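(* Let $\mathfrak g$ be a finite-dimensional simple Lie algebra over an algebraically closed field $F$ of characteristic $0$, with Cartan subalgebra $\mathfrak h$, root system $\Delta$ and root spaces $\mathfrak g_\alpha$. Given an $m$-regular partition $\Delta=S_1\sqcup\dots\sqcup S_m$ with $m\ge3$, there exist subspaces $\mathfrak s_1,\dots,\mathfrak s_m\subseteq\mathfrak h$ (not unique in general) such that $$\mathfrak g=\bigoplus_{i=1}^m\Big(\mathfrak s_i\oplus\bigoplus_{\alpha\in S_i}\mathfrak g_\alpha\Big)$$ is a regular decomposition. Conversely, by forgetting the Cartan part of an $m$-regular decomposition of $\mathfrak g$ (i.e. passing from $\mathfrak g_i=\mathfrak s_i\oplus\bigoplus_{\alpha\in\Delta_i}\mathfrak g_\alpha$ to $\Delta_i$ for all $i$) one obtains an $m$-regular partition of $\Delta$.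
   Context: A subset $S\subseteq\Delta$ is closed if $\alpha,\beta\in S$ and $\alpha+\beta\in\Delta$ imply $\alpha+\beta\in S$. For $m\ge 2$, an $m$-regular partition of $\Delta$ is a partition $\Delta=\bigsqcup_{i=1}^m\Delta_i$ into $m$ nonempty subsets such that all $\Delta_i$ and all $\Delta_i\sqcup\Delta_j$ ($i\neq j$) are closed. For $m\ge2$, an $m$-regular decomposition of $\mathfrak g$ is a direct sum decomposition (of vector spaces) $\mathfrak g=\bigoplus_{i=1}^m\mathfrak g_i$ with nonzero summands such that all $\mathfrak g_i$ and all $\mathfrak g_i\oplus\mathfrak g_j$ ($i\ne j$) are Lie subalgebras of $\mathfrak g$, and each $\mathfrak g_i$ has the form $\mathfrak s_i\oplus\bigoplus_{\alpha\in\Delta_i}\mathfrak g_\alpha$ for some subspace $\mathfrak s_i\subseteq\mathfrak h$ and some subset $\Delta_i\subseteq\Delta$. *)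

(* Defs.v *)
From HB Require Import structures.
From mathcomp Require Import all_boot all_order all_algebra.
From mathcomp Require Import finmap.

Set Implicit Arguments.
Unset Strict Implicit.
Unset Printing Implicit Defensive.

Import GRing.Theory.
Local Open Scope ring_scope.

(* Every vectType is finite-dimensional, hence so is every lieAlgType. *)
HB.mixin Record Vector_isLieAlgebra (F : fieldType) L of Vector F L := {
  lie : L -> L -> L;
  lie_linearl : forall y : L, linear (lie^~ y);
  lie_linearr : forall x : L, linear (lie x);
  liexx : forall x : L, lie x x = 0;
  lie_jacobi : forall x y z : L,
    lie x (lie y z) + lie y (lie z x) + lie z (lie x y) = 0
}.

#[short(type="lieAlgType")]
HB.structure Definition LieAlgebra (F : fieldType) :=
  { L of Vector_isLieAlgebra F L & Vector F L }.

Section LieAlgebraTheory.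
Variables (F : fieldType) (L : lieAlgType F).
Implicit Types (U V W h : {vspace L}) (x y : L).

HB.instance Definition _ (x : L) :=
  GRing.isLinear.Build F L L *:%R (lie x) (@lie_linearr F L x).

Definition lier y x : L := lie x y.

HB.instance Definition _ (y : L) :=
  GRing.isLinear.Build F L L *:%R (lier y) (@lie_linearl F L y).

Lemma lie_suml I (r : seq I) (f : I -> L) y :
  lie (\sum_(i <- r) f i) y = \sum_(i <- r) lie (f i) y.
Proof. exact: (linear_sum (lier y)). Qed.

Lemma lieZl (c : F) x y : lie (c *: x) y = c *: lie x y.
Proof. exact: (linearZ_LR (lier y)). Qed.

Definition ad x : 'End(L) := linfun (lie x).

Lemma adE x y : ad x y = lie x y.
Proof. by rewrite lfunE. Qed.

Definition lie_prodv U V : {vspace L} :=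
  <<[seq lie u v | u <- vbasis U, v <- vbasis V]>>%VS.

Lemma memv_lie U V x y : x \in U -> y \in V -> lie x y \in lie_prodv U V.
Proof.
move=> xU yV; rewrite (coord_vbasis xU) (coord_vbasis yV).
rewrite lie_suml memv_suml // => i _.
rewrite lieZl memvZ // linear_sum memv_suml // => j _.
rewrite linearZ memvZ // memv_span //.
by apply: allpairs_f; rewrite mem_nth // size_tuple.
Qed.

Lemma lie_prodvP U V W :
  reflect (forall x y, x \in U -> y \in V -> lie x y \in W)
          (lie_prodv U V <= W)%VS.
Proof.
apply: (iffP idP) => [sW x y xU yV | sW].
  exact: (subvP sW) (memv_lie xU yV).
apply/span_subvP => _ /allpairsP[[u v] [uU vV ->]].
by apply: sW; apply: vbasis_mem.
Qed.

Definition lie_subalgebra U : Prop := {in U &, forall x y, lie x y \in U}.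

Definition lie_ideal U : Prop := forall x y, y \in U -> lie x y \in U.

Definition lie_simple : Prop :=
  (exists x y : L, lie x y != 0) /\
  (forall U, lie_ideal U -> U = 0%VS \/ U = fullv).

Fixpoint lower_central U n : {vspace L} :=
  if n is k.+1 then lie_prodv U (lower_central U k) else U.

Definition lie_nilpotent U : Prop := exists n, lower_central U n = 0%VS.

Definition cartan_subalgebra h : Prop :=
  [/\ lie_subalgebra h,
      lie_nilpotent h
    & forall x, {in h, forall y, lie x y \in h} -> x \in h].

Definition dual_space h := 'Hom(subvs_of h, F^o).

(* The simultaneous eigenspace {x | [y, x] = a(y) x for all y in h}: it is    *)
(* enough to let y run through a basis of h (root_spaceP).                    *)
Definition root_space h (a : dual_space h) : {vspace L} :=
  (\bigcap_(y <- vbasis h) lker (ad y - (a (vsproj h y) : F) *: \1%VF))%VS.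

Lemma root_spaceP h (a : dual_space h) x :
  reflect {in h, forall y, lie y x = (a (vsproj h y) : F) *: x}
          (x \in root_space a).
Proof.
have memE (r : seq L) : (x \in \bigcap_(y <- r)
    lker (ad y - (a (vsproj h y) : F) *: \1%VF))%VS
    = all (fun y => lie y x == (a (vsproj h y) : F) *: x) r.
  elim: r => [|y r IHr]; first by rewrite big_nil memvf.
  by rewrite big_cons memv_cap IHr memv_ker add_lfunE opp_lfunE scale_lfunE
    adE id_lfunE subr_eq0.
rewrite /root_space memE; apply: (iffP allP) => [ev y yh | ev y yB].
  rewrite (coord_vbasis yh) lie_suml !linear_sum scaler_suml.
  apply: eq_bigr => i _; rewrite lieZl !linearZ /= -scalerA.
  by congr (_ *: _); apply/eqP/ev; rewrite mem_nth // size_tuple.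
by apply/eqP/ev/vbasis_mem.
Qed.

Definition root_system h : {pred dual_space h} :=
  [pred a | (a != 0) && (root_space a != 0%VS)].

End LieAlgebraTheory.

Arguments lie_simple {F} L.
Arguments root_system {F L} h _.

Section RegularPartition.
Variables (V : zmodType) (Delta : {pred V}).

Definition closed_subset (S : {fset V}) : Prop :=
  forall a b, a \in S -> b \in S -> a + b \in Delta -> a + b \in S.

(* Only finite parts are considered: this is no restriction for a root system *)
(* of a finite-dimensional Lie algebra, which is a finite set.                *)
Definition regular_partition m (S : 'I_m -> {fset V}) : Prop :=
  [/\ (2 <= m)%N,
      (forall a, (a \in Delta) = [exists i, a \in S i])
        /\ (forall i j, i != j -> [disjoint S i & S j]%fset),
      (forall i, S i != fset0),
      (forall i, closed_subset (S i))
    & (forall i j, i != j -> closed_subset (S i `|` S j)%fset)].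

End RegularPartition.

Section RegularDecomposition.
Variables (F : fieldType) (L : lieAlgType F) (h : {vspace L}).

(* U is the internal direct sum of s and of the root spaces of the a in A. *)
Definition regular_form (U s : {vspace L}) (A : {fset dual_space h}) : Prop :=
  [/\ (s <= h)%VS,
      {subset A <= root_system h},
      U = (s + \sum_(a <- A) root_space a)%VS
    & directv (s + \sum_(a <- A) root_space a)].

Definition regular_decomposition m (g : 'I_m -> {vspace L}) : Prop :=
  [/\ (2 <= m)%N,
      (\sum_i g i)%VS = fullv /\ directv (\sum_i g i),
      (forall i, g i != 0%VS),
      (forall i, lie_subalgebra (g i))
        /\ (forall i j, i != j -> lie_subalgebra (g i + g j)%VS)
    & (forall i, exists s A, regular_form (g i) s A)].

Definition cartan_completion m (S : 'I_m -> {fset dual_space h})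
    (s : 'I_m -> {vspace L}) : Prop :=
  exists2 g : 'I_m -> {vspace L},
    regular_decomposition g & forall i, regular_form (g i) (s i) (S i).

End RegularDecomposition.

(* Main.v *)
From HB Require Import structures.
From Stdlib Require Import Classical ClassicalEpsilon.
Require Import Defs.
From mathcomp Require Import all_boot all_order all_algebra.
From mathcomp Require Import finmap ring.

Set Implicit Arguments.
Unset Strict Implicit.
Unset Printing Implicit Defensive.

Import GRing.Theory.
Local Open Scope ring_scope.

(** Structure of L. Killing form arguments in which every string computation is
    replaced by "a commutator of operators preserving a subspace has trace 0
    there" show that the Cartan subalgebra h is abelian and acts diagonally,
    that root spaces are lines, and that [L_a, L_b] <> 0 whenever a, b and a + b
    are roots.  The last fact makes the parts S_i closed in the converse.

    Existence. Let c(a) be the index of the part containing the root a, so that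
    c(a + b) is c(a) or c(b), and let a have type (c(a), c(-a)).  Since the
    centralizer of a set of root spaces normalized by all the others is an
    ideal, simplicity and the presence of a third part exclude a, b, a + b
    of a common type (i, j), i <> j; hence a |-> e_{c(-a)} - e_{c(a)} is additive
    on roots.  Put T_a = [L_a, L_-a] and let A_i be the sum of the T_a with a of
    type (i, i).  Simplicity again gives roots e_i - e_j of every type (i, j)
    with e_k = 0 for some k, and T_a <= T_(e_i - e_j) + A_i + A_j for all a of type
    (i, j).  So s_i = A_i + T_(e_i) (without the second term for i = k) contains
    what it must.  The sum is direct: the forms t |-> tr (D_i ad t), with D_i the
    derivation acting on L_a by the i-th coordinate of the degree of a, isolate the
    components in the T_(e_i); and if \sum_i a_i = 0 with a_i in A_i, then a_i
    commutes with the root spaces of type (i, i), so all its weights vanish by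
    traces.

    Non-uniqueness. Exchanging the roles of c(a) and c(-a) for a single root a
    with c(a) <> c(-a) changes k, and with it the spaces s_i.  An example with
    m = 3 is sl_3, the roots e_j - e_i being put in the part i. *)

(** * Traces of endomorphisms *)

(** The spaces s_i are tied to the partition only by brackets of opposite root spaces: T_a must lie
    in s_i if a and -a are in S_i, and in s_i + s_j if a is in S_i and -a in S_j. The difficulty is
    to meet all conditions of the second kind with a direct sum. The degree map takes values in the
    root lattice of type A_(m-1), so modulo the A_i the lines T_a behave like the coroots of that
    system, which span m - 1 dimensions: m - 1 lines T_(e_i) are distributed over m indices, and one
    index k gets none. A third part is indispensable: for m = 2 the positive and the negative roots
    form a regular partition in which positive roots a, b, a + b have a common type.

    Simplicity enters the combinatorics in one form: given a nonempty set of roots, stable under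
    opposites and absorbing sums with the roots outside it, every root has a partner in the set such
    that their sum is a root or 0. Instead of inner products of roots, the other tool is the Jacobi
    identity: if a + b and a + b + c are roots, then a + c or b + c is a root or 0. *)

Section PredSpace.
Variables (F : fieldType) (V : vectType F).

(** Enlarging a subspace inside the predicate by a missing vector raises its dimension, so the
    process stops. In this way ideals, centralizers and weight spaces given by propositions become
    subspaces. *)
Lemma pred_vspace (P : V -> Prop) :
  P 0 -> (forall (c : F) u v, P u -> P v -> P (c *: u + v)) ->
  exists U : {vspace V}, forall v, v \in U <-> P v.
Proof.
move=> P0 PZD; suff: forall n (U : {vspace V}), (forall v, v \in U -> P v) ->
    (\dim {:V} - \dim U <= n)%N ->
    exists W : {vspace V}, forall v, v \in W <-> P v.
  move=> /(_ (\dim {:V}) 0%VS); apply; last by rewrite dimv0 subn0.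
  by move=> v; rewrite memv0 => /eqP ->.
elim=> [|n IHn] U sUP dimU.
  exists U => v; split=> [/sUP //|_].
  suff -> : U = fullv by rewrite memvf.
  by apply/eqP; rewrite eqEdim subvf -subn_eq0 -leqn0.
have [[v [Pv vU]]|nex] := classic (exists v, P v /\ v \notin U); last first.
  exists U => v; split=> [/sUP //|Pv].
  by apply/negPn/negP => vU; case: nex; exists v.
apply: (IHn (U + <[v]>)%VS).
  move=> w /memv_addP[u /sUP Pu [x /vlineP[c ->] ->]].
  by rewrite addrC; apply: PZD.
suff lt : (\dim U < \dim (U + <[v]>)%VS)%N.
  rewrite leq_subLR in dimU; rewrite leq_subLR (leq_trans dimU) //.
  by rewrite addnS -addSn leq_add2r.
rewrite ltnNge; apply/negP => le; case/negP: vU.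
have /eqP -> : U == (U + <[v]>)%VS by rewrite eqEdim addvSl.
by rewrite (subvP (addvSr _ _)) // memv_line.
Qed.

End PredSpace.

Section Trace.
Import VectorInternalTheory.
Variables (F : fieldType) (V : vectType F).
Implicit Types (f g P : 'End(V)) (U W : {vspace V}).

Definition lftr f : F := \tr (f2mx f).

Lemma f2mxE f v : v2r (f v) = v2r v *m f2mx f.
Proof. by rewrite unlock /= r2vK. Qed.

Lemma f2mx_ext f (A : 'M_(_, _)) :
  (forall v, v2r (f v) = v2r v *m A) -> f2mx f = A.
Proof.
move=> fE; apply/row_matrixP => i; rewrite !rowE.
by rewrite -[delta_mx 0 i]r2vK -f2mxE fE.
Qed.

Lemma f2mx_comp f g : f2mx (f \o g)%VF = f2mx g *m f2mx f.
Proof. by apply: f2mx_ext => v; rewrite comp_lfunE !f2mxE mulmxA. Qed.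

Lemma lftr_is_scalar : scalar lftr.
Proof.
move=> c f g; rewrite /lftr -linearP; congr (\tr _).
by apply: f2mx_ext => v; rewrite add_lfunE scale_lfunE linearP /= !f2mxE
  mulmxDr -scalemxAr.
Qed.

Lemma lftrD f g : lftr (f + g) = lftr f + lftr g.
Proof. by have := lftr_is_scalar 1 f g; rewrite scale1r mul1r. Qed.

Lemma lftr0 : lftr 0 = 0.
Proof. by apply: (addrI (lftr 0)); rewrite -lftrD !addr0. Qed.

Lemma lftrZ c f : lftr (c *: f) = c * lftr f.
Proof. by have := lftr_is_scalar c f 0; rewrite lftr0 !addr0. Qed.

Lemma lftrN f : lftr (- f) = - lftr f.
Proof. by rewrite -scaleN1r lftrZ mulN1r. Qed.

Lemma lftrB f g : lftr (f - g) = lftr f - lftr g.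
Proof. by rewrite lftrD lftrN. Qed.

Lemma lftr_sum (I : Type) (r : seq I) (f : I -> 'End(V)) :
  lftr (\sum_(i <- r) f i) = \sum_(i <- r) lftr (f i).
Proof. exact: (big_morph _ lftrD lftr0). Qed.

Lemma lftrC f g : lftr (f \o g)%VF = lftr (g \o f)%VF.
Proof. by rewrite /lftr !f2mx_comp mxtrace_mulC. Qed.

(** The trace of f on a stable subspace U is taken as the trace of f composed on the right with a
    projector onto U; any projector may serve. *)
Definition projector_on P U :=
  (forall v, P v \in U) /\ (forall v, v \in U -> P v = v).

Lemma projector_on_projv U : projector_on (projv U) U.
Proof. by split=> [v|v vU]; [exact: memv_proj | exact: projv_id]. Qed.

(** With a full rank factorization A = C R, idempotence gives R C = 1, and C R has the trace of R
    C. *)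
Lemma mxtrace_idem n (A : 'M[F]_n) : A *m A = A -> \tr A = (\rank A)%:R.
Proof.
move=> AA; rewrite -{1}(mulmx_base A) mxtrace_mulC.
suff -> : row_base A *m col_base A = 1%:M by rewrite mxtrace1.
apply: (row_full_inj (col_base_full A)).
apply: (row_free_inj (row_base_free A)); rewrite /= mulmx1.
by rewrite (mulmxA (col_base A)) -mulmxA mulmx_base AA.
Qed.

Lemma lftr_projector P U : projector_on P U -> lftr P = (\dim U)%:R.
Proof.
case=> PU Pid; rewrite /lftr mxtrace_idem; last first.
  by rewrite -f2mx_comp; congr f2mx; apply/lfunP => v; rewrite comp_lfunE Pid.
have -> : U = limg P.
  apply/eqP; rewrite eqEsubv; apply/andP; split; apply/subvP => v.
    by move=> /Pid <-; rewrite memv_img ?memvf.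
  by case/memv_imgP=> u _ ->.
have := limg_ker_dim P fullv; rewrite capfv dimvf {1}/dimv mx2vsK mxrank_ker.
move=> dimE; congr (_%:R); apply: (@addnI (dim V - \rank (f2mx P))%N).
by rewrite dimE subnK // rank_leq_row.
Qed.

(** On a stable subspace restrictions multiply, (a b) P = (a P) (b P), so this is the trace of a
    commutator of two endomorphisms. *)
Lemma lftr_comm_stable P U f g : projector_on P U ->
  (forall v, v \in U -> f v \in U) -> (forall v, v \in U -> g v \in U) ->
  lftr (((f \o g) - (g \o f)) \o P)%VF = 0.
Proof.
case=> PU Pid fU gU; apply/eqP; rewrite comp_lfunDl comp_lfunNl lftrB subr_eq0.
have E (a b : 'End(V)) : (forall v, v \in U -> b v \in U) ->
    ((a \o b) \o P = (a \o P) \o (b \o P))%VF.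
  by move=> bU; apply/lfunP => v; rewrite !comp_lfunE [P (b _)]Pid // bU.
by rewrite (E f g) // (E g f) //= lftrC.
Qed.

(** Inserting the projector onto f(U) on the left and using cyclicity gives the trace of f on f(U),
    which is smaller than U because f has a nonzero kernel there. *)
Lemma lftr_nilpotent P U f : projector_on P U ->
  (forall v, v \in U -> f v \in U) ->
  (forall v, v \in U -> exists n, iter n f v = 0) ->
  lftr (f \o P)%VF = 0.
Proof.
have [n] := ubnP (\dim U); elim: n => // n IHn in P U *; rewrite ltnS => leUn.
case=> PU Pid fU nilf.
have [U0|Un0] := eqVneq U 0%VS.
  suff -> : (f \o P)%VF = 0 by rewrite lftr0.
  apply/lfunP => v; rewrite comp_lfunE zero_lfunE.
  by have:= PU v; rewrite U0 memv0 => /eqP ->; rewrite linear0.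
have sfU : (f @: U <= U)%VS.
  by apply/subvP => _ /memv_imgP[v vU ->]; apply: fU.
have ltU : (\dim (f @: U) < \dim U)%N.
  rewrite -(limg_ker_dim f U) addnC -[X in (X < _)%N]addn0 ltn_add2l lt0n dimv_eq0.
  apply/negP => /eqP ker0; case/negP: Un0; rewrite -subv0; apply/subvP => v vU.
  have [k] := nilf v vU; elim: k v vU => [|k IHk] v vU /=; first by move=> ->; rewrite mem0v.
  rewrite -iterS iterSr => /(IHk _ (fU _ vU)) fv0; rewrite -ker0 memv_cap vU memv_ker.
  by rewrite memv0 in fv0.
have [QW Qid] := projector_on_projv (f @: U).
have -> : (f \o P = projv (f @: U) \o (f \o P))%VF.
  by apply/lfunP => v; rewrite !comp_lfunE Qid // memv_img.
rewrite lftrC -comp_lfunA.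
have -> : (P \o projv (f @: U) = projv (f @: U))%VF.
  by apply/lfunP => v; rewrite !comp_lfunE Pid // (subvP sfU).
apply: (IHn _ (f @: U)%VS); first exact: leq_trans ltU leUn.
- by split.
- by move=> v /(subvP sfU) vU; rewrite memv_img.
- by move=> v /(subvP sfU); apply: nilf.
Qed.

End Trace.

(** * Generalized eigenspaces *)

Section GeneralizedEigen.
Variables (F : fieldType) (V : vectType F).
Implicit Types (f : 'End(V)) (a b : F) (u v w : V) (U : {vspace V}).

Lemma iter_lfunP f n c u v : iter n f (c *: u + v) = c *: iter n f u + iter n f v.
Proof. by elim: n => //= n ->; rewrite linearP. Qed.

Lemma iter_lfun0 f n : iter n f 0 = 0.
Proof. by elim: n => //= n ->; rewrite linear0. Qed.

Lemma iter_lfun0_le f m n v : (m <= n)%N -> iter m f v = 0 -> iter n f v = 0.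
Proof. by move=> /subnK <- fv0; rewrite iterD fv0 iter_lfun0. Qed.

Definition shift f a : 'End(V) := f - a *: \1%VF.

Lemma shiftE f a v : shift f a v = f v - a *: v.
Proof. by rewrite add_lfunE opp_lfunE scale_lfunE id_lfunE. Qed.

Definition gen_eigen f a v := exists n, iter n (shift f a) v = 0.

Lemma gen_eigen0 f a : gen_eigen f a 0.
Proof. by exists 0. Qed.

Lemma gen_eigenP f a c u v :
  gen_eigen f a u -> gen_eigen f a v -> gen_eigen f a (c *: u + v).
Proof.
move=> [m um] [n vn]; exists (maxn m n); rewrite iter_lfunP.
by rewrite (iter_lfun0_le (leq_maxl m n) um) (iter_lfun0_le (leq_maxr m n) vn) scaler0 addr0.
Qed.

Lemma gen_eigen_stable f a v : gen_eigen f a v -> gen_eigen f a (f v).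
Proof.
case=> n vn; have -> : f v = a *: v + shift f a v by rewrite shiftE addrC subrK.
by apply: gen_eigenP; exists n => //; rewrite -iterSr /= vn linear0.
Qed.

Lemma eigen_iter f a b n v : f v = a *: v ->
  iter n (shift f b) v = (a - b) ^+ n *: v.
Proof.
move=> fv; elim: n => [|n IHn]; first by rewrite expr0 scale1r.
by rewrite iterS IHn linearZ /= shiftE fv -scalerBl scalerA -exprSr.
Qed.

Lemma gen_eigen_unique f a b v :
  a != b -> gen_eigen f a v -> gen_eigen f b v -> v = 0.
Proof.
move=> neq_ab [n]; elim: n => [|n IHn] in v *; first by [].
rewrite iterSr => vn bv; have : shift f a v = 0.
  apply: IHn => //; rewrite shiftE addrC -scaleNr; apply: gen_eigenP => //.
  exact: gen_eigen_stable.
move/eqP; rewrite shiftE subr_eq0 => /eqP fv; case: bv => m.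
rewrite (eigen_iter _ _ fv) => /eqP.
by rewrite scaler_eq0 expf_eq0 subr_eq0 (negPf neq_ab) andbF => /eqP.
Qed.

(** If w solves (f - a) w = (f - b) u, then (b - a)^-1 (u - w) solves the equation for u; the
    exponent killing (f - b) u is one less. *)
Lemma gen_eigen_shift_onto f a b U u : a != b ->
  (forall v, v \in U -> f v \in U) -> u \in U -> gen_eigen f b u ->
  exists w, [/\ w \in U, gen_eigen f b w & shift f a w = u].
Proof.
move=> neq_ab fU uU [n]; elim: n => [|n IHn] in u uU *.
  by move=> /= ->; exists 0; rewrite mem0v linear0; split=> //; apply: gen_eigen0.
rewrite iterSr => un.
have bU : shift f b u \in U by rewrite shiftE rpredB ?rpredZ ?fU.
have [w [wU gw wE]] := IHn _ bU un.
have ba0 : b - a != 0 by rewrite subr_eq0 eq_sym.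
exists ((b - a)^-1 *: (- w + u)); split.
- by rewrite rpredZ // rpredD ?rpredN.
- have gu : gen_eigen f b u by exists n.+1; rewrite iterSr.
  rewrite -[_ *: _]addr0; apply: gen_eigenP; last exact: gen_eigen0.
  by rewrite -scaleN1r; apply: gen_eigenP.
- rewrite linearZ linearD linearN /= wE !shiftE opprB addrA subrK -scalerBl.
  by rewrite scalerA mulVf // scale1r.
Qed.

Fixpoint killed f (s : seq F) v : Prop :=
  if s is a :: s' then killed f s' (shift f a v) else v = 0.

Lemma primary_killed f s U v :
  (forall v, v \in U -> f v \in U) -> v \in U -> killed f s v ->
  exists2 t : seq (F * V), (forall p, p \in t -> p.2 \in U /\ gen_eigen f p.1 p.2)
    & v = \sum_(p <- t) p.2.
Proof.
move=> fU; elim: s => [|a s IHs] in v *.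
  by move=> _ /= ->; exists [::]; rewrite ?big_nil.
move=> vU /IHs []; first by rewrite shiftE rpredB ?rpredZ ?fU.
move=> t tP vE.
(* The components of [shift f a v] for eigenvalues other than a are lifted through [shift f a];
   those for a are left out, and the remainder is then a generalized eigenvector for a. *)
suff [t' t'P] : exists2 t' : seq (F * V),
    (forall p, p \in t' -> p.2 \in U /\ gen_eigen f p.1 p.2)
    & gen_eigen f a (shift f a v - shift f a (\sum_(p <- t') p.2)).
  rewrite -linearB; set z := v - _ => gz; exists ((a, z) :: t'); last by rewrite big_cons subrK.
  move=> p; rewrite inE => /orP[/eqP ->|/t'P //] /=; split.
    by rewrite rpredB // big_seq memv_suml // => q /t'P[].
  by case: gz => n; rewrite -iterSr => zn; exists n.+1.
rewrite {}vE; elim: t tP => [|[b u] t IHt] tP.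
  by exists [::] => //; rewrite !big_nil linear0 subr0; apply: gen_eigen0.
have [|t' t'P gt] := IHt; first by move=> p pt; apply: tP; rewrite inE pt orbT.
have [uU gu] : u \in U /\ gen_eigen f b u by apply: (tP (b, u)); rewrite inE eqxx.
have [ab|neq_ab] := eqVneq a b.
  exists t' => //; rewrite big_cons /= -addrA -[u]scale1r; apply: gen_eigenP => //.
  by rewrite ab.
have [w [wU gw wE]] := gen_eigen_shift_onto neq_ab fU uU gu.
exists ((b, w) :: t'); first by move=> p; rewrite inE => /orP[/eqP ->|/t'P].
by rewrite !big_cons linearD /= wE opprD addrACA subrr add0r.
Qed.

End GeneralizedEigen.

Section PrimaryDecomposition.
Import VectorInternalTheory.
Variables (F : closedFieldType) (V : vectType F).

(** Cayley-Hamilton: over a closed field the characteristic polynomial splits, and its roots are the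
    required scalars. *)
Lemma exists_killed (f : 'End(V)) (v : V) : exists s, killed f s v.
Proof.
suff matP n (A : 'M[F]_n) (x : 'rV_n) : exists s : seq F,
    x *m \big[mulmx/1%:M]_(a <- s) (A - a%:M) = 0.
  have [s sP] := matP _ (f2mx f) (v2r v); exists s.
  elim: s v sP => [|a s IHs] v /=.
    by rewrite big_nil mulmx1 => v0; apply: v2r_inj; rewrite v0 linear0.
  rewrite big_cons mulmxA => sP; apply: IHs; rewrite -sP; congr (_ *m _).
  by rewrite shiftE linearB linearZ /= f2mxE mulmxBr mul_mx_scalar.
case: n A x => [|n] A x; first by exists [::]; exact: thinmx0.
have [s sE] := closed_field_poly_normal (char_poly A).
exists s; have := Cayley_Hamilton A; rewrite sE.
rewrite (monicP (char_poly_monic A)) scale1r.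
rewrite rmorph_prod /= => H; rewrite -[RHS](mulmx0 _ x) -H; congr (_ *m _).
apply: eq_bigr => a _; by rewrite rmorphB /= horner_mx_X horner_mx_C.
Qed.

Lemma primary_decomposition (f : 'End(V)) (U : {vspace V}) v :
  (forall v, v \in U -> f v \in U) -> v \in U ->
  exists2 t : seq (F * V), (forall p, p \in t -> p.2 \in U /\ gen_eigen f p.1 p.2)
    & v = \sum_(p <- t) p.2.
Proof. by move=> fU vU; have [s] := exists_killed f v; apply: primary_killed. Qed.

End PrimaryDecomposition.

(** * Weights of a nilpotent subalgebra *)

Section LieBasics.
Variables (F : fieldType) (L : lieAlgType F).
Implicit Types (x y z u v : L) (U : {vspace L}).

Lemma lieDl x y z : lie (x + y) z = lie x z + lie y z.
Proof. exact: (linearD (lier z)). Qed.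

Lemma lieDr x y z : lie x (y + z) = lie x y + lie x z.
Proof. exact: linearD. Qed.

Lemma lie0l x : lie 0 x = 0.
Proof. exact: (linear0 (lier x)). Qed.

Lemma lie0r x : lie x 0 = 0.
Proof. exact: linear0. Qed.

Lemma lieNl x y : lie (- x) y = - lie x y.
Proof. exact: (linearN (lier y)). Qed.

Lemma lieNr x y : lie x (- y) = - lie x y.
Proof. exact: linearN. Qed.

Lemma lieZr c x y : lie x (c *: y) = c *: lie x y.
Proof. exact: linearZ. Qed.

Lemma lie_sumr I (r : seq I) (f : I -> L) x :
  lie x (\sum_(i <- r) f i) = \sum_(i <- r) lie x (f i).
Proof. exact: linear_sum. Qed.

Lemma lieC x y : lie x y = - lie y x.
Proof.
have := liexx (x + y); rewrite lieDl !lieDr !liexx addr0 add0r => /eqP.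
by rewrite addr_eq0 => /eqP.
Qed.

Lemma lie_jacobiE x y z : lie x (lie y z) = lie (lie x y) z + lie y (lie x z).
Proof.
have /eqP := lie_jacobi x y z; rewrite [lie z x]lieC lieNr [lie z _]lieC.
by rewrite -addrA addr_eq0 opprD !opprK addrC => /eqP.
Qed.

Lemma lie_jacobiE2 x y z : lie (lie x y) z = lie x (lie y z) - lie y (lie x z).
Proof. by rewrite lie_jacobiE addrK. Qed.

Lemma ad_lie x y : ad (lie x y) = ((ad x \o ad y) - (ad y \o ad x))%VF.
Proof.
by apply/lfunP => z; rewrite add_lfunE opp_lfunE !comp_lfunE !adE lie_jacobiE2.
Qed.

Lemma adP c x y : ad (c *: x + y) = c *: ad x + ad y.
Proof.
by apply/lfunP => z; rewrite add_lfunE scale_lfunE !adE lieDl lieZl.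
Qed.

Lemma adD x y : ad (x + y) = ad x + ad y.
Proof. by rewrite -[x]scale1r adP !scale1r. Qed.

(** The operator ad x - (a + b) obeys a Leibniz rule, acting as ad x - a on the first factor and ad
    x - b on the second, so its power m + n kills the bracket. *)
Lemma gen_eigen_lie x a b u v :
  gen_eigen (ad x) a u -> gen_eigen (ad x) b v -> gen_eigen (ad x) (a + b) (lie u v).
Proof.
case=> m um [n vn]; exists (m + n)%N.
have [k] := ubnPleq (m + n); elim: k => [|k IHk] in m n u v um vn *.
  rewrite leqn0 addn_eq0 => /andP[/eqP m0 _].
  by move: um; rewrite m0 /= => ->; rewrite lie0l.
have shiftL : shift (ad x) (a + b) (lie u v) =
    lie (shift (ad x) a u) v + lie u (shift (ad x) b v).
  rewrite !shiftE !adE lie_jacobiE !lieDl !lieDr lieNl lieNr lieZl lieZr.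
  by rewrite scalerDl opprD addrACA.
case: m um => [|m] um; first by rewrite (um : u = 0) lie0l iter_lfun0.
case: n vn => [|n] vn; first by rewrite (vn : v = 0) lie0r iter_lfun0.
move=> le; rewrite iterSr shiftL -[lie _ v]scale1r iter_lfunP.
rewrite (IHk m n.+1) ?scaler0 ?add0r -?iterSr //.
by rewrite (IHk m.+1 n) -?iterSr // addSnnS.
Qed.

Lemma shift0 (f : 'End(L)) : shift f 0 = f.
Proof. by rewrite /shift scale0r subr0. Qed.

Lemma simple_ideal (P : L -> Prop) : lie_simple L ->
  P 0 -> (forall (c : F) u v, P u -> P v -> P (c *: u + v)) ->
  (forall x y, P y -> P (lie x y)) ->
  (forall v, P v -> v = 0) \/ (forall v, P v).
Proof.
move=> [_ simL] P0 PZD PI; have [U UP] := pred_vspace P0 PZD.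
have [|U0|UT] := simL U; first by move=> x y /UP /PI /UP.
  by left=> v /UP; rewrite U0 memv0 => /eqP.
by right=> v; apply/UP; rewrite UT memvf.
Qed.

Lemma simple_center x : lie_simple L -> (forall y, lie x y = 0) -> x = 0.
Proof.
move=> simL x0; have [|||E|E] := simple_ideal (P := fun x => forall y, lie x y = 0) simL.
- exact: lie0l.
- by move=> c u v u0 v0 y; rewrite lieDl lieZl u0 v0 scaler0 addr0.
- by move=> y z z0 t; rewrite lie_jacobiE2 !z0 lie0r subrr.
- exact: E.
by have [[u [v /eqP uv0]] _] := simL; case: uv0; apply: E.
Qed.

Lemma simple_not_nilpotent : lie_simple L -> ~ lie_nilpotent (fullv : {vspace L}).
Proof.
move=> simL; have full : lie_prodv fullv fullv = fullv :> {vspace L}.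
  have [[x [y xy0]] idL] := simL.
  have [|L0 //|//] := idL (lie_prodv fullv fullv).
    by move=> u v _; apply: memv_lie; rewrite memvf.
  by case/eqP: xy0; apply/eqP; rewrite -memv0 -L0 memv_lie ?memvf.
case=> n; have -> : lower_central fullv n = fullv :> {vspace L}.
  by elim: n => //= n ->.
have [[x [y /negP xy0]] _] := simL.
by move=> L0; case: xy0; rewrite -memv0 -L0 memvf.
Qed.

End LieBasics.

Section CharZero.
Variables (F : fieldType) (charF0 : [pchar F] =i pred0).

Lemma natf0 n : (n%:R == 0 :> F) = (n == 0%N).
Proof. exact: (pcharf0P F).1. Qed.

End CharZero.

Section Weights.
Variables (F : closedFieldType) (charF0 : [pchar F] =i pred0).
Variables (L : lieAlgType F) (h : {vspace L}).
Implicit Types (x y z u v : L) (U : {vspace L}) (a b : dual_space h).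

Definition ev a x : F := a (vsproj h x).

Lemma evD a b x : ev (a + b) x = ev a x + ev b x.
Proof. by rewrite /ev add_lfunE. Qed.

Lemma evN a x : ev (- a) x = - ev a x.
Proof. by rewrite /ev opp_lfunE. Qed.

Lemma ev0 x : ev 0 x = 0.
Proof. by rewrite /ev zero_lfunE. Qed.

Lemma evP a c x y : ev a (c *: x + y) = c * ev a x + ev a y.
Proof. by rewrite /ev !linearP. Qed.

Lemma ev_addr a x y : ev a (x + y) = ev a x + ev a y.
Proof. by rewrite -[x]scale1r evP mul1r scale1r. Qed.

Lemma ev_neq a b : a != b -> exists2 x, x \in h & ev a x != ev b x.
Proof.
move=> neq_ab; have [y yab] : exists y : subvs_of h, a y != b y by apply/lfunPn.
by exists (vsval y); [exact: subvsP | rewrite /ev vsvalK].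
Qed.

Definition weight_vector a v := forall x, x \in h -> gen_eigen (ad x) (ev a x) v.

Lemma weight_space_exists a : exists U : {vspace L}, forall v, v \in U <-> weight_vector a v.
Proof.
apply: pred_vspace; first by move=> x _; apply: gen_eigen0.
by move=> c u v uP vP x xh; apply: gen_eigenP; [apply: uP | apply: vP].
Qed.

Definition weight_space a : {vspace L} :=
  sval (constructive_indefinite_description _ (weight_space_exists a)).

Lemma weight_spaceP a v : v \in weight_space a <-> weight_vector a v.
Proof. by rewrite /weight_space; case: constructive_indefinite_description. Qed.

Lemma weight_space_lie a b u v :
  u \in weight_space a -> v \in weight_space b -> lie u v \in weight_space (a + b).
Proof.
move=> /weight_spaceP uP /weight_spaceP vP; apply/weight_spaceP => x xh.
by rewrite evD; apply: gen_eigen_lie; [apply: uP | apply: vP].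
Qed.

Hypotheses (subh : lie_subalgebra h) (nilh : lie_nilpotent h).

Lemma h_weight0 y : y \in h -> y \in weight_space 0.
Proof.
move=> yh; apply/weight_spaceP => x xh; have [n hn] := nilh; exists n.
rewrite ev0 shift0; apply/eqP; rewrite -memv0 -hn.
by elim: n {hn} => //= n IHn; rewrite adE memv_lie.
Qed.

Lemma weight_space_stable a x v :
  x \in h -> v \in weight_space a -> lie x v \in weight_space a.
Proof. by move=> xh vW; rewrite -[a]add0r weight_space_lie // h_weight0. Qed.

(** The candidate weight is the average eigenvalue tr (ad x) / dim U, linear in x by construction. A
    single generalized eigenvalue of ad x must agree with it, since ad x minus that eigenvalue is
    nilpotent on U. This plays the role of Lie's theorem. *)
Lemma weight_of_stable U : U != 0%VS ->
  (forall x u, x \in h -> u \in U -> lie x u \in U) ->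
  (forall x, x \in h -> exists a : F, forall u, u \in U -> gen_eigen (ad x) a u) ->
  exists a, forall u, u \in U -> u \in weight_space a.
Proof.
move=> U0 hU hgen; set d := \dim U.
have d0 : d%:R != 0 :> F by rewrite natf0 // /d dimv_eq0.
pose f (y : subvs_of h) : F^o := lftr (ad (vsval y) \o projv U)%VF / d%:R.
have flin : linear f.
  move=> c y z; rewrite /f linearP adP comp_lfunDl -comp_lfunZl lftrD lftrZ.
  by rewrite mulrDl -mulrA.
pose fl : {linear subvs_of h -> F^o} := HB.pack f (GRing.isLinear.Build _ _ _ _ f flin).
exists (linfun fl) => u uU; apply/weight_spaceP => x xh.
have [a aP] := hgen x xh; suff -> : ev (linfun fl) x = a by apply: aP.
rewrite /ev lfunE /= /f vsprojK //.
have tr0 : lftr (shift (ad x) a \o projv U)%VF = 0.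
  apply: (lftr_nilpotent (projector_on_projv U)); last exact: aP.
  by move=> v vU; rewrite shiftE adE rpredB ?rpredZ ?hU.
move: tr0; rewrite comp_lfunDl comp_lfunNl -comp_lfunZl comp_lfun1l lftrB lftrZ.
rewrite (lftr_projector (projector_on_projv U)) => /eqP.
by rewrite subr_eq0 => /eqP ->; rewrite mulfK.
Qed.

(** Induction on the dimension of an h-stable subspace: either every ad x has one generalized
    eigenvalue on it, which gives a weight, or some ad x splits it into smaller generalized
    eigenspaces. These are again h-stable because elements of h have generalized eigenvalue 0 under
    ad x. *)
Lemma weight_decomposition v : exists2 t : seq (dual_space h * L),
  (forall p, p \in t -> p.2 \in weight_space p.1) & v = \sum_(p <- t) p.2.
Proof.
suff: forall n U, (\dim U < n)%N ->
    (forall x u, x \in h -> u \in U -> lie x u \in U) ->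
    forall v, v \in U -> exists2 t : seq (dual_space h * L),
      (forall p, p \in t -> p.2 \in weight_space p.1) & v = \sum_(p <- t) p.2.
  by apply; [exact: ltnSn | | exact: memvf] => x u _ _; apply: memvf.
elim=> // n IHn U; rewrite ltnS => leU hU {}v vU.
have [U0|Un0] := eqVneq U 0%VS.
  by exists [::] => //; rewrite big_nil; apply/eqP; rewrite -memv0 -U0.
have [hgen|nex] := classic (forall x, x \in h ->
    exists a : F, forall u, u \in U -> gen_eigen (ad x) a u).
  have [a aP] := weight_of_stable Un0 hU hgen.
  by exists [:: (a, v)]; rewrite ?big_seq1 // => p; rewrite inE => /eqP ->; apply: aP.
have {nex} [x [xh nx]] : exists x, x \in h /\
    ~ exists a : F, forall u, u \in U -> gen_eigen (ad x) a u.
  apply: NNPP => nex'; apply: nex => x xh; apply: NNPP => nx.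
  by apply: nex'; exists x.
have [|t tP ->] := primary_decomposition (f := ad x) _ vU.
  by move=> u uU; rewrite adE hU.
elim: t tP => [|[a u] t IHt] tP; first by exists [::]; rewrite ?big_nil.
have [|t1 t1P E1] := IHt; first by move=> p pt; apply: tP; rewrite inE pt orbT.
have [/= uU gu] : u \in U /\ gen_eigen (ad x) a u by apply: (tP (a, u)); rewrite inE eqxx.
have [||W WP] := @pred_vspace _ L (fun w => w \in U /\ gen_eigen (ad x) a w).
- by rewrite mem0v; split=> //; apply: gen_eigen0.
- move=> c w1 w2 [w1U g1] [w2U g2]; split; last exact: gen_eigenP.
  by rewrite rpredD ?rpredZ.
have [|||t2 t2P E2] := IHn W _ _ u.
- apply: leq_trans leU; rewrite ltnNge; apply/negP => leUW; apply: nx; exists a => w.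
  have /eqP <- : W == U; last by move=> /WP[].
  by rewrite eqEdim leUW andbT; apply/subvP => ? /WP[].
- move=> y w yh /WP[wU gw]; apply/WP; split; first exact: hU.
  rewrite -[a]add0r; apply: gen_eigen_lie => //.
  by have /weight_spaceP := h_weight0 yh; move=> /(_ x xh); rewrite ev0.
- by apply/WP.
exists (t2 ++ t1); last by rewrite big_cons big_cat /= -E1 -E2.
by move=> p; rewrite mem_cat => /orP[/t2P|/t1P].
Qed.

Lemma weight_independent (s : seq (dual_space h)) (f : dual_space h -> L) :
  uniq s -> (forall a, a \in s -> f a \in weight_space a) ->
  \sum_(a <- s) f a = 0 -> forall a, a \in s -> f a = 0.
Proof.
elim: s f => [|a s IHs] f //= /andP[aNs us] fW.
rewrite big_cons => sum0.
have fs0 b : b \in s -> f b = 0.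
  move=> bs; have neq_ab : a != b by apply: contraNneq aNs => ->.
  have [x xh xab] := ev_neq neq_ab.
  have /weight_spaceP/(_ x xh)[n fan] : f a \in weight_space a by apply: fW; rewrite inE eqxx.
  have fbW : f b \in weight_space b by apply: fW; rewrite inE bs orbT.
  apply: (gen_eigen_unique xab); last by move/weight_spaceP: fbW; apply.
  (* The power of ad x - a(x) that kills f a is applied to the whole relation; the images of the
     other terms stay in their weight spaces and still add up to 0. *)
  exists n; apply: (IHs (fun c => iter n (shift (ad x) (ev a x)) (f c))) => //.
    move=> c cs; have fcW : f c \in weight_space c by apply: fW; rewrite inE cs orbT.
    elim: n {fan} => //= n IHn; rewrite shiftE adE rpredB ?rpredZ //.
    exact: weight_space_stable.
  transitivity (iter n (shift (ad x) (ev a x)) (f a + \sum_(j <- s) f j)); last first.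
    by rewrite sum0 iter_lfun0.
  rewrite -[f a]scale1r iter_lfunP fan scaler0 add0r.
  elim: (s) => [|c r IHr]; first by rewrite !big_nil iter_lfun0.
  by rewrite !big_cons -[f c]scale1r iter_lfunP !scale1r IHr.
move=> b; rewrite inE => /orP[/eqP ->|/fs0 //].
by move: sum0; rewrite big_seq big1 ?addr0.
Qed.

Lemma weight_support : exists2 s : seq (dual_space h), uniq s &
  forall v, exists2 f : dual_space h -> L,
    (forall a, f a \in weight_space a) & v = \sum_(a <- s) f a.
Proof.
have main (s : seq (dual_space h)) v : v \in (\sum_(a <- s) weight_space a)%VS ->
    exists2 f : dual_space h -> L,
      (forall a, f a \in weight_space a) & uniq s -> v = \sum_(a <- s) f a.
  elim: s v => [|a s IHs] v.
    rewrite big_nil memv0 => /eqP ->; exists (fun=> 0) => [a|_]; first exact: mem0v.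
    by rewrite big_nil.
  rewrite big_cons => /memv_addP[u uW [w /IHs[f fW wE] ->]].
  exists (fun b => if b == a then u else f b).
    by move=> b; case: eqP => [->|].
  move=> /= /andP[aNs us]; rewrite big_cons eqxx (wE us); congr (_ + _).
  rewrite big_seq [RHS]big_seq; apply: eq_bigr => b bs.
  by case: eqP bs aNs => // -> ->.
suff [s us sE] : exists2 s : seq (dual_space h), uniq s &
    (fullv <= \sum_(a <- s) weight_space a)%VS.
  exists s => // v; have [|f fW vE] := main s v; last by exists f => //; apply: vE.
  by rewrite (subvP sE) // memvf.
rewrite -(span_basis (vbasisP fullv)).
move: (vbasis fullv : seq L) => r.
elim: r => [|v r [s us sP]]; first by exists [::]; rewrite ?span_nil ?sub0v.
have [t tP vE] := weight_decomposition v.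
have sub (s1 s2 : seq (dual_space h)) : {subset s1 <= s2} ->
    (\sum_(a <- s1) weight_space a <= \sum_(a <- s2) weight_space a)%VS.
  move=> ss; elim: s1 ss => [|a s1 IHs1] ss; first by rewrite big_nil sub0v.
  rewrite big_cons subv_add IHs1 ?andbT; last by move=> b bs; apply: ss; rewrite inE bs orbT.
  have : a \in s2 by apply: ss; rewrite inE eqxx.
  by move/perm_to_rem => p; rewrite (perm_big _ p) big_cons addvSl.
exists (undup (map fst t ++ s)); first exact: undup_uniq.
rewrite span_cons subv_add; apply/andP; split.
  rewrite -memvE vE big_seq memv_suml // => p pt.
  have /sub : {subset [:: p.1] <= undup (map fst t ++ s)}.
    by move=> b; rewrite inE => /eqP ->; rewrite mem_undup mem_cat map_f.
  by rewrite big_seq1 => /subvP; apply; apply: tP.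
by apply: subv_trans sP _; apply: sub => b bs; rewrite mem_undup mem_cat bs orbT.
Qed.

(** Uniqueness of the weight components makes them linear. The projectors are indexed by all linear
    forms and vanish off the support, so a sum of weights can serve as an index before it is known
    to be a weight. *)
Lemma weight_projectors : exists s : seq (dual_space h), exists Q : dual_space h -> 'End(L),
  [/\ uniq s, (forall a, a \in s -> weight_space a != 0%VS),
      (forall a, projector_on (Q a) (weight_space a)),
      (forall a b v, a != b -> v \in weight_space b -> Q a v = 0)
    & (forall v, v = \sum_(a <- s) Q a v)].
Proof.
have [s0 us0 sP0] := weight_support.
have [s [us sn0 sP]] : exists s : seq (dual_space h), [/\ uniq s,
    (forall a, a \in s -> weight_space a != 0%VS) & forall v, exists f : dual_space h -> L,
    [/\ forall a, f a \in weight_space a, forall a, a \notin s -> f a = 0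
      & v = \sum_(a <- s) f a]].
  exists [seq a <- s0 | weight_space a != 0%VS]; split.
  - exact: filter_uniq.
  - by move=> a; rewrite mem_filter => /andP[].
  move=> v; have [f fW ->] := sP0 v.
  exists (fun a => if a \in s0 then f a else 0); split.
  - by move=> a; case: ifP => // _; apply: mem0v.
  - move=> a; rewrite mem_filter negb_and negbK; case: ifP => // _; rewrite orbF => /eqP W0.
    by apply/eqP; rewrite -memv0 -W0.
  rewrite big_filter [LHS](bigID (fun a => weight_space a != 0%VS)) /= addrC.
  rewrite big1 ?add0r => [|a]; last first.
    by rewrite negbK => /eqP W0; apply/eqP; rewrite -memv0 -W0.
  by rewrite big_seq_cond [RHS]big_seq_cond; apply: eq_bigr => a /andP[->].
pose q v := sval (constructive_indefinite_description _ (sP v)).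
have qP v : [/\ forall a, q v a \in weight_space a, forall a, a \notin s -> q v a = 0
    & v = \sum_(a <- s) q v a].
  by rewrite /q; case: constructive_indefinite_description.
have quniq (f : dual_space h -> L) : (forall a, f a \in weight_space a) ->
    (forall a, a \notin s -> f a = 0) -> forall a, q (\sum_(a <- s) f a) a = f a.
  move=> fW f0 a; have [qW q0 qE] := qP (\sum_(a <- s) f a).
  have [as_|aNs] := boolP (a \in s); last by rewrite q0 // f0.
  apply/eqP; rewrite -subr_eq0; apply/eqP.
  apply: (weight_independent (s := s) (f := fun a => q (\sum_(a <- s) f a) a - f a)) => //.
    by move=> b _; rewrite rpredB.
  by rewrite sumrB -qE subrr.
have qlin a : linear (q^~ a).
  move=> c u v; have [uW u0 uE] := qP u; have [vW v0 vE] := qP v.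
  rewrite -(quniq (fun a => c *: q u a + q v a)).
  - by rewrite {1}uE {1}vE scaler_sumr -big_split.
  - by move=> b; rewrite rpredD ?rpredZ.
  - by move=> b bNs; rewrite u0 // v0 // scaler0 addr0.
pose ql a : {linear L -> L} := HB.pack (q^~ a) (GRing.isLinear.Build _ _ _ _ (q^~ a) (qlin a)).
have qsingle a v : v \in weight_space a -> forall b, q v b = if b == a then v else 0.
  move=> vW b.
  have [as_|aNs] := boolP (a \in s); last first.
    suff v0 : v = 0.
      have := quniq (fun=> 0) _ _ b; rewrite v0 if_same big1 //.
      by apply=> // c; apply: mem0v.
    have [qW q0 vE] := qP v.
    have := @weight_independent (a :: s) (fun b => if b == a then v else - q v b).
    rewrite /= aNs us big_cons eqxx.
    have E : \sum_(j <- s) (if j == a then v else - q v j) = - v.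
      transitivity (\sum_(j <- s) - q v j); last by rewrite sumrN -vE.
      rewrite big_seq [RHS]big_seq; apply: eq_bigr => c cs.
      by case: eqP cs aNs => // -> ->.
    rewrite E subrr => /(_ isT _ erefl a); rewrite eqxx inE eqxx; apply=> // c _.
    by case: eqP => [->|_] //; rewrite rpredN.
  have {1}-> : v = \sum_(b <- s) (fun b => if b == a then v else 0) b.
    by rewrite /= -big_mkcond /= -big_filter filter_pred1_uniq // big_seq1.
  rewrite quniq // => c; case: eqP => [->|_] //; first exact: mem0v.
  by rewrite as_.
exists s, (fun a => linfun (ql a)); split=> //.
- move=> a; split=> v; rewrite lfunE /=; first by case: (qP v).
  by move=> vW; rewrite (qsingle a) // eqxx.
- by move=> a b v neq_ab vW; rewrite lfunE /= (qsingle b) // (negPf neq_ab).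
- move=> v; have [_ _ {1}->] := qP v; apply: eq_bigr => a _; by rewrite lfunE.
Qed.

End Weights.

(** * The Killing form *)

(** Sums are restricted by boolean predicates, whereas the weight strings below are given by
    existential propositions. *)
Definition prop_bool (P : Prop) : bool :=
  if excluded_middle_informative P then true else false.

Lemma prop_boolP P : reflect P (prop_bool P).
Proof. by rewrite /prop_bool; case: excluded_middle_informative => H; constructor. Qed.

(** * Positivity through the rational elements of F *)

Section RationalElements.
Variables (F : fieldType) (charF0 : [pchar F] =i pred0).
Implicit Types z w : F.

(** F carries no order, so sign arguments are made with the rational numbers inside F, written with
    cleared denominators. In characteristic 0 a sum of nonnegative ones vanishes only if every term
    does. *)
Definition rational_elt z := exists d : nat, exists e : int,
  d != 0%N /\ d%:R * z = e%:~R.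

Definition nonneg_rational_elt z := exists d e : nat, d != 0%N /\ d%:R * z = e%:R.

Lemma nonneg_rationalD z w : nonneg_rational_elt z -> nonneg_rational_elt w ->
  nonneg_rational_elt (z + w).
Proof.
move=> [d [e [d0 dz]]] [d' [e' [d'0 dw]]]; exists (d * d')%N, (d' * e + d * e')%N.
split; first by rewrite muln_eq0 negb_or d0.
by rewrite natrD !natrM -dz -dw mulrDr -mulrA mulrCA -mulrA.
Qed.

Lemma nonneg_rationalMn n z : nonneg_rational_elt z -> nonneg_rational_elt (n%:R * z).
Proof.
move=> [d [e [d0 dz]]]; exists d, (n * e)%N; split=> //.
by rewrite mulrCA dz natrM.
Qed.

Lemma nonneg_rational_sqr z : rational_elt z -> nonneg_rational_elt (z ^+ 2).
Proof.
move=> [d [e [d0 dz]]]; exists (d * d)%N, (`|e| * `|e|)%N.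
split; first by rewrite muln_eq0 negb_or d0.
rewrite natrM expr2 mulrACA dz natrM -intrM -natrM -[RHS]/((Posz _)%:~R).
by congr (_%:~R); rewrite -abszM; case: e {dz} => n //=; rewrite !NegzE mulrNN.
Qed.

Lemma nonneg_rational_add0 z w : nonneg_rational_elt z -> nonneg_rational_elt w ->
  z + w = 0 -> z = 0.
Proof.
move=> [d [e [d0 dz]]] [d' [e' [d'0 dw]]] zw0.
have : (d' * e + d * e')%N == 0%N.
  rewrite -(natf0 charF0) natrD !natrM -dz -dw !mulrA [d'%:R * d%:R]mulrC.
  by rewrite -mulrDr zw0 mulr0.
rewrite addn_eq0 muln_eq0 (negPf d'0) => /andP[/= /eqP e0 _].
by apply/eqP; move/eqP: dz; rewrite e0 mulf_eq0 (natf0 charF0) (negPf d0).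
Qed.

Lemma nonneg_rational_sum (I : Type) (r : seq I) (f : I -> F) :
  (forall i, nonneg_rational_elt (f i)) -> nonneg_rational_elt (\sum_(i <- r) f i).
Proof.
move=> fP; elim: r => [|i r IHr]; last by rewrite big_cons; apply: nonneg_rationalD.
by rewrite big_nil; exists 1%N, 0%N; split; rewrite ?mulr0.
Qed.

Lemma nonneg_rational_sum0 (I : eqType) (r : seq I) (f : I -> F) i :
  (forall i, nonneg_rational_elt (f i)) -> \sum_(i <- r) f i = 0 -> i \in r -> f i = 0.
Proof.
move=> fP s0 /perm_to_rem ir; apply: (nonneg_rational_add0 (fP i)) (_ : _ + _ = 0).
  exact: (nonneg_rational_sum (rem i r) fP).
by move: s0; rewrite (perm_big _ ir) big_cons.
Qed.

End RationalElements.

Section Killing.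
Variables (F : closedFieldType) (charF0 : [pchar F] =i pred0).
Variables (L : lieAlgType F) (h : {vspace L}).
Hypotheses (simL : lie_simple L) (carth : cartan_subalgebra h).
Implicit Types (x y z u v : L) (U : {vspace L}) (a b c : dual_space h).

Local Lemma subh : lie_subalgebra h. Proof. by case: carth. Qed.
Local Lemma nilh : lie_nilpotent h. Proof. by case: carth. Qed.
Local Lemma normh x : {in h, forall y, lie x y \in h} -> x \in h.
Proof. by case: carth => _ _; apply. Qed.

Notation W := weight_space.
Notation W0 := (weight_space (0 : dual_space h)).

Local Lemma hW0 y : y \in h -> y \in W0.
Proof. exact: (h_weight0 nilh). Qed.

Local Lemma W_stable a x v : x \in h -> v \in W a -> lie x v \in W a.
Proof. exact: (weight_space_stable nilh). Qed.

Lemma gen_eigen_uniform (f : 'End(L)) k U :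
  (forall u, u \in U -> gen_eigen f k u) ->
  exists n, forall u, u \in U -> iter n (shift f k) u = 0.
Proof.
move=> gU; suff [n nP] : exists n, forall u, u \in (vbasis U : seq L) -> iter n (shift f k) u = 0.
  exists n; have [||V VP] := @pred_vspace _ L (fun u => iter n (shift f k) u = 0).
  - exact: iter_lfun0.
  - by move=> c u v u0 v0; rewrite iter_lfunP u0 v0 scaler0 addr0.
  move=> u uU; apply/VP; move: u uU; apply/subvP.
  by rewrite -(span_basis (vbasisP U)); apply/span_subvP => u uB; apply/VP/nP.
have: forall u, u \in (vbasis U : seq L) -> gen_eigen f k u.
  by move=> u uB; apply: gU; apply: vbasis_mem.
move: (vbasis U : seq L) => r; elim: r => [|u r IHr] gr; first by exists 0.
have [|n nP] := IHr; first by move=> v vr; apply: gr; rewrite inE vr orbT.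
have [m um] : gen_eigen f k u by apply: gr; rewrite inE eqxx.
exists (maxn m n) => v; rewrite inE => /orP[/eqP ->|vr].
  exact: iter_lfun0_le (leq_maxl m n) um.
exact: iter_lfun0_le (leq_maxr m n) (nP v vr).
Qed.

Lemma minimal_vspace (P : {vspace L} -> Prop) U : P U ->
  exists2 V, P V & forall V', P V' -> (\dim V <= \dim V')%N.
Proof.
have [n] := ubnP (\dim U); elim: n U => // n IHn U; rewrite ltnS => leU PU.
have [[V [PV ltV]]|nV] := classic (exists V, P V /\ (\dim V < \dim U)%N).
  exact: IHn (leq_trans ltV leU) PV.
exists U => // V PV; rewrite leqNgt; apply/negP => ltV; apply: nV; by exists V.
Qed.

Lemma lower_central_sub n : (lower_central h n <= h)%VS.
Proof.
case: n => //= n; elim: n => [|n IHn] /=; apply/lie_prodvP => x y xh yh.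
  exact: subh.
by apply: subh => //; apply: (subvP IHn).
Qed.

(* Engel's theorem for the action of h on [W 0 / h]: in a minimal h-stable     *)
(* subspace strictly containing h, the terms of the lower central series of h *)
(* all act trivially modulo h, starting from the last one.                    *)
Lemma weight_space0 : W0 = h.
Proof.
apply/eqP; rewrite eqEsubv; apply/andP; split; last first.
  by apply/subvP => x xh; apply: hW0.
apply/negPn/negP => W0h.
pose P U := [/\ (h <= U)%VS, (U <= W0)%VS, ~~ (U <= h)%VS
  & forall x u, x \in h -> u \in U -> lie x u \in U].
have [|U [hU UW Uh stU] minU] := @minimal_vspace P W0.
  split=> //; first by apply/subvP => x xh; apply: hW0.
  by move=> x u xh uW; apply: W_stable.
have step k : (forall x u, x \in lower_central h k.+1 -> u \in U -> lie x u \in h) ->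
    forall x u, x \in lower_central h k -> u \in U -> lie x u \in h.
  move=> IH x u xC uU; have xh := subvP (lower_central_sub k) x xC.
  pose U' := (ad x @: U + h)%VS.
  have U'U : (U' <= U)%VS.
    rewrite subv_add hU andbT; apply/subvP => _ /memv_imgP[w wU ->].
    by rewrite adE stU.
  have [U'h|nU'h] := boolP (U' <= h)%VS.
    by rewrite (subvP U'h) // (subvP (addvSl _ _)) // -adE memv_img.
  have PU' : P U'.
    split=> //; [exact: addvSr | exact: subv_trans U'U UW |].
    move=> y _ yh /memv_addP[_ /memv_imgP[w wU ->] [t th ->]].
    rewrite adE lieDr lie_jacobiE [X in X + _]addrC -addrA memv_add //.
      by rewrite -adE memv_img // stU.
    by apply: rpredD; [apply: IH => //; apply: memv_lie | apply: subh].
  have {U'U} U'E : U' = U by apply/eqP; rewrite eqEdim U'U minU.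
  case/negP: Uh; apply/subvP => w wU.
  have [n nP] : exists n, forall u, u \in U -> iter n (shift (ad x) 0) u = 0.
    apply: gen_eigen_uniform => t /(subvP UW)/weight_spaceP/(_ x xh).
    by rewrite ev0.
  rewrite shift0 in nP.
  (* From U = [x, U] + h, iteration gives U = (ad x)^n U + h for all n; as ad x is nilpotent on U,
     this puts U inside h. *)
  suff [u' u'U [t th ->]] : exists2 u', u' \in U & exists2 t, t \in h &
      w = iter n (ad x) u' + t by rewrite nP // add0r.
  elim: n {nP} => [|n [u' u'U [t th ->]]]; first by exists w => //; exists 0; rewrite ?mem0v ?addr0.
  move: u'U; rewrite -U'E => /memv_addP[_ /memv_imgP[u2 u2U ->] [t2 t2h ->]].
  exists u2; rewrite ?U'E //; exists (iter n (ad x) t2 + t).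
    rewrite rpredD //; elim: n => //= n IHn; rewrite adE; exact: subh.
  by rewrite iterSr addrA -[ad x u2]scale1r iter_lfunP !scale1r.
have [n hn] := nilh.
have hUh : forall x u, x \in lower_central h n -> u \in U -> lie x u \in h.
  by rewrite hn => x u; rewrite memv0 => /eqP -> _; rewrite lie0l mem0v.
have {hn} : forall x u, x \in h -> u \in U -> lie x u \in h.
  by elim: n {hn} hUh => // n IHn /step.
move=> hUh'; case/negP: Uh; apply/subvP => u uU; apply: normh => y yh.
by rewrite lieC rpredN hUh'.
Qed.

Variables (s : seq (dual_space h)) (Q : dual_space h -> 'End(L)).
Hypotheses (us : uniq s) (sn0 : forall a, a \in s -> W a != 0%VS)
  (QP : forall a, projector_on (Q a) (W a))
  (Q0 : forall a b v, a != b -> v \in W b -> Q a v = 0)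
  (Qsum : forall v, v = \sum_(a <- s) Q a v).

Lemma QW a v : Q a v \in W a. Proof. by case: (QP a). Qed.
Lemma Qid a v : v \in W a -> Q a v = v. Proof. by case: (QP a) => _; apply. Qed.

Lemma mem_support a v : v \in W a -> v != 0 -> a \in s.
Proof.
move=> vW; apply: contraR => aNs; rewrite [v]Qsum big_seq big1 // => b bs.
by rewrite (Q0 _ vW) //; apply: contraNneq aNs => <-.
Qed.

Lemma lie_h_weight a x y : x \in W a -> y \in W (- a) -> lie x y \in h.
Proof. by move=> xW yW; rewrite -weight_space0 -(subrr a) weight_space_lie. Qed.

Lemma lftr_decomp (f : 'End(L)) : lftr f = \sum_(b <- s) lftr (f \o Q b)%VF.
Proof.
rewrite -lftr_sum; congr lftr; apply/lfunP => v; rewrite sum_lfunE.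
rewrite {1}[v]Qsum linear_sum; apply: eq_bigr => b _; by rewrite comp_lfunE.
Qed.

Lemma lftr_Q b x : x \in h -> lftr (ad x \o Q b)%VF = (\dim (W b))%:R * ev b x.
Proof.
move=> xh; have : lftr (shift (ad x) (ev b x) \o Q b)%VF = 0.
  apply: (lftr_nilpotent (QP b)) => v vW.
    by rewrite shiftE adE rpredB ?rpredZ //; apply: W_stable.
  by move/weight_spaceP: vW; apply.
rewrite comp_lfunDl comp_lfunNl -comp_lfunZl comp_lfun1l lftrB lftrZ.
by rewrite (lftr_projector (QP b)) mulrC => /eqP; rewrite subr_eq0 => /eqP.
Qed.

(** The sum of the W b with b in B is stable under ad x and ad y, so ad [x, y] has trace 0 on it,
    and each W b contributes its dimension times b([x, y]). Stability is asked only where a bracket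
    is nonzero, so that half a string qualifies when a vanishing bracket cuts it off. *)
Lemma trace_stable_weights (B : pred (dual_space h)) a x y :
  x \in W a -> y \in W (- a) ->
  (forall b v, B b -> v \in W b -> lie x v != 0 -> B (a + b)) ->
  (forall b v, B b -> v \in W b -> lie y v != 0 -> B (- a + b)) ->
  \sum_(b <- s | B b) (\dim (W b))%:R * ev b (lie x y) = 0.
Proof.
move=> xW yW Bx By; pose P := \sum_(b <- s | B b) Q b.
have PE v : P v = \sum_(b <- s | B b) Q b v by rewrite sum_lfunE.
have Pid b v : B b -> v \in W b -> P v = v.
  move=> Bb vW; rewrite PE {2}[v]Qsum [RHS](bigID B) /= [X in _ + X]big1 ?addr0 // => c nBc.
  by rewrite (Q0 _ vW) //; apply: contraNneq nBc => ->.
have PP : projector_on P (limg P).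
  split=> v; first by rewrite memv_img ?memvf.
  case/memv_imgP=> u _ ->; rewrite [P u]PE linear_sum; apply: eq_bigr => b Bb.
  exact: Pid Bb (QW b u).
have st c z : z \in W c ->
    (forall b v, B b -> v \in W b -> lie z v != 0 -> B (c + b)) ->
    forall v, v \in limg P -> ad z v \in limg P.
  move=> zW Bz v vP; rewrite -(PP.2 _ vP) PE linear_sum rpred_sum // => b Bb.
  rewrite /= adE; have [->|nz] := eqVneq (lie z (Q b v)) 0; first exact: mem0v.
  rewrite -(@Pid (c + b) (lie z (Q b v))) ?memv_img ?memvf //; first exact: Bz (QW b v) nz.
  by rewrite weight_space_lie ?QW.
have := lftr_comm_stable PP (st _ _ xW Bx) (st _ _ yW By).
rewrite -ad_lie => tr0; rewrite -[RHS]tr0.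
have -> : (ad (lie x y) \o P = \sum_(b <- s | B b) (ad (lie x y) \o Q b))%VF.
  apply/lfunP => v; rewrite comp_lfunE PE sum_lfunE linear_sum.
  by apply: eq_bigr => b _; rewrite comp_lfunE.
rewrite -big_filter -[in RHS]big_filter lftr_sum; apply: eq_bigr => b _.
by rewrite lftr_Q // (lie_h_weight xW).
Qed.

Lemma evMn a n x : ev (a *+ n) x = n%:R * ev a x.
Proof. by elim: n => [|n IHn]; rewrite ?mulr0n ?ev0 ?mul0r // mulrS evD IHn mulrS mulrDl mul1r. Qed.

Lemma evMz a (k : int) x : ev (a *~ k) x = k%:~R * ev a x.
Proof.
case: k => n; rewrite ?NegzE ?mulrNz ?evN -pmulrn evMn //.
by rewrite mulNr -?pmulrn.
Qed.

(** For t = [x, y], the trace identity on the full string b + Z a reads d b(t) + e a(t) = 0 with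
    integers d and e; d is the total dimension of the string, nonzero since b is a weight. *)
Lemma string_ratio a x y b : x \in W a -> y \in W (- a) -> b \in s ->
  exists d : nat, exists e : int,
    d != 0%N /\ d%:R * ev b (lie x y) = e%:~R * ev a (lie x y).
Proof.
move=> xW yW bs; set t := lie x y.
pose B c := prop_bool (exists k : int, c = b + a *~ k).
have Bx c v : B c -> v \in W c -> lie x v != 0 -> B (a + c).
  move=> /prop_boolP[k ->] _ _; apply/prop_boolP; exists (k + 1).
  by rewrite mulrzDr mulr1z addrCA [a + _]addrC.
have By c v : B c -> v \in W c -> lie y v != 0 -> B (- a + c).
  move=> /prop_boolP[k ->] _ _; apply/prop_boolP; exists (k - 1).
  by rewrite mulrzBr mulr1z addrC addrA.
have := trace_stable_weights xW yW Bx By; rewrite -/t -big_filter.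
have [] : all (fun c => (c \in s) && B c) [seq c <- s | B c] /\ b \in [seq c <- s | B c].
  split; first by apply/allP => c; rewrite mem_filter andbC.
  by rewrite mem_filter bs andbT; apply/prop_boolP; exists 0; rewrite mulr0z addr0.
move: [seq c <- s | B c] => r rB br.
have [E ->] : exists E : int, \sum_(c <- r) (\dim (W c))%:R * ev c t =
    (\sum_(c <- r) \dim (W c))%N%:R * ev b t + E%:~R * ev a t.
  elim: r rB {br} => [|c r IHr] /=; first by exists 0; rewrite !big_nil !mul0r addr0.
  case/andP=> /andP[_ /prop_boolP[k cE]] /IHr[E EE].
  exists ((\dim (W c))%:Z * k + E); rewrite !big_cons EE natrD intrD intrM !mulrDl.
  rewrite {2}cE evD mulrDr -!addrA; congr (_ + _); rewrite addrCA; congr (_ + _).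
  by congr (_ + _); rewrite evMz mulrA -pmulrn.
move/eqP; rewrite addr_eq0 -mulNr -intrN => /eqP E0.
exists (\sum_(c <- r) \dim (W c))%N, (- E); split=> //.
have /= := allP rB b br; rewrite bs /= => _.
by rewrite (perm_big _ (perm_to_rem br)) big_cons addn_eq0 dimv_eq0 (negPf (sn0 bs)).
Qed.
Lemma Q0h v : Q 0 v \in h.
Proof. by have := QW 0 v; rewrite weight_space0. Qed.

(** * Invariance and nondegeneracy of the Killing form *)

Definition killing x y : F := lftr (ad x \o ad y)%VF.

Lemma killingC x y : killing x y = killing y x.
Proof. exact: lftrC. Qed.

Lemma killingP (k : F) x y z : killing (k *: x + y) z = k * killing x z + killing y z.
Proof. by rewrite /killing adP comp_lfunDl -comp_lfunZl lftrD lftrZ. Qed.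

Lemma killing0l x : killing 0 x = 0.
Proof.
apply: (addrI (killing 0 x)); rewrite addr0.
by have := killingP 1 0 0 x; rewrite scaler0 mul1r addr0 => <-.
Qed.

Lemma killingZl (k : F) x y : killing (k *: x) y = k * killing x y.
Proof. by have := killingP k x 0 y; rewrite killing0l !addr0. Qed.

Lemma killingDl x y z : killing (x + y) z = killing x z + killing y z.
Proof. by rewrite -[x]scale1r killingP scale1r mul1r. Qed.

Lemma killingDr x y z : killing x (y + z) = killing x y + killing x z.
Proof. by rewrite killingC killingDl !(killingC x). Qed.

Lemma killing_sumr (I : Type) (r : seq I) (f : I -> L) x :
  killing x (\sum_(i <- r) f i) = \sum_(i <- r) killing x (f i).
Proof.
by apply: (big_morph _ (killingDr x)); rewrite killingC killing0l.
Qed.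

Lemma killing_inv x y z : killing (lie x y) z = killing x (lie y z).
Proof.
rewrite /killing !ad_lie !(comp_lfunDl, comp_lfunDr, comp_lfunNl, comp_lfunNr) !lftrB.
by rewrite -!comp_lfunA [lftr (ad y \o _)%VF]lftrC -!comp_lfunA.
Qed.

Lemma lftr_shift (f : 'End(L)) c b : c != 0 ->
  (forall v, v \in W b -> f v \in W (c + b)) -> lftr (f \o Q b)%VF = 0.
Proof.
move=> c0 fW; have -> : (f \o Q b = (f \o Q b) \o Q b)%VF.
  by apply/lfunP => v; rewrite !comp_lfunE (Qid (QW b v)).
rewrite lftrC; suff -> : (Q b \o (f \o Q b))%VF = 0 by rewrite lftr0.
apply/lfunP => v; rewrite !comp_lfunE zero_lfunE (Q0 (b := c + b)) ?fW ?QW //.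
by rewrite -subr_eq0 opprD addrCA subrr addr0 oppr_eq0.
Qed.

Lemma killing_weight0 a b x y : x \in W a -> y \in W b -> a + b != 0 -> killing x y = 0.
Proof.
move=> xW yW ab0; rewrite /killing lftr_decomp big1 // => c _.
apply: (lftr_shift ab0) => v vW; rewrite comp_lfunE !adE -addrA.
by rewrite !weight_space_lie.
Qed.

(** On W b, ad x = b(x) + N with N nilpotent and commuting with ad x, so the product of ad x and N
    contributes no trace. *)
Lemma lftr_sqr b x : x \in h ->
  lftr ((ad x \o ad x) \o Q b)%VF = (\dim (W b))%:R * ev b x ^+ 2.
Proof.
move=> xh; set N := shift (ad x) (ev b x).
have NE v : N v = lie x v - ev b x *: v by rewrite /N shiftE adE.
have NW v : v \in W b -> N v \in W b.
  by move=> vW; rewrite NE rpredB ?rpredZ // W_stable.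
have comm n v : iter n (ad x \o N)%VF v = iter n (ad x) (iter n N v).
  elim: n => //= n ->; rewrite comp_lfunE; congr (ad x _).
  have NC w : N (ad x w) = ad x (N w) by rewrite !NE !adE lieDr lieNr lieZr.
  by move: (iter n N v) => w; elim: n => //= n IHn; rewrite NC IHn.
have nil : lftr ((ad x \o N) \o Q b)%VF = 0.
  apply: (lftr_nilpotent (QP b)) => v vW.
    by rewrite comp_lfunE adE W_stable // NW.
  have /weight_spaceP/(_ x xh)[n nv] := vW; exists n.
  by rewrite comm nv iter_lfun0.
have : ((ad x \o ad x) \o Q b = (ad x \o N) \o Q b + ev b x *: (ad x \o Q b))%VF.
  apply/lfunP => v; rewrite add_lfunE scale_lfunE !comp_lfunE NE !adE.
  by rewrite lieDr lieNr lieZr subrK.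
by move=> ->; rewrite lftrD nil add0r lftrZ lftr_Q // mulrCA -expr2.
Qed.

(** Polarization of the formula for squares, 2 being invertible. Elements of h are not yet known to
    commute or to act diagonally, hence the detour for the mixed trace. *)
Lemma killing_h x y : x \in h -> y \in h ->
  killing x y = \sum_(b <- s) (\dim (W b))%:R * (ev b x * ev b y).
Proof.
have sq z : z \in h -> killing z z = \sum_(b <- s) (\dim (W b))%:R * ev b z ^+ 2.
  by move=> zh; rewrite /killing lftr_decomp; apply: eq_bigr => b _; rewrite lftr_sqr.
move=> xh yh; have := sq _ (rpredD xh yh).
rewrite killingDl !killingDr (killingC y x) !sq //.
set A := \sum_(b <- s) _ * ev b x ^+ 2; set B := \sum_(b <- s) _ * ev b y ^+ 2.
have -> : \sum_(b <- s) (\dim (W b))%:R * ev b (x + y) ^+ 2 =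
    A + (\sum_(b <- s) (\dim (W b))%:R * (ev b x * ev b y)) *+ 2 + B.
  rewrite /A /B -sumrMnl -!big_split /=; apply: eq_bigr => b _.
  by rewrite ev_addr sqrrD 2!mulrDr mulrnAr.
rewrite -!addrA => /addrI; rewrite !addrA => /addIr.
rewrite -mulr2n => /eqP; rewrite -subr_eq0 -mulrnBl -mulr_natl mulf_eq0.
by rewrite (natf0 charF0) /= subr_eq0 => /eqP.
Qed.

(** Let t = [x, y]. If a(t) were nonzero, dividing tr (ad t)^2 = 0 by a(t)^2 would leave a sum of
    nonnegative rationals whose term at a is dim W a > 0. So a(t) = 0, and the string ratio
    transfers this to every weight. *)
Lemma bracket_weight_vanish (kill0 : forall x y, killing x y = 0) a x y b :
  x \in W a -> y \in W (- a) -> b \in s -> ev b (lie x y) = 0.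
Proof.
move=> xW yW; have th := lie_h_weight xW yW; set t := lie x y in th *.
have [at0|at1] := eqVneq (ev a t) 0.
  move=> bs; have [d [e [d0]]] := string_ratio xW yW bs.
  rewrite -/t at0 mulr0 => /eqP; rewrite mulf_eq0 (natf0 charF0) (negPf d0).
  by move/eqP.
have [x0|x0] := eqVneq x 0.
  by move: at1; rewrite /t x0 lie0l /ev !linear0 eqxx.
have as_ := mem_support xW x0.
have rat c : c \in s -> rational_elt (ev c t / ev a t).
  move=> cs; have [d [e [d0 de]]] := string_ratio xW yW cs; exists d, e.
  by split=> //; rewrite mulrA de mulfK.
pose g c := if c \in s then (\dim (W c))%:R * (ev c t / ev a t) ^+ 2 else 0.
have sum0 : \sum_(c <- s) g c = 0.
  have := congr1 (fun z : F => z / ev a t ^+ 2) (kill0 t t).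
  rewrite /= mul0r killing_h // mulr_suml => kt; rewrite -[RHS]kt.
  rewrite big_seq [RHS]big_seq; apply: eq_bigr => c cs.
  by rewrite /g cs expr_div_n expr2 !mulrA.
have ga0 : g a = 0.
  apply: (nonneg_rational_sum0 charF0 _ sum0 as_) => c; rewrite /g.
  case: ifP => [cs|_]; last by exists 1%N, 0%N; split; rewrite ?mulr0.
  by apply: nonneg_rationalMn; apply: nonneg_rational_sqr; apply: rat.
move/eqP: ga0; rewrite /g as_ divff // expr1n mulr1.
by rewrite (natf0 charF0) dimv_eq0 (negPf (sn0 as_)).
Qed.

(** The radical is an ideal, so otherwise the form vanishes identically. Then all weights vanish on
    the h-component of every bracket, hence on h by simplicity; every weight is 0 and L = h would be
    nilpotent. *)
Lemma killing_nondegenerate x : (forall y, killing x y = 0) -> x = 0.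
Proof.
move=> x0; have [||||] := simple_ideal (P := fun x => forall y, killing x y = 0) simL.
- exact: killing0l.
- by move=> c u v u0 v0 y; rewrite killingP u0 v0 mulr0 addr0.
- by move=> u v v0 y; rewrite killingC -killing_inv killingC v0.
- by apply.
move=> kill0; case: (simple_not_nilpotent simL).
have brk u v b : b \in s -> ev b (Q 0 (lie u v)) = 0.
  move=> bs; rewrite [u]Qsum lie_suml linear_sum /ev !linear_sum big1 // => c _.
  rewrite [v]Qsum lie_sumr !linear_sum big1 // => d _ /=.
  have [cd|cd] := eqVneq (c + d) 0; last first.
    by rewrite (Q0 (a := 0) (b := c + d)) ?linear0 ?weight_space_lie ?QW // [0 == _]eq_sym.
  have dE : d = - c by apply/eqP; rewrite -addr_eq0 addrC cd.
  rewrite Qid; last by rewrite -cd weight_space_lie ?QW.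
  by apply: (bracket_weight_vanish kill0 (QW c u)) => //; rewrite dE QW.
have [|||P0|PT] := simple_ideal (P := fun v => forall b, b \in s -> ev b (Q 0 v) = 0) simL.
- by move=> b _; rewrite linear0 /ev !linear0.
- by move=> c u v u0 v0 b bs; rewrite linearP /= evP u0 // v0 // mulr0 addr0.
- by move=> u v _ b; apply: brk.
- have [[u [v /eqP uv0]] _] := simL; case: uv0; apply: P0 => b; exact: brk.
suff hT : h = fullv by rewrite -hT; apply: nilh.
apply/eqP; rewrite eqEsubv subvf; apply/subvP => v _.
rewrite [v]Qsum rpred_sum // => b _; have [->|Qb0] := eqVneq (Q b v) 0; first exact: mem0v.
have bs := mem_support (QW b v) Qb0.
suff -> : b = 0 by apply: Q0h.
apply/eqP/negPn/negP => /ev_neq[z zh]; rewrite ev0.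
by have := PT z b bs; rewrite Qid ?weight_space0 // => ->; rewrite eqxx.
Qed.

Lemma weights_separate x : x \in h -> (forall b, b \in s -> ev b x = 0) -> x = 0.
Proof.
move=> xh x0; apply: killing_nondegenerate => y.
rewrite [y]Qsum killing_sumr big1 // => b _.
have [->|b0] := eqVneq b 0.
  have Qh := Q0h y.
  by rewrite killing_h // big_seq big1 // => c cs; rewrite x0 // mul0r mulr0.
by rewrite (killing_weight0 (a := 0) (b := b)) ?QW ?hW0 // add0r.
Qed.

(** Since ad (N v) = [N, ad v], cyclicity turns tr (ad (N v) ad w) into tr (N ad [v, w]), and
    nondegeneracy concludes. *)
Lemma derivation_trace0 (N : 'End(L)) :
  (forall u v, N (lie u v) = lie (N u) v + lie u (N v)) ->
  (forall y, lftr (N \o ad y)%VF = 0) -> N = 0.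
Proof.
move=> derN tr0; apply/lfunP => v; rewrite zero_lfunE.
apply: killing_nondegenerate => w; rewrite /killing.
have -> : ad (N v) = ((N \o ad v) - (ad v \o N))%VF.
  apply/lfunP => u; rewrite add_lfunE opp_lfunE !comp_lfunE !adE derN.
  by rewrite addrK.
rewrite comp_lfunDl comp_lfunNl lftrB -comp_lfunA -comp_lfunA.
rewrite (lftrC (ad v)) -comp_lfunA -lftrB -comp_lfunNr -comp_lfunDr -ad_lie.
exact: tr0.
Qed.

(** D is the diagonal part of ad x, a derivation because weights add under the bracket; so N = ad x
    - D is a derivation as well. It has trace 0 against ad y: for y in W c with c nonzero because
    weights are shifted, and for y in h because the traces for ad x and for D are both the sum of
    the (dim W b) b(x) b(y). *)
Lemma weight_space_eigen b x v : x \in h -> v \in W b -> lie x v = ev b x *: v.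
Proof.
move=> xh; pose D := \sum_(c <- s) ev c x *: Q c; pose N := ad x - D.
have DE c u : u \in W c -> D u = ev c x *: u.
  move=> uW; rewrite sum_lfunE; have [->|u0] := eqVneq u 0.
    by rewrite scaler0 big1 // => d _; rewrite linear0.
  have cs := mem_support uW u0; rewrite (bigD1_seq c) //= scale_lfunE Qid // big1 ?addr0 //.
  by move=> d dc; rewrite scale_lfunE (Q0 _ uW) // scaler0.
have DS (r : seq (dual_space h)) (f : dual_space h -> L) :
    D (\sum_(c <- r) f c) = \sum_(c <- r) D (f c) by exact: linear_sum.
have derD u w : D (lie u w) = lie (D u) w + lie u (D w).
  rewrite [u]Qsum lie_suml !DS !lie_suml -big_split; apply: eq_bigr => c _ /=.
  rewrite [w]Qsum lie_sumr !DS !lie_sumr -big_split; apply: eq_bigr => d _ /=.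
  rewrite (DE (c + d)) ?weight_space_lie ?QW // !(DE _ _ (QW _ _)) evD.
  by rewrite lieZl lieZr scalerDl.
have N0 : N = 0.
  apply: derivation_trace0 => [u w|y].
    rewrite /N !add_lfunE !opp_lfunE !adE derD lie_jacobiE.
    by rewrite !lieDl !lieDr lieNl lieNr opprD addrACA.
  have -> : (N \o ad y = \sum_(c <- s) (N \o ad (Q c y)))%VF.
    apply/lfunP => u; rewrite sum_lfunE comp_lfunE adE {1}[y]Qsum lie_suml linear_sum.
    by apply: eq_bigr => c _; rewrite comp_lfunE adE.
  rewrite lftr_sum big1 // => c _.
  have NW (d : dual_space h) u : u \in W d -> N u \in W d.
    by move=> uW; rewrite add_lfunE opp_lfunE adE (DE d) // rpredB ?rpredZ ?W_stable.
  have [->|c0] := eqVneq c 0; last first.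
    rewrite lftr_decomp big1 // => d _; apply: (lftr_shift c0) => u uW.
    by rewrite comp_lfunE adE NW // weight_space_lie ?QW.
  have Qh := Q0h y.
  rewrite comp_lfunDl comp_lfunNl lftrB -[lftr (ad x \o _)%VF]/(killing x (Q 0 y)) killing_h //.
  have -> : (D \o ad (Q 0 y) = \sum_(d <- s) ev d x *: (Q d \o ad (Q 0 y)))%VF.
    apply/lfunP => u; rewrite comp_lfunE !sum_lfunE; apply: eq_bigr => d _.
    by rewrite !scale_lfunE comp_lfunE.
  rewrite lftr_sum -sumrB big1 // => d _; rewrite lftrZ lftrC lftr_Q //.
  by rewrite mulrCA subrr.
move=> vW; have : N v = 0 by rewrite N0 zero_lfunE.
by rewrite /N add_lfunE opp_lfunE adE (DE b) // => /eqP; rewrite subr_eq0 => /eqP.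
Qed.

Lemma root_space_weight b v : (v \in root_space b) = (v \in W b).
Proof.
apply/root_spaceP/idP => [rv|vW x xh]; last by rewrite (weight_space_eigen xh vW).
apply/weight_spaceP => x xh; exists 1%N; rewrite /= shiftE adE rv //.
by rewrite subrr.
Qed.

(** * Coroots, dimension of the root spaces and nonvanishing brackets *)

Lemma ev0r a : ev a 0 = 0.
Proof. by rewrite /ev !linear0. Qed.

Lemma evZ a (k : F) x : ev a (k *: x) = k * ev a x.
Proof. by rewrite -[k *: x]addr0 evP ev0r addr0. Qed.

Lemma killing_pairing a x : x \in W a -> x != 0 ->
  exists2 y, y \in W (- a) & killing x y != 0.
Proof.
move=> xW /eqP x0.
have [y kxy] : exists y, killing x y != 0.
  apply: NNPP => ny; apply: x0; apply: killing_nondegenerate => y.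
  by apply/eqP/negPn/negP => kxy; apply: ny; exists y.
exists (Q (- a) y); first exact: QW.
apply: contra kxy => /eqP k0; rewrite [y]Qsum killing_sumr big1 // => c _.
have [ac0|ac0] := eqVneq (a + c) 0; last exact: (killing_weight0 xW (QW c y) ac0).
by have -> : c = - a by apply/eqP; rewrite -addr_eq0 addrC ac0.
Qed.

(** If a vanished at t = [x, y], every weight would, by the string ratio, and t would be 0; but by
    invariance the Killing product of t with z is a(z) times that of x with y. The value is
    normalized to 1 rather than the usual 2, so that k a takes the value k. *)
Lemma coroot_exists a x : a != 0 -> x \in W a -> x != 0 ->
  exists2 y, y \in W (- a) & ev a (lie x y) = 1.
Proof.
move=> a0 xW x0; have [y yW kxy] := killing_pairing xW x0.
have th := lie_h_weight xW yW.
suff at0 : ev a (lie x y) != 0.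
  exists ((ev a (lie x y))^-1 *: y); first by rewrite rpredZ.
  by rewrite lieZr evZ mulVf.
apply/negP => /eqP at0; have t0 : lie x y = 0.
  apply: weights_separate => // b bs; have [d [e [d0]]] := string_ratio xW yW bs.
  by rewrite at0 mulr0 => /eqP; rewrite mulf_eq0 (natf0 charF0) (negPf d0) => /eqP.
have [z zh] := ev_neq a0; rewrite ev0 => az.
have := killing_inv x y z; rewrite t0 killing0l lieC (weight_space_eigen zh yW) evN.
rewrite scaleNr opprK killingC killingZl => /esym/eqP.
by rewrite mulf_eq0 (negPf az) killingC (negPf kxy).
Qed.

Lemma mulrn_ev_inj a x (m n : nat) : ev a x = 1 -> a *+ m = a *+ n -> m = n.
Proof.
move=> ax1 /(congr1 (fun b => ev b x)); rewrite !evMn ax1 !mulr1.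
wlog le_mn : m n / (m <= n)%N.
  by case: (leqP m n) => [/[swap]|/ltnW le_nm W1 /esym/(W1 _ _ le_nm)]; [apply|].
move=> /eqP; rewrite eq_sym -subr_eq0 -natrB // (natf0 charF0) subn_eq0 => le_nm.
by apply/eqP; rewrite eqn_leq le_mn.
Qed.

(* With t = [e, f] normalized by a(t) = 1, the trace of ad t on the            *)
(* (ad e, ad f)-stable subspace F f + h + \sum_(k >= 1) W (k a) vanishes and   *)
(* equals -1 + \sum_k k \dim (W (k a)).                                        *)
Lemma dim_weight_space a : a != 0 -> a \in s -> \dim (W a) = 1%N.
Proof.
move=> a0 as_; have Wa0 := sn0 as_.
pose e := vpick (W a); have eW : e \in W a by exact: memv_pick.
have e0 : e != 0 by rewrite vpick0.
have [f fW t1] := coroot_exists a0 eW e0; set t := lie e f in t1.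
have th : t \in h by exact: lie_h_weight eW fW.
have f0 : f != 0 by apply/negP => /eqP f0; move: t1; rewrite /t f0 lie0r ev0r =>
  /esym/eqP; rewrite oner_eq0.
pose B b := prop_bool (exists k : nat, b = a *+ k).
have B0 : B 0 by apply/prop_boolP; exists 0%N.
have Ba : B a by apply/prop_boolP; exists 1%N.
have nB : ~~ B (- a).
  apply/negP => /prop_boolP[k ak]; have : a *+ k.+1 = a *+ 0 by rewrite mulrS -ak subrr mulr0n.
  by move/(mulrn_ev_inj t1).
(* Only the line of f is kept from W (- a), whose dimension is not known at this point. *)
pose p := (projv <[f]> \o Q (- a))%VF.
pose P := p + \sum_(b <- s | B b) Q b.
have PE v : P v = p v + \sum_(b <- s | B b) Q b v by rewrite add_lfunE sum_lfunE.
have pf v : exists k, p v = k *: f.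
  by rewrite comp_lfunE; apply/vlineP; exact: memv_proj.
have Pf : P f = f.
  rewrite PE comp_lfunE (Qid fW) projv_id ?memv_line // big1 ?addr0 // => b Bb.
  by rewrite (Q0 _ fW) //; apply: contraNneq nB => <-.
have Pid b v : B b -> v \in W b -> P v = v.
  move=> Bb vW; rewrite PE comp_lfunE (Q0 _ vW) ?linear0 ?add0r; last first.
    by apply: contraNneq nB => ->.
  rewrite [RHS]Qsum [RHS](bigID B) /= [X in _ + X]big1 ?addr0 // => c nBc.
  by rewrite (Q0 _ vW) //; apply: contraNneq nBc => ->.
have PP : projector_on P (limg P).
  split=> v; first by rewrite memv_img ?memvf.
  case/memv_imgP=> u _ ->; rewrite [P u]PE linearD linear_sum /=; congr (_ + _).
    by have [k ->] := pf u; rewrite linearZ /= Pf.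
  by apply: eq_bigr => b Bb; apply: Pid Bb (QW b u).
have limP b v : B b -> v \in W b -> v \in limg P.
  by move=> Bb vW; rewrite -(Pid b v) // memv_img ?memvf.
have limf : f \in limg P by rewrite -Pf memv_img ?memvf.
have stable z : lie z f \in limg P ->
    (forall b v, B b -> v \in W b -> lie z v \in limg P) ->
    forall v, v \in limg P -> ad z v \in limg P.
  move=> zf zB v vP; rewrite -(PP.2 _ vP) PE linearD linear_sum /=.
  rewrite rpredD // ?rpred_sum // => [|b Bb]; last by rewrite adE (zB b) ?QW.
  by have [k ->] := pf v; rewrite linearZ /= adE rpredZ.
have := lftr_comm_stable PP (f := ad e) (g := ad f).
rewrite -ad_lie -/t => tr0.
have {}tr0 : lftr (ad t \o P)%VF = 0.
  apply: tr0; apply: stable.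
  - by apply: (limP 0) => //; rewrite weight_space0 //.
  - move=> b v /prop_boolP[k ->] vW; apply: (limP (a + a *+ k)); last exact: weight_space_lie.
    by apply/prop_boolP; exists k.+1; rewrite mulrS.
  - by rewrite liexx mem0v.
  move=> b v /prop_boolP[[|k] ->] vW.
    have vh : v \in h by rewrite -weight_space0.
    by rewrite lieC (weight_space_eigen vh fW) rpredN rpredZ.
  apply: (limP (- a + a *+ k.+1)); last exact: weight_space_lie.
  by apply/prop_boolP; exists k; rewrite mulrS addrA addNr add0r.
move: tr0; rewrite comp_lfunDr lftrD.
have -> : (ad t \o p)%VF = - p.
  apply/lfunP => v; rewrite comp_lfunE opp_lfunE adE; have [k ->] := pf v.
  by rewrite lieZr (weight_space_eigen th fW) evN t1 scaleN1r scalerN.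
have -> : lftr (- p) = -1.
  rewrite lftrN (@lftr_projector _ _ _ <[f]>) ?dim_vline ?f0 //; split=> v.
    by rewrite comp_lfunE memv_proj.
  by case/vlineP=> k ->; rewrite linearZ /= comp_lfunE (Qid fW) projv_id ?memv_line.
have -> : (ad t \o \sum_(b <- s | B b) Q b = \sum_(b <- s | B b) (ad t \o Q b))%VF.
  apply/lfunP => v; rewrite comp_lfunE !sum_lfunE linear_sum; apply: eq_bigr => b _.
  by rewrite comp_lfunE.
rewrite -big_filter lftr_sum (eq_bigr (fun b => (\dim (W b))%:R * ev b t)) => [|b _]; last first.
  exact: lftr_Q.
have ain : a \in [seq b <- s | B b] by rewrite mem_filter Ba.
have rB b : b \in [seq b <- s | B b] -> B b by rewrite mem_filter => /andP[].
rewrite (perm_big _ (perm_to_rem ain)) big_cons t1 mulr1.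
have {}rB b : b \in rem a [seq b <- s | B b] -> B b by move/mem_rem; apply: rB.
have [N ->] : exists N : nat, \sum_(b <- rem a [seq b <- s | B b])
    (\dim (W b))%:R * ev b t = N%:R.
  move: (rem a _) rB => r; elim: r => [|b r IHr] rB; first by exists 0%N; rewrite big_nil.
  have [|N NE] := IHr; first by move=> c cr; apply: rB; rewrite inE cr orbT.
  have /prop_boolP[k bE] : B b by apply: rB; rewrite inE eqxx.
  exists (\dim (W b) * k + N)%N; rewrite big_cons NE natrD natrM; congr (_ * _ + _).
  by rewrite bE evMn t1 mulr1.
move/eqP; rewrite addrC subr_eq0 /= -natrD -[1]/(1%:R) -subr_eq0.
have le1 : (1 <= \dim (W a) + N)%N by rewrite addn_gt0 lt0n dimv_eq0 Wa0.
rewrite -natrB // (natf0 charF0) subn_eq0 => le.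
by apply/eqP; rewrite eqn_leq lt0n dimv_eq0 Wa0 (leq_trans (leq_addr _ _) le).
Qed.

Lemma weight_space_line a x : a != 0 -> x \in W a -> x != 0 -> W a = <[x]>%VS.
Proof.
move=> a0 xW x0; apply/esym/eqP; rewrite eqEdim -memvE xW /=.
by rewrite dim_vline x0 (dim_weight_space a0 (mem_support xW x0)).
Qed.

(* If [x, y] = 0, the lower half of the a-string through b is stable under     *)
(* ad x and ad f, so by traces b(t) >= 0; but then the traces on the upper     *)
(* half could not add up to 0.                                                 *)
Lemma lie_weight_neq0 a b x y : a != 0 -> b != 0 -> x \in W a -> y \in W b ->
  x != 0 -> y != 0 -> a + b \in s -> lie x y != 0.
Proof.
move=> a0 b0 xW yW x0 y0 abs; apply/negP => /eqP xy0.
have [f fW t1] := coroot_exists a0 xW x0; set t := lie x f in t1.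
pose B c := prop_bool (exists k : int, c = b + a *~ k).
pose Bm c := prop_bool (exists k : nat, c = b - a *+ k).
have Bx c v : B c -> v \in W c -> lie x v != 0 -> B (a + c).
  move=> /prop_boolP[k ->] _ _; apply/prop_boolP; exists (k + 1).
  by rewrite mulrzDr mulr1z addrCA [a + _]addrC.
have By c v : B c -> v \in W c -> lie f v != 0 -> B (- a + c).
  move=> /prop_boolP[k ->] _ _; apply/prop_boolP; exists (k - 1).
  by rewrite mulrzBr mulr1z addrC addrA.
have Bmx c v : Bm c -> v \in W c -> lie x v != 0 -> Bm (a + c).
  move=> /prop_boolP[[|k] ->].
    rewrite subr0 (weight_space_line b0 yW y0) => /vlineP[l ->].
    by rewrite lieZr xy0 scaler0 eqxx.
  move=> _ _; apply/prop_boolP; exists k.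
  by rewrite addrCA mulrS opprD addNKr.
have Bmy c v : Bm c -> v \in W c -> lie f v != 0 -> Bm (- a + c).
  move=> /prop_boolP[k ->] _ _; apply/prop_boolP; exists k.+1.
  by rewrite addrCA mulrS opprD.
have trB := trace_stable_weights xW fW Bx By.
have trBm := trace_stable_weights xW fW Bmx Bmy.
rewrite -/t in trB trBm.
have bs := mem_support yW y0.
have evBm c : Bm c -> exists k : nat, ev c t = ev b t - k%:R.
  by move=> /prop_boolP[k ->]; exists k; rewrite evD evN evMn t1 mulr1.
have bt : nonneg_rational_elt (ev b t).
  have bin : b \in [seq c <- s | Bm c].
    by rewrite mem_filter bs andbT; apply/prop_boolP; exists 0%N; rewrite subr0.
  move: trBm; rewrite -big_filter => trBm.
  have rB c : c \in [seq c <- s | Bm c] -> Bm c by rewrite mem_filter => /andP[].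
  move: [seq c <- s | Bm c] rB bin trBm => r rB br trBm.
  suff [N NE] : exists N : nat, \sum_(c <- r) (\dim (W c))%:R * ev c t =
      (\sum_(c <- r) \dim (W c))%N%:R * ev b t - N%:R.
    exists (\sum_(c <- r) \dim (W c))%N, N; split.
      by rewrite (perm_big _ (perm_to_rem br)) big_cons addn_eq0 dimv_eq0 (negPf (sn0 bs)).
    by apply/eqP; rewrite -subr_eq0 -NE trBm.
  elim: r rB {br trBm} => [|c r IHr] rB; first by exists 0%N; rewrite !big_nil mul0r subr0.
  have [|N NE] := IHr; first by move=> d dr; apply: rB; rewrite inE dr orbT.
  have [|k cE] := evBm c; first by apply: rB; rewrite inE eqxx.
  exists (\dim (W c) * k + N)%N; rewrite !big_cons NE cE !natrD natrM mulrDl mulrBr.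
  by rewrite opprD addrACA.
(* The upper half of the string need not be stable; its sum vanishes as the difference of two
   vanishing sums. *)
have trBp : \sum_(c <- s | B c && ~~ Bm c) (\dim (W c))%:R * ev c t = 0.
  move: trB; rewrite (bigID Bm) /= (eq_bigl Bm) ?trBm ?add0r // => c.
  rewrite andbC; case: (boolP (Bm c)) => //= /prop_boolP[k ->]; apply/prop_boolP.
  by exists (- k%:Z); rewrite mulrNz.
have abin : a + b \in [seq c <- s | B c && ~~ Bm c].
  rewrite mem_filter abs andbT; apply/andP; split.
    by apply/prop_boolP; exists 1; rewrite mulr1z addrC.
  apply/negP => /prop_boolP[k /eqP]; rewrite addrC (inj_eq (addrI b)) => /eqP ak.
  have : a *+ k.+1 = a *+ 0 by rewrite mulrS {1}ak addNr.
  by move/(mulrn_ev_inj t1).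
have g c : c \in s -> B c && ~~ Bm c -> nonneg_rational_elt ((\dim (W c))%:R * ev c t).
  move=> cs /andP[/prop_boolP[k ->] nBm]; apply: nonneg_rationalMn.
  rewrite evD evMz t1 mulr1; case: k nBm => k nBm.
    by apply: nonneg_rationalD => //; exists 1%N, k; rewrite mul1r.
  by case/prop_boolP: nBm; exists k.+1; rewrite NegzE mulrNz.
have := @nonneg_rational_sum0 F charF0 _ [seq c <- s | B c && ~~ Bm c]
  (fun c => if (c \in s) && (B c && ~~ Bm c) then (\dim (W c))%:R * ev c t else 0) (a + b).
rewrite abs; have /andP[-> /= _] := (allP (filter_all _ s) _ abin).
move: abin; rewrite mem_filter => /andP[/andP[-> ->] _] /=.
have E : \sum_(c <- [seq c <- s | B c && ~~ Bm c])
   (if (c \in s) && (B c && ~~ Bm c) then (\dim (W c))%:R * ev c t else 0) = 0.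
  rewrite -[RHS]trBp -[RHS]big_filter big_seq [RHS]big_seq; apply: eq_bigr => c.
  by rewrite mem_filter andbC => ->.
rewrite E => /(_ _ erefl) H.
have /eqP : (\dim (W (a + b)))%:R * ev (a + b) t = 0.
  apply: H => [c|]; first by case: ifP => [/andP[]|_]; [exact: g | exists 1%N, 0%N; split; rewrite ?mulr0].
  by rewrite abs.
rewrite mulf_eq0 (natf0 charF0) dimv_eq0 (negPf (sn0 abs)) /= evD t1 => /eqP.
have one : nonneg_rational_elt (1 : F) by exists 1%N, 1%N; rewrite mul1r.
by move=> /(nonneg_rational_add0 charF0 one bt)/eqP; rewrite oner_eq0.
Qed.

Lemma killing_weight_neq0 a x y : a != 0 -> x \in W a -> y \in W (- a) ->
  x != 0 -> y != 0 -> killing x y != 0.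
Proof.
move=> a0 xW yW x0 y0; have [z] := killing_pairing xW x0.
rewrite (@weight_space_line (- a) y) ?oppr_eq0 // => /vlineP[k ->].
apply: contra => /eqP kxy; by rewrite killingC killingZl killingC kxy mulr0.
Qed.

(** Let D act on W b by the scalar chi b. Then [D, ad x] = chi(a) ad x, so that tr (D ad [x, y]) =
    tr ([D, ad x] ad y) = chi(a) tr (ad x ad y). *)
Lemma trace_grading (chi : dual_space h -> F) a x y :
  chi 0 = 0 ->
  (forall b, b \in s -> a + b \in s -> chi (a + b) = chi a + chi b) ->
  x \in W a -> y \in W (- a) ->
  \sum_(b <- s) (\dim (W b))%:R * (chi b * ev b (lie x y)) = chi a * killing x y.
Proof.
move=> chi0 chiD xW yW; pose D := \sum_(b <- s) chi b *: Q b.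
have DE c u : u \in W c -> D u = chi c *: u.
  move=> uW; rewrite sum_lfunE; have [->|u0] := eqVneq u 0.
    by rewrite scaler0 big1 // => d _; rewrite linear0.
  have cs := mem_support uW u0; rewrite (bigD1_seq c) //= scale_lfunE Qid // big1 ?addr0 //.
  by move=> d dc; rewrite scale_lfunE (Q0 _ uW) // scaler0.
have comm : ((D \o ad x) - (ad x \o D) = chi a *: ad x)%VF.
  apply/lfunP => v; rewrite add_lfunE opp_lfunE scale_lfunE !comp_lfunE !adE.
  have DS (r : seq (dual_space h)) (f : dual_space h -> L) :
    D (\sum_(c <- r) f c) = \sum_(c <- r) D (f c) by exact: linear_sum.
  rewrite [v]Qsum lie_sumr !DS lie_sumr -sumrB scaler_sumr.
  apply: eq_bigr => b _; have bW := QW b v.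
  rewrite (DE (a + b)) ?weight_space_lie // (DE b) // lieZr -scalerBl.
  have [->|xb0] := eqVneq (lie x (Q b v)) 0; first by rewrite !scaler0.
  rewrite chiD ?addrK //; last exact: mem_support (weight_space_lie xW bW) xb0.
  by apply: (mem_support bW); apply/negP => /eqP b0; rewrite b0 lie0r eqxx in xb0.
have : lftr (D \o ad (lie x y))%VF = chi a * killing x y.
  rewrite /killing -lftrZ comp_lfunZl -comm ad_lie comp_lfunDr comp_lfunDl.
  rewrite comp_lfunNr comp_lfunNl !lftrB !comp_lfunA; congr (_ - _).
  by rewrite lftrC !comp_lfunA.
move=> <-; have -> : (D \o ad (lie x y) = \sum_(d <- s) chi d *: (Q d \o ad (lie x y)))%VF.
  apply/lfunP => u; rewrite comp_lfunE !sum_lfunE; apply: eq_bigr => d _.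
  by rewrite !scale_lfunE comp_lfunE.
rewrite lftr_sum; apply: eq_bigr => b _.
by rewrite lftrZ lftrC lftr_Q ?(lie_h_weight xW) // mulrCA.
Qed.

End Killing.

(** * Root space decomposition *)

(** Besides simplicity and characteristic 0, this is the interface between the structure of L and
    the combinatorics of roots. Traces carry no multiplicities any more because root spaces are
    lines. The constant k of [rs_grading] is the Killing product of x and y, the same for every
    chi. *)
Record root_structure (F : closedFieldType) (L : lieAlgType F) (h : {vspace L})
    (D : seq (dual_space h)) (Q : dual_space h -> 'End(L)) : Prop := RootStructure {
  rs_uniq : uniq D;
  rs_mem a : (a \in D) = (a \in root_system h);
  rs_proj a : projector_on (Q a) (root_space a);
  rs_proj0 a b v : a != b -> v \in root_space b -> Q a v = 0;
  rs_sum v : v = Q 0 v + \sum_(a <- D) Q a v;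
  rs_h : root_space (0 : dual_space h) = h;
  rs_separate x : x \in h -> (forall a, a \in D -> ev a x = 0) -> x = 0;
  rs_coroot a x : a \in D -> x \in root_space a -> x != 0 ->
    exists2 y, y \in root_space (- a) & ev a (lie x y) = 1;
  rs_line a x y : a \in D -> x \in root_space a -> x != 0 -> y \in root_space a ->
    exists k : F, y = k *: x;
  rs_neq0 a b x y : a \in D -> b \in D -> a + b \in D ->
    x \in root_space a -> y \in root_space b -> x != 0 -> y != 0 -> lie x y != 0;
  rs_trace (B : pred (dual_space h)) a x y :
    x \in root_space a -> y \in root_space (- a) ->
    (forall b v, B b -> v \in root_space b -> lie x v != 0 -> B (a + b)) ->
    (forall b v, B b -> v \in root_space b -> lie y v != 0 -> B (- a + b)) ->
    \sum_(b <- D | B b) ev b (lie x y) = 0;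
  rs_grading a x y : a \in D -> x \in root_space a -> y \in root_space (- a) ->
    x != 0 -> y != 0 -> exists2 k : F, k != 0 &
    forall chi : dual_space h -> F, chi 0 = 0 -> chi (- a) = - chi a ->
      (forall b, b \in D -> a + b \in D -> chi (a + b) = chi a + chi b) ->
      \sum_(b <- D) chi b * ev b (lie x y) = chi a * k
}.

Theorem root_structure_exists (F : closedFieldType) (charF0 : [pchar F] =i pred0)
    (L : lieAlgType F) (h : {vspace L}) :
  lie_simple L -> cartan_subalgebra h ->
  exists (D : seq (dual_space h)) (Q : dual_space h -> 'End(L)), root_structure D Q.
Proof.
move=> simL carth; have [subh nilh _] := carth.
have [s [Q [us sn0 QP Q0 Qsum]]] := weight_projectors charF0 nilh.
have RW (b : dual_space h) : root_space b = weight_space b.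
  by apply/vspaceP => v; apply: (root_space_weight charF0 simL carth us sn0 QP Q0 Qsum).
pose D := [seq a <- s | a != 0].
have DE a : (a \in D) = (a != 0) && (a \in s) by rewrite mem_filter.
have sumD (B : pred (dual_space h)) (f : dual_space h -> F) : f 0 = 0 ->
    \sum_(b <- D | B b) f b = \sum_(b <- s | B b) f b.
  move=> f0; rewrite big_filter_cond [RHS](bigID (fun b => b != 0)) /=.
  rewrite [X in _ = _ + X]big1 ?addr0; last by move=> b /andP[_]; rewrite negbK => /eqP ->.
  by apply: eq_bigl => b; rewrite andbC.
have dimE := dim_weight_space charF0 simL carth us sn0 QP Q0 Qsum.
have sumdim (B : pred (dual_space h)) (f : dual_space h -> F) : f 0 = 0 ->
    \sum_(b <- D | B b) f b = \sum_(b <- s | B b) (\dim (weight_space b))%:R * f b.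
  move=> f0; rewrite -sumD ?f0 ?mulr0 // big_seq_cond [RHS]big_seq_cond.
  by apply: eq_bigr => b /andP[]; rewrite DE => /andP[b0 bs] _; rewrite dimE // mul1r.
exists D, Q; split.
- exact: filter_uniq.
- move=> a; rewrite DE inE RW; congr (_ && _); apply/idP/idP => [/sn0 //|Wa0].
  by apply: (mem_support Q0 Qsum (memv_pick (weight_space a))); rewrite vpick0.
- by move=> a; rewrite RW.
- by move=> a b v ab; rewrite RW; apply: Q0.
- move=> v; rewrite {1}[v]Qsum [LHS](bigID (fun b => b != 0)) /= addrC big_filter.
  congr (_ + _); have [s0|nos0] := boolP (0 \in s).
    by rewrite -big_filter (eq_filter (a2 := pred1 0)) ?filter_pred1_uniq ?big_seq1 // => b;
      rewrite negbK.
  rewrite big_seq_cond big1 => [|b /andP[bs]]; last by rewrite negbK => /eqP b0; rewrite -b0 bs in nos0.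
  apply/esym/eqP; apply: contraR nos0; apply: (mem_support Q0 Qsum).
  exact: (QW QP).
- by rewrite RW (weight_space0 carth).
- move=> x xh x0; apply: (weights_separate charF0 simL carth sn0 QP Q0 Qsum xh) => b bs.
  by have [->|b0] := eqVneq b 0; [exact: ev0 | apply: x0; rewrite DE b0].
- move=> a x; rewrite DE !RW => /andP[a0 as_].
  exact: (coroot_exists charF0 simL carth us sn0 QP Q0 Qsum).
- move=> a x y; rewrite DE RW => /andP[a0 as_] xW x0.
  rewrite (weight_space_line charF0 simL carth us sn0 QP Q0 Qsum a0 xW x0).
  by move/vlineP.
- move=> a b x y; rewrite !DE !RW => /andP[a0 _] /andP[b0 _] /andP[_ abs] xW yW x0 y0.
  exact: (lie_weight_neq0 charF0 simL carth us sn0 QP Q0 Qsum a0 b0 xW yW).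
- move=> B a x y; rewrite !RW => xW yW Bx By.
  rewrite sumdim ?ev0 //; apply: (trace_stable_weights carth QP Q0 Qsum xW yW).
    by move=> b v Bb; rewrite -RW; apply: Bx.
  by move=> b v Bb; rewrite -RW; apply: By.
- move=> a x y; rewrite DE !RW => /andP[a0 as_] xW yW x0 y0.
  exists (killing x y); first exact: (killing_weight_neq0 charF0 simL carth us sn0 QP Q0 Qsum a0).
  move=> chi chi0 chiN chiD; rewrite (sumdim xpredT) ?chi0 ?mul0r //.

  apply: (trace_grading carth us QP Q0 Qsum) => // b bs abs.
  have [->|b0] := eqVneq b 0; first by rewrite addr0 chi0 addr0.
  have [ab0|ab0] := eqVneq (a + b) 0.
    have -> : b = - a by apply/eqP; rewrite -addr_eq0 addrC ab0.
    by rewrite subrr chi0 chiN subrr.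
  by apply: chiD; rewrite DE ?b0 ?ab0.
Qed.

(** * Roots and coroot spaces *)

Lemma sumv_seq_subP (K : fieldType) (V : vectType K) (I : eqType) (r : seq I) (P : pred I)
    (U : I -> {vspace V}) W :
  (forall i, i \in r -> P i -> (U i <= W)%VS) -> (\sum_(i <- r | P i) U i <= W)%VS.
Proof.
move=> UW; rewrite big_seq_cond; apply: (big_ind (fun Z => (Z <= W)%VS)).
- exact: sub0v.
- by move=> X Y XW YW; rewrite subv_add XW.
- by move=> i /andP[]; apply: UW.
Qed.

Section Roots.
Variables (F : closedFieldType) (charF0 : [pchar F] =i pred0).
Variables (L : lieAlgType F) (h : {vspace L}) (simL : lie_simple L).
Variables (D : seq (dual_space h)) (Q : dual_space h -> 'End(L)).
Hypothesis rs : root_structure D Q.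
Implicit Types (x y z u v t : L) (a b c : dual_space h).

Notation R := root_space.

Lemma lie_root a x v : x \in h -> v \in R a -> lie x v = ev a x *: v.
Proof. by move=> xh /root_spaceP; apply. Qed.

Lemma root_lie a b u v : u \in R a -> v \in R b -> lie u v \in R (a + b).
Proof.
move=> uR vR; apply/root_spaceP => x xh.
rewrite lie_jacobiE !(lie_root xh uR, lie_root xh vR) lieZl lieZr -scalerDl.
by rewrite -evD.
Qed.

Lemma root_zero : 0 \notin D.
Proof. by rewrite (rs_mem rs) inE eqxx. Qed.

Lemma root_neq0 a : a \in D -> a != 0.
Proof. by apply: contraTneq => ->; apply: root_zero. Qed.

Definition root_vector a : L := vpick (R a).
Notation E := root_vector.

Lemma root_vectorP a : E a \in R a.
Proof. exact: memv_pick. Qed.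

Lemma root_vector_neq0 a : a \in D -> E a != 0.
Proof. by rewrite (rs_mem rs) inE vpick0 => /andP[]. Qed.

Lemma mem_root a v : v \in R a -> v != 0 -> a != 0 -> a \in D.
Proof.
move=> vR v0 a0; rewrite (rs_mem rs) inE a0 /=.
by apply: contra v0 => /eqP R0; rewrite -memv0 -R0.
Qed.

Lemma root_vector_line a v : a \in D -> v \in R a -> exists k : F, v = k *: E a.
Proof.
by move=> aD; apply: (rs_line rs aD); [exact: root_vectorP | exact: root_vector_neq0].
Qed.

Lemma root_opp a : a \in D -> - a \in D.
Proof.
move=> aD; have [y yR t1] := rs_coroot rs aD (root_vectorP a) (root_vector_neq0 aD).
apply: (mem_root yR); last by rewrite oppr_eq0 root_neq0.
by apply/negP => /eqP y0; move: t1; rewrite y0 lie0r ev0r => /esym/eqP; rewrite oner_eq0.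
Qed.

Lemma mem_h x : (x \in h) = (x \in R (0 : dual_space h)).
Proof. by rewrite (rs_h rs). Qed.

Lemma QR a v : Q a v \in R a. Proof. by case: (rs_proj rs a). Qed.
Lemma QRid a v : v \in R a -> Q a v = v. Proof. by case: (rs_proj rs a) => _; apply. Qed.
Lemma Q0_h v : Q 0 v \in h. Proof. by rewrite mem_h QR. Qed.

Lemma h_abelian x y : x \in h -> y \in h -> lie x y = 0.
Proof. by move=> xh; rewrite mem_h => yh; rewrite (lie_root xh yh) ev0 scale0r. Qed.

(** For a root a this is the whole of [L_a, L_-a]: root spaces being lines, the choice of root
    vectors is immaterial. *)
Definition coroot_space a : {vspace L} := <[lie (E a) (E (- a))]>%VS.
Notation T := coroot_space.

Lemma lie_coroot a x y : a \in D -> x \in R a -> y \in R (- a) -> lie x y \in T a.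
Proof.
move=> aD /(root_vector_line aD)[k ->] /(root_vector_line (root_opp aD))[l ->].
by rewrite lieZl lieZr !rpredZ ?memv_line.
Qed.

Lemma coroot_space_h a : (T a <= h)%VS.
Proof. by rewrite -memvE mem_h -(subrr a) root_lie ?root_vectorP. Qed.

Lemma coroot_spaceN a : T (- a) = T a.
Proof.
rewrite /coroot_space opprK lieC.
by apply/vspaceP => v; apply/vlineP/vlineP => -[k ->]; exists (- k);
  rewrite scalerN -?scaleNr ?opprK.
Qed.

Lemma root_lie_neq0 a b : a \in D -> b \in D -> a + b \in D -> lie (E a) (E b) != 0.
Proof.
by move=> aD bD abD; apply: (rs_neq0 rs aD bD abD);
  rewrite ?root_vectorP ?root_vector_neq0.
Qed.

(** L_(a + b) is spanned by [x, y] for root vectors x, y. For z in L_-(a + b), Jacobi gives [[x, y],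
    z] = [x, [y, z]] - [y, [x, z]], where [y, z] lies in L_-a and [x, z] in L_-b. *)
Lemma coroot_spaceD a b : a \in D -> b \in D -> a + b \in D ->
  (T (a + b)%R <= T a + T b)%VS.
Proof.
move=> aD bD abD; rewrite -memvE.
have [k ->] : exists k : F, E (a + b) = k *: lie (E a) (E b).
  apply: (rs_line rs abD) (root_lie_neq0 aD bD abD) (root_vectorP _).
  by rewrite root_lie ?root_vectorP.
have zR := root_vectorP (- (a + b)); set z := E _ in zR *.
rewrite lieZl rpredZ // lie_jacobiE2 memv_add // ?rpredN.
  apply: lie_coroot => //; first exact: root_vectorP.
  have -> : - a = b + - (a + b) by rewrite opprD addrCA subrr addr0.
  by rewrite root_lie ?root_vectorP.
apply: lie_coroot => //; first exact: root_vectorP.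
have -> : - b = a + - (a + b) by rewrite opprD addNKr.
by rewrite root_lie ?root_vectorP.
Qed.

Definition root_or0 a := a = 0 \/ a \in D.

Lemma lie_root_or0 a b u v : u \in R a -> v \in R b -> lie u v != 0 -> root_or0 (a + b).
Proof.
move=> uR vR uv0; have [->|ab0] := eqVneq (a + b) 0; first by left.
by right; apply: (mem_root (root_lie uR vR)).
Qed.

(** For root vectors [[x, y], z] is nonzero, so by Jacobi [y, z] or [x, z] is nonzero. *)
Lemma root_triple a b c : a \in D -> b \in D -> c \in D -> a + b \in D -> a + b + c \in D ->
  root_or0 (a + c) \/ root_or0 (b + c).
Proof.
move=> aD bD cD abD abcD.
have : lie (lie (E a) (E b)) (E c) != 0.
  apply: (rs_neq0 rs abD cD abcD); rewrite ?root_lie ?root_vectorP ?root_lie_neq0 //.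
  exact: root_vector_neq0.
rewrite lie_jacobiE2; have [->|bc0 _] := eqVneq (lie (E b) (E c)) 0; last first.
  by right; apply: lie_root_or0 bc0; apply: root_vectorP.
rewrite lie0r sub0r oppr_eq0; have [->|ac0 _] := eqVneq (lie (E a) (E c)) 0.
  by rewrite lie0r eqxx.
by left; apply: lie_root_or0 ac0; apply: root_vectorP.
Qed.

Lemma simple_ideal_homogeneous (P : L -> Prop) :
  P 0 -> (forall (k : F) u v, P u -> P v -> P (k *: u + v)) ->
  (forall a x y, root_or0 a -> x \in R a -> P y -> P (lie x y)) ->
  (forall v, P v -> v = 0) \/ (forall v, P v).
Proof.
move=> P0 PZD PI; apply: simple_ideal => // x y Py.
have PD u v : P u -> P v -> P (u + v) by move=> Pu Pv; rewrite -[u]scale1r; apply: PZD.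
rewrite [x](rs_sum rs) lieDl lie_suml; apply: (PD).
  by apply: (PI 0); [left | exact: QR |].
have : {subset D <= D} by []; move: {1 3}D => r.
elim: r => [|a r IHr] sr; first by rewrite big_nil.
rewrite big_cons; apply: PD; last by apply: IHr => b br; apply: sr; rewrite inE br orbT.
by apply: (PI a) => //; [right; apply: sr; rewrite inE eqxx | exact: QR].
Qed.

(* The common centralizer of the root spaces R b, b in K, is an ideal.         *)
Lemma absorbing_interacts (K : dual_space h -> Prop) c a :
  c \in D -> K c -> (forall b, K b -> K (- b)) ->
  (forall b d, b \in D -> d \in D -> ~ K b -> K d -> b + d \in D -> K (b + d)) ->
  a \in D -> exists b, [/\ b \in D, K b & root_or0 (a + b)].
Proof.
move=> cD Kc KN KD aD; apply: NNPP => nK.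
pose P x := forall b z, b \in D -> K b -> z \in R b -> lie x z = 0.
have [|||P0|PT] := @simple_ideal_homogeneous P.
- by move=> b z *; rewrite lie0l.
- by move=> k u v Pu Pv b z bD Kb zR; rewrite lieDl lieZl (Pu b) // (Pv b) // scaler0 addr0.
- move=> d x y d0 xR Py b z bD Kb zR.
  rewrite lie_jacobiE2 (Py b) // lie0r sub0r; apply/eqP; rewrite oppr_eq0; apply/eqP.
  case: d0 => [d0|dD].
    have xh : x \in h by rewrite mem_h -d0.
    by rewrite (lie_root xh zR) lieZr (Py b) // scaler0.
  have [Kd|nKd] := classic (K d).
    by rewrite lie_jacobiE (Py b z) // lie0r addr0 (Py d x) ?lie0l.
  have [->|xz0] := eqVneq (lie x z) 0; first by rewrite lie0r.
  have [db0|dbD] := lie_root_or0 xR zR xz0.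
    by case: nKd; have -> : d = - b; [apply/eqP; rewrite -addr_eq0 db0 | apply: KN].
  by apply: (Py (d + b)) => //; [apply: KD | rewrite root_lie].
- have /negP[] := root_vector_neq0 aD; apply/eqP/P0 => b z bD Kb zR.
  apply/eqP/negPn/negP => az0; apply: nK; exists b; split=> //.
  by apply: lie_root_or0 az0; rewrite ?root_vectorP.
- have /negP[] := root_vector_neq0 cD; apply/eqP/(simple_center simL) => y.
  by rewrite lieC (PT y c) ?oppr0 ?root_vectorP.
Qed.

(** The vectors whose h-component lies in the sum of the T_a include all brackets, hence form a
    nonzero ideal. *)
Lemma h_coroots x : x \in h -> x \in (\sum_(a <- D) T a)%VS.
Proof.
set U := (\sum_(a <- D) T a)%VS => xh.
have TU a : a \in D -> (T a <= U)%VS.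
  by move=> /perm_to_rem aD; rewrite /U (perm_big _ aD) big_cons addvSl.
have brk u v : Q 0 (lie u v) \in U.
  rewrite [u](rs_sum rs) lieDl linearD lie_suml linear_sum rpredD //.
    rewrite [v](rs_sum rs) lieDr linearD lie_sumr linear_sum rpredD //=.
      by rewrite h_abelian ?Q0_h // linear0 mem0v.
    rewrite big_seq rpred_sum // => a aD /=.
    rewrite (rs_proj0 rs (b := 0 + a)) ?mem0v ?root_lie ?QR //.
    by rewrite add0r eq_sym root_neq0.
  rewrite big_seq rpred_sum // => a aD /=.
  rewrite [v](rs_sum rs) lieDr linearD lie_sumr linear_sum rpredD //=.
    rewrite (rs_proj0 rs (b := a + 0)) ?mem0v ?root_lie ?QR //.
    by rewrite addr0 eq_sym root_neq0.
  rewrite big_seq rpred_sum // => b bD /=.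
  have [ab0|ab0] := eqVneq (a + b) 0; last first.
    by rewrite (rs_proj0 rs (b := a + b)) ?mem0v ?root_lie ?QR // eq_sym.
  have -> : b = - a by apply/eqP; rewrite -addr_eq0 addrC ab0.
  have tT : lie (Q a u) (Q (- a) v) \in T a by rewrite lie_coroot ?QR.
  rewrite QRid; first exact: (subvP (TU a aD)).
  by rewrite -mem_h (subvP (coroot_space_h a)).
have [|||P0|PT] := @simple_ideal _ _ (fun v => Q 0 v \in U) simL.
- by rewrite linear0 mem0v.
- by move=> k u v uU vU; rewrite linearP rpredD ?rpredZ.
- by move=> u v _; apply: brk.
- by have [[u [v /eqP uv0]] _] := simL; case: uv0; apply: P0; apply: brk.
by rewrite -(QRid (a := 0) (v := x)) -?mem_h.
Qed.

Definition grading_form (chi : dual_space h -> F) t := \sum_(b <- D) chi b * ev b t.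

Lemma grading_formP chi (k : F) t u :
  grading_form chi (k *: t + u) = k * grading_form chi t + grading_form chi u.
Proof.
rewrite /grading_form mulr_sumr -big_split; apply: eq_bigr => b _ /=.
by rewrite evP mulrDr mulrCA.
Qed.

Lemma grading_formZ chi (k : F) t : grading_form chi (k *: t) = k * grading_form chi t.
Proof.
by rewrite /grading_form mulr_sumr; apply: eq_bigr => b _; rewrite evZ mulrCA.
Qed.

Section Grading.
Variable chi : dual_space h -> F.
Hypotheses (chi0 : chi 0 = 0) (chiN : forall a, a \in D -> chi (- a) = - chi a)
  (chiD : forall a b, a \in D -> b \in D -> a + b \in D -> chi (a + b) = chi a + chi b).

Lemma grading_form_coroot a : a \in D -> exists2 k : F, k != 0 &
  grading_form chi (lie (E a) (E (- a))) = chi a * k.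
Proof.
move=> aD; have naD := root_opp aD.
have [k k0 kP] := rs_grading rs aD (root_vectorP a) (root_vectorP (- a))
  (root_vector_neq0 aD) (root_vector_neq0 naD).
exists k => //; apply: kP => //; first exact: chiN.
by move=> b; apply: chiD.
Qed.

Lemma grading_form0 a t : a \in D -> chi a = 0 -> t \in T a -> grading_form chi t = 0.
Proof.
move=> aD ca0 /vlineP[l ->]; have [k _ kE] := grading_form_coroot aD.
by rewrite grading_formZ kE ca0 mul0r mulr0.
Qed.

Lemma grading_form_inj a t : a \in D -> chi a != 0 -> t \in T a ->
  grading_form chi t = 0 -> t = 0.
Proof.
move=> aD ca0 /vlineP[l ->]; have [k k0 kE] := grading_form_coroot aD.
rewrite grading_formZ kE => /eqP.
by rewrite !mulf_eq0 (negPf ca0) (negPf k0) !orbF => /eqP ->; rewrite scale0r.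
Qed.

End Grading.

(* Each eigenspace of ad t is stable under the root vectors of A, whose        *)
(* brackets span a space containing t; so the trace of ad t on it vanishes.    *)
Lemma coroot_center0 (A : pred (dual_space h)) t :
  t \in (\sum_(a <- D | A a) T a)%VS -> (forall a, a \in D -> A a -> ev a t = 0) -> t = 0.
Proof.
move=> tA t0; have th : t \in h.
  by apply: subvP tA; apply: sumv_seq_subP => a _ _; apply: coroot_space_h.
apply: (rs_separate rs th) => b bD; apply/eqP/negPn/negP => bt0.
pose B c := ev c t == ev b t.
have [||U UP] := @pred_vspace _ L (fun u => \sum_(c <- D | B c) ev c u = 0).
- by rewrite big1 // => c _; rewrite ev0r.
- move=> k u v u0 v0; rewrite (eq_bigr (fun c => k * ev c u + ev c v)) => [|c _]; last exact: evP.
  by rewrite big_split -mulr_sumr /= u0 v0 mulr0 addr0.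
have /UP : t \in U.
  apply: subvP tA; apply: sumv_seq_subP => a aD Aa.
  rewrite -memvE; apply/UP; apply: (rs_trace rs (root_vectorP a) (root_vectorP (- a))).
    by move=> c v /eqP ct _ _; rewrite /B evD t0 // add0r ct.
  by move=> c v /eqP ct _ _; rewrite /B evD evN t0 // oppr0 add0r ct.
rewrite (eq_bigr (fun=> ev b t)) => [|c /eqP //].
rewrite -big_filter big_const_seq count_predT iter_addr_0 -mulr_natr => /eqP.
rewrite mulf_eq0 (negPf bt0) (natf0 charF0) size_filter -leqn0 leqNgt -has_count.
by case/negP; apply/hasP; exists b => //; rewrite /B.
Qed.

End Roots.

(** * Colorings of the root system *)

Section Coloring.
Variables (F : closedFieldType) (charF0 : [pchar F] =i pred0).
Variables (L : lieAlgType F) (h : {vspace L}) (simL : lie_simple L).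
Variables (D : seq (dual_space h)) (Q : dual_space h -> 'End(L)).
Hypothesis rs : root_structure D Q.
Variables (m : nat) (c : dual_space h -> 'I_m).
Hypotheses (cD : forall a b, a \in D -> b \in D -> a + b \in D ->
    c (a + b) = c a \/ c (a + b) = c b)
  (csurj : forall i, exists2 a, a \in D & c a = i) (m3 : (3 <= m)%N).
Implicit Types (a b d e : dual_space h) (i j k l : 'I_m).

Notation T := coroot_space.
Notation root_or0 := (root_or0 D).

Local Lemma rN a : a \in D -> - a \in D.
Proof. exact: (root_opp rs). Qed.

Local Lemma rNE a : (- a \in D) = (a \in D).
Proof. by apply/idP/idP => [/rN|/rN //]; rewrite opprK. Qed.

Lemma color_sub a b : a \in D -> b \in D -> a + b \in D ->
  c a = c (a + b) \/ c a = c (- b).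
Proof.
move=> aD bD abD; have := cD abD (rN bD); rewrite addrK.
by apply.
Qed.

Lemma third_color i j : exists l, l != i /\ l != j.
Proof.
suff /set0Pn[l] : ~: [set i; j] != set0 by rewrite !inE negb_or => /andP[]; exists l.
rewrite -card_gt0 cardsCs setCK card_ord subn_gt0 cards2.
by apply: leq_trans m3; case: (i != j).
Qed.

(* In the hexagon formed by b, a + b, a and their opposites every vertex       *)
(* shares its color with a neighbor; a third color at b forces the others.     *)
Lemma color_forced a b : a \in D -> b \in D -> b + a \in D ->
  c b != c a -> c b != c (- a) ->
  [/\ c (b + a) = c b, c (- b) = c a & c (- (b + a)) = c (- a)].
Proof.
move=> aD bD abD ba bna.
have nabD : - b + - a \in D by rewrite -opprD rN.
have ab : c (b + a) = c b.
  by case: (color_sub bD aD abD) => E; [rewrite -E | rewrite E eqxx in bna].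
have na : c a = c (- b).
  have := color_sub aD bD; rewrite addrC => /(_ abD)[E|//].
  by rewrite E ab eqxx in ba.
split=> //.
have := color_sub (rN aD) (rN bD); rewrite addrC => /(_ nabD); rewrite opprK opprD.
by case=> // E; rewrite E eqxx in bna.
Qed.

Lemma color_opp a b : a + b = 0 -> c b = c (- a).
Proof. by move/eqP; rewrite addrC addr_eq0 => /eqP ->. Qed.

(** * Bad triples and additivity of the degree *)

Section BadTriple.
Variables (i j : 'I_m) (a b : dual_space h).
Hypotheses (aD : a \in D) (bD : b \in D) (abD : a + b \in D).
Hypotheses (ca : c a = i) (cb : c b = i) (cna : c (- a) = j) (cnb : c (- b) = j) (ij : i != j).

(** By [root_triple], a + e or b + e is a root, say a + e. The hexagon rule for a and e puts color j
    at -(a + e), while the rule for b and a + e puts color i there. *)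
Lemma bad_no_add e : e \in D -> c e != i -> c e != j -> a + b + e \notin D.
Proof.
move=> eD ei ej; apply/negP => abeD.
have step x y : x \in D -> y \in D -> c x = i -> c y = i -> c (- x) = j -> c (- y) = j ->
    x + e \in D -> x + y + e \in D -> False.
  move=> xD yD cx cy cnx cny xeD xyeD.
  have [] := @color_forced x e xD eD; rewrite ?cx ?cnx // addrC // => xe nex nxe.
  have [] := @color_forced y (x + e) yD xeD; rewrite ?xe ?cy ?cny //.
    by rewrite addrAC.
  by move=> _ E _; move: ij; rewrite -E nxe eqxx.
have [[]|[]] := root_triple rs aD bD eD abD abeD.
- by move=> /color_opp E; rewrite E cna eqxx in ej.
- by move=> aeD; apply: (step a b).
- by move=> /color_opp E; rewrite E cnb eqxx in ej.
- by move=> beD; apply: (step b a) => //; rewrite [b + a]addrC.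
Qed.
End BadTriple.

Definition outside i j a : Prop := (c a != i /\ c a != j) \/ (c (- a) != i /\ c (- a) != j).

Lemma outside_opp i j a : outside i j a -> outside i j (- a).
Proof. by rewrite /outside opprK => -[]; [right | left]. Qed.

Lemma insideP i j a : ~ outside i j a ->
  (c a = i \/ c a = j) /\ (c (- a) = i \/ c (- a) = j).
Proof.
move=> out; split.
  have [|ai] := eqVneq (c a) i; first by left.
  by have [|aj] := eqVneq (c a) j; [right | case: out; left].
have [|ai] := eqVneq (c (- a)) i; first by left.
by have [|aj] := eqVneq (c (- a)) j; [right | case: out; right].
Qed.

Lemma outside_add i j a b : a \in D -> b \in D -> ~ outside i j a -> outside i j b ->
  a + b \in D -> outside i j (a + b).
Proof.
move=> aD bD /insideP[ca cna] ob abD; apply: NNPP => /insideP[cab cnab].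
have abD' : b + a \in D by rewrite addrC.
have nabD : - b + - a \in D by rewrite -opprD rN.
case: ob => -[bi bj].
  by case: (color_sub bD aD abD') => E; rewrite -?[b + a]addrC E in bi bj;
    [rewrite addrC in bi bj; case: cab | case: cna] => E'; rewrite E' eqxx in bi bj.
case: (color_sub (rN bD) (rN aD) nabD) => E; rewrite E in bi bj.
  by rewrite -opprD addrC in bi bj; case: cnab => E'; rewrite E' eqxx in bi bj.
by rewrite opprK in bi bj; case: ca => E'; rewrite E' eqxx in bi bj.
Qed.

(** The roots with a third color at one end at least form a nonempty absorbing set, so one of them,
    e, makes a + b + e a root. If e itself has the third color, [bad_no_add] excludes this. *)
Lemma no_bad_triple a b : a \in D -> b \in D -> a + b \in D ->
  c b = c a -> c (a + b) = c a -> c (- b) = c (- a) -> c (- (a + b)) = c (- a) ->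
  c a = c (- a).
Proof.
move=> aD bD abD cb cab cnb cnab; apply/eqP/negPn/negP => ij.
have [k [ki kj]] := third_color (c a) (c (- a)); have [z zD cz] := csurj k.
have noadd := bad_no_add aD bD abD erefl cb erefl cnb ij.
have [|||e [eD oe]] := absorbing_interacts simL rs (K := outside (c a) (c (- a))) zD _ _ _ abD.
- by left; rewrite cz.
- exact: outside_opp.
- by move=> b' d b'D dD; apply: outside_add.
case=> [/eqP|abeD].
  rewrite addrC addr_eq0 => /eqP eE; case: oe => -[e1 e2]; rewrite eE in e1 e2.
    by rewrite cnab eqxx in e2.
  by rewrite opprK cab eqxx in e1.
case: oe => [[ei ej]|[ei ej]]; first by rewrite (negPf (noadd e eD ei ej)) in abeD.
(* Otherwise the third color sits at -e. Then e' = -e - (a + b) has that color too, and a + b + e' =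
   -e is a root. *)
have [|||||E _ _] := @color_forced (- (a + b)) (- e).
- exact: rN.
- exact: rN.
- by rewrite -opprD rN // addrC.
- by rewrite cnab.
- by rewrite opprK cab.
have := noadd (- e + - (a + b)); rewrite E addrCA subrr addr0 => /(_ _ ei ej).
by rewrite !rNE eD -opprD rNE addrC abeD => /(_ isT).
Qed.

Definition degree i a : int := (c (- a) == i)%:R - (c a == i)%:R.

Lemma degreeN i a : degree i (- a) = - degree i a.
Proof. by rewrite /degree opprK opprB. Qed.

(** In the hexagon of a, b, a + b and their opposites each color agrees with that of a neighbor. The
    identity is then formal unless one of the triples (a, b, a + b), (a + b, -b, a), (a + b, -a, b)
    has a common type (i, j), and in that case [no_bad_triple] gives i = j. *)
Lemma degreeD i a b : a \in D -> b \in D -> a + b \in D ->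
  degree i (a + b) = degree i a + degree i b.
Proof.
move=> aD bD abD; have naD := rN aD; have nbD := rN bD.
have nabD := rN abD; have nabD' : - a + - b \in D by rewrite -opprD.
have r := cD aD bD abD.
have := cD naD nbD nabD'; rewrite -opprD => r'.
have p := color_sub aD bD abD.
have q : c b = c (a + b) \/ c b = c (- a).
  by have := color_sub bD aD; rewrite addrC => /(_ abD).
have := color_sub naD nbD nabD'; rewrite -opprD opprK => p'.
have q' : c (- b) = c (- (a + b)) \/ c (- b) = c a.
  by have := color_sub nbD naD; rewrite addrC => /(_ nabD'); rewrite -opprD opprK.
have bad1 := no_bad_triple aD bD abD.
have bad2 : c (- b) = c a -> c (a + b) = c a -> c b = c (- a) ->
    c (- (a + b)) = c (- a) -> c a = c (- a).
  move=> e1 e2 e3 e4; have := @no_bad_triple (a + b) (- b) abD nbD.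
  by rewrite addrK opprK e2 e4 => /(_ aD e1 erefl e3 erefl).
have bad3 : c (- a) = c b -> c (a + b) = c b -> c a = c (- b) ->
    c (- (a + b)) = c (- b) -> c b = c (- b).
  move=> e1 e2 e3 e4; have := @no_bad_triple (a + b) (- a) abD naD.
  have -> : a + b + - a = b by rewrite addrC addKr.
  by rewrite opprK e2 e4 => /(_ bD e1 erefl e3 erefl).
rewrite /degree.
case: r => r; case: r' => r'; rewrite r r' in p q p' q' bad1 bad2 bad3 *.
- case: q => q; case: q' => q'.
  + by have := bad1 q erefl q' erefl; rewrite q q' => ->; ring.
  + by rewrite q q'; ring.
  + by rewrite q q'; ring.
  + by have := bad2 q' erefl q erefl; rewrite q q' => ->; ring.
- case: q => q; last by rewrite q; ring.
  case: p' => p'; last by rewrite p'; ring.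
  by have := bad1 q erefl (esym p') (esym p'); rewrite q p' => ->; ring.
- case: p => p; last by rewrite p; ring.
  case: q' => q'; last by rewrite q'; ring.
  by have := bad1 (esym p) (esym p) q' erefl; rewrite p q' => ->; ring.
- case: p => p; case: p' => p'.
  + by have := bad1 (esym p) (esym p) (esym p') (esym p'); rewrite p p' => ->; ring.
  + by rewrite p p'; ring.
  + by rewrite p p'; ring.
  + by have := bad3 p' erefl p erefl; rewrite p p' => ->; ring.
Qed.

(** * Roots of prescribed types *)

Lemma color_absorbing l a b : a \in D -> b \in D ->
  ~ (c a = l \/ c (- a) = l) -> c b = l \/ c (- b) = l -> a + b \in D ->
  c (a + b) = l \/ c (- (a + b)) = l.
Proof.
move=> aD bD na bl abD; apply: NNPP => nab.
have abD' : b + a \in D by rewrite addrC.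
have nabD : - b + - a \in D by rewrite -opprD rN.
case: bl => bl.
  have [E|E] := color_sub bD aD abD'.
    by apply: nab; left; rewrite addrC -E.
  by apply: na; right; rewrite -E.
have [E|E] := color_sub (rN bD) (rN aD) nabD.
  by apply: nab; right; rewrite addrC opprD -E.
by apply: na; left; rewrite -[a]opprK -E.
Qed.

Lemma color_interacts l a : a \in D -> exists b, [/\ b \in D, c b = l \/ c (- b) = l
  & root_or0 (a + b)].
Proof.
move=> aD; have [z zD cz] := csurj l.
apply: (absorbing_interacts simL rs (K := fun b => c b = l \/ c (- b) = l) zD) => //.
- by left.
- by move=> b; rewrite opprK => -[]; [right | left].
- by move=> b d bD dD; apply: color_absorbing.
Qed.

(** Simplicity gives a root z, with color l at z or at -z, such that a + z is a root. As l differs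
    from both colors of a, the hexagon rule fixes all colors, and the summands are -z and a + z, in
    the order decided by the place of l. *)
Lemma interpolate l a : a \in D -> l != c a -> l != c (- a) ->
  exists b d, [/\ b \in D, d \in D, a = b + d, c b = c a /\ c (- b) = l
    & c d = l /\ c (- d) = c (- a)].
Proof.
move=> aD la lna; have [z [zD zl]] := color_interacts l aD.
case=> [az0|azD].
  have zE : z = - a by apply/eqP; rewrite -addr_eq0 addrC az0.
  by case: zl => E; [rewrite -E zE eqxx in lna | rewrite -E zE opprK eqxx in la].
have zaD : z + a \in D by rewrite addrC.
case: zl => cz.
  have [||e1 e2 e3] := color_forced aD zD zaD; rewrite ?cz //.
  by exists (- z), (z + a); rewrite addKr opprK rN // e1 e2 e3 cz.
have nzaD : - z + - a \in D by rewrite -opprD rN.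
have [||e1 e2 e3] := color_forced (rN aD) (rN zD) nzaD; rewrite ?cz ?opprK //.
rewrite opprK in e2; rewrite -opprD !opprK in e1 e3.
by exists (a + z), (- z); rewrite addrK opprK rN // [a + z]addrC e1 e2 e3 cz.
Qed.

(** Otherwise every root shares its color with its opposite; two roots of different colors then
    never add up to a root or 0, whereas simplicity provides such a pair. *)
Lemma mixed_root : exists2 a, a \in D & c a != c (- a).
Proof.
apply: NNPP => nex; have same a : a \in D -> c (- a) = c a.
  by move=> aD; apply/eqP/negPn/negP => ne; apply: nex; exists a => //; rewrite eq_sym.
have i0 : 'I_m by exact: (Ordinal (leq_trans (isT : 0 < 3)%N m3)).
have [j [ji _]] := third_color i0 i0.
have [a aD ca] := csurj j; have [z [zD zl]] := color_interacts i0 aD.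
have {zl} cz : c z = i0 by case: zl => //; rewrite same.
case=> [/color_opp|azD]; first by rewrite same // ca cz => E; rewrite E eqxx in ji.
have abs := @color_absorbing i0 a z aD zD _ (or_introl cz) azD.
have : c (a + z) = i0.
  by case: abs => //; [rewrite same // ca => -[] E; rewrite E eqxx in ji | rewrite same].
have [] := color_sub aD zD azD; rewrite ?same // ca ?cz => E.
  by rewrite -E => E'; rewrite E' eqxx in ji.
by rewrite E eqxx in ji.
Qed.

(** With k the color of -a0, the remaining e_i come from a decomposition a0 = (a0 - e_i) + e_i
    through the color i, so e_i has type (i, k). For a general e_i - e_j, [root_triple] is applied
    to (a0 - e_i) + e_i + (- e_j): colors exclude a0 - e_i - e_j, which leaves e_i - e_j. *)
Lemma frame_exists a0 : a0 \in D -> c a0 != c (- a0) -> exists e : 'I_m -> dual_space h,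
  [/\ e (c (- a0)) = 0, e (c a0) = a0 & forall i j, i != j ->
     [/\ e i - e j \in D, c (e i - e j) = i & c (- (e i - e j)) = j]].
Proof.
move=> aD mixa; set k := c (- a0) in mixa *; set i0 := c a0 in mixa *.
pose P i b := [/\ i = k -> b = 0, i = i0 -> b = a0,
  i != k -> [/\ b \in D, c b = i & c (- b) = k]
  & i != i0 -> [/\ a0 - b \in D, c (a0 - b) = i0 & c (- (a0 - b)) = i]].
have ex i : exists b, P i b.
  have [->|ik] := eqVneq i k.
    by exists 0; split=> //; [move=> E; rewrite E eqxx in mixa | rewrite eqxx | rewrite subr0].
  have [->|ii0] := eqVneq i i0.
    by exists a0; split=> //; [move=> E; rewrite E eqxx in mixa | rewrite eqxx].
  have [b [d [bD dD aE [cb cnb] [cd cnd]]]] := interpolate aD ii0 ik.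
  exists d; split=> //; [by move=> E; rewrite E eqxx in ik | by move=> E; rewrite E eqxx in ii0|].
  by rewrite {1 2 3}aE addrK.
pose e i := sval (constructive_indefinite_description _ (ex i)).
have eP i : P i (e i) by rewrite /e; case: constructive_indefinite_description.
exists e; split; [by case: (eP k) => E *; apply: E | by case: (eP i0) => _ E *; apply: E |].
move=> i j ij; have [ei0 eia eiD bi] := eP i; have [ej0 eja ejD bj] := eP j.
have [jk|jk] := eqVneq j k.
  by rewrite (ej0 jk) subr0 jk; apply: eiD; rewrite -jk.
have {ejD} [ejD cej cnej] := ejD jk.
have [ik|ik] := eqVneq i k.
  by rewrite (ei0 ik) sub0r opprK rN // cnej cej -ik.
have {eiD} [eiD cei cnei] := eiD ik.
have [ii|ii] := eqVneq i i0.
  by rewrite (eia ii) ii; apply: bj; rewrite -ii eq_sym.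
have {bi} [biD cbi cnbi] := bi ii.
have [ji|ji] := eqVneq j i0.
  have -> : e i - e j = - (a0 - e i) by rewrite (eja ji) opprB.
  by rewrite opprK rN // cnbi cbi -ji.
have {bj} [bjD cbj cnbj] := bj ji.
have := @root_triple _ _ _ _ _ rs (a0 - e i) (e i) (- e j) biD eiD (rN ejD).
rewrite subrK => /(_ aD bjD)[[]|[]].
- by move/color_opp; rewrite cnej cnbi => E; rewrite E eqxx in ik.
- move=> sD; have [|||E1 E2 E3] := @color_forced (a0 - e i) (- e j) biD (rN ejD).
  + by rewrite addrC.
  + by rewrite cnej cbi eq_sym.
  + by rewrite cnej cnbi eq_sym.
  by move: ji; rewrite -cej -[e j]opprK E2 cbi eqxx.
- by move/eqP; rewrite subr_eq0 => /eqP E; rewrite -cei E cej eqxx in ij.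
move=> sD; have [|||E1 E2 E3] := @color_forced (- e j) (e i) (rN ejD) eiD.
- by [].
- by rewrite cei cnej.
- by rewrite cei opprK cej.
by rewrite E1 E3 cei opprK cej.
Qed.

(** * Coroot lines of roots of the same type *)

Lemma degree_eqN1 i a : degree i a = - 1 <-> c a = i /\ c (- a) != i.
Proof.
rewrite /degree; split; last by case=> -> /negPf ->; rewrite eqxx.
by case: eqVneq => _; case: eqVneq.
Qed.

Lemma degree_eq1 i a : degree i a = 1 <-> c a != i /\ c (- a) = i.
Proof.
rewrite /degree; split; last by case=> /negPf -> ->; rewrite eqxx.
by case: eqVneq => // ?; case: eqVneq.
Qed.

Lemma degree_eq0 i a : degree i a = 0 <-> (c a == i) = (c (- a) == i).
Proof.
by rewrite /degree; split=> [|->]; [case: eqVneq => _; case: eqVneq | rewrite subrr].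
Qed.

Lemma degree_bound i a : [\/ degree i a = 0, degree i a = 1 | degree i a = - 1].
Proof.
rewrite /degree; case: eqVneq => _; case: eqVneq => _.
- by constructor 1.
- by constructor 2.
- by constructor 3.
- by constructor 1.
Qed.

Lemma type_add0 a d : a \in D -> d \in D -> a + d \in D -> c a != c (- a) -> c d = c (- d) ->
  [/\ c (a + d) = c a, c (- (a + d)) = c (- a) & c d = c a \/ c d = c (- a)].
Proof.
move=> aD dD adD mix cd.
have deg l : degree l (a + d) = degree l a.
  by rewrite degreeD // [degree l d](degree_eq0 _ _).2 ?addr0 // cd.
have [E1 _] : c (a + d) = c a /\ c (- (a + d)) != c a.
  by apply/degree_eqN1; rewrite deg; apply/degree_eqN1; rewrite eq_sym.
have [_ E2] : c (a + d) != c (- a) /\ c (- (a + d)) = c (- a).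
  by apply/degree_eq1; rewrite deg; apply/degree_eq1.
split=> //; have := color_sub dD aD; rewrite addrC => /(_ adD).
by rewrite E1.
Qed.

(** Types compose like matrix units, (i, j) + (j, l) = (i, l); with the color i absent from d no
    other composition is possible. *)
Lemma type_add a d : a \in D -> d \in D -> a + d \in D -> c a != c (- a) ->
  c d != c (- d) -> c d != c a -> c (- d) != c a ->
  [/\ c d = c (- a), c (a + d) = c a & c (- (a + d)) = c (- d)].
Proof.
move=> aD dD adD mixa mixd da nda.
have [E|E] := eqVneq (c d) (c (- a)); last first.
  have daD : d + a \in D by rewrite addrC.
  by have [_ E' _] := color_forced aD dD daD da E; rewrite E' eqxx in nda.
have [E1 _] : c (a + d) = c a /\ c (- (a + d)) != c a.
  apply/degree_eqN1; rewrite degreeD // (degree_eqN1 _ _).2; last by rewrite eq_sym.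
  by rewrite [degree _ d](degree_eq0 _ _).2 ?addr0 // (negPf da) (negPf nda).
have [_ E2] : c (a + d) != c (- d) /\ c (- (a + d)) = c (- d).
  apply/degree_eq1; rewrite degreeD // [degree _ d](degree_eq1 _ _).2; last by split.
  by rewrite [degree _ a](degree_eq0 _ _).2 ?add0r // -E (negPf mixd) eq_sym (negPf nda).
by split.
Qed.

Definition diag_space i : {vspace L} :=
  (\sum_(a <- D | (c a == i) && (c (- a) == i)) T a)%VS.
Notation A := diag_space.

Lemma coroot_diag a i : a \in D -> c a = i -> c (- a) = i -> (T a <= A i)%VS.
Proof.
move=> aD ca cna; rewrite /diag_space -big_filter.
have ain : a \in [seq a <- D | (c a == i) && (c (- a) == i)].
  by rewrite mem_filter ca cna eqxx.
by rewrite (perm_big _ (perm_to_rem ain)) big_cons addvSl.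
Qed.

Section SameType.
Variables (i j : 'I_m) (a0 : dual_space h).
Hypotheses (a0D : a0 \in D) (ca0 : c a0 = i) (cna0 : c (- a0) = j) (ij : i != j).

Definition congruent r := [/\ r \in D, c r = i, c (- r) = j
  & (T r <= T a0 + (A i + A j))%VS].

Lemma congruent_add r d : congruent r -> d \in D -> c d = c (- d) -> r + d \in D ->
  congruent (r + d).
Proof.
move=> [rD cr cnr Tr] dD cd rdD.
have [|E1 E2 E3] := type_add0 rD dD rdD _ cd; first by rewrite cr cnr.
split=> //; rewrite ?E1 ?E2 //.
apply: subv_trans (coroot_spaceD rs rD dD rdD) _; rewrite subv_add Tr /=.
apply: subv_trans (addvSr _ _); case: E3; rewrite ?cr ?cnr => E.
  by apply: subv_trans (addvSl _ _); apply: coroot_diag; rewrite -?cd.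
by apply: subv_trans (addvSr _ _); apply: coroot_diag; rewrite -?cd.
Qed.

(** A bound for what is reached from a0 by adding roots of degree 0 at i. Such steps may leave the
    type (i, j) for some (i, l) and come back, so the intermediate roots are described as r0 + g
    with r0 congruent to a0 and g of type (j, l). For a root of type (i, j) only the first
    alternative is possible. *)
Definition row_generated r := [/\ r \in D, c r = i, c (- r) != i
  & congruent r \/ exists r0 g, [/\ congruent r0, g \in D, c g = j,
      c (- g) = c (- r) /\ c (- g) != j & r = r0 + g]].

Lemma row_generated_add r d : row_generated r -> d \in D -> degree i d = 0 -> r + d \in D ->
  row_generated (r + d).
Proof.
move=> [rD cr cnr gen] dD /degree_eq0 di rdD.
have mixr : c r != c (- r) by rewrite cr eq_sym.
have [dsame|dmix] := eqVneq (c d) (c (- d)).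
  have [E1 E2 _] := type_add0 rD dD rdD mixr dsame.
  split; rewrite ?E1 ?E2 //.
  case: gen => [gen|[r0 [g [gr0 gD cg [cng gj] rE]]]].
    by left; apply: congruent_add.
  have [r0D cr0 cnr0 _] := gr0; right.
  have := @root_triple _ _ _ _ _ rs r0 g d r0D gD dD; rewrite -rE => /(_ rD rdD)[[]|[]].
  - move/eqP; rewrite addrC addr_eq0 => /eqP dE.
    by move: dsame ij; rewrite dE opprK cr0 cnr0 => ->; rewrite eqxx.
  - move=> r0dD; exists (r0 + d), g; split=> //; last by rewrite rE addrAC.
    exact: congruent_add.
  - move/eqP; rewrite addrC addr_eq0 => /eqP dE.
    by move: dsame; rewrite dE opprK cg => E; rewrite E eqxx in gj.
  - move=> gdD; have [|F1 F2 _] := type_add0 gD dD gdD _ dsame.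
      by rewrite cg eq_sym.
    by exists r0, (g + d); rewrite F1 F2 addrA -rE; split.
have di1 : c d != i.
  by apply: contra dmix => /eqP E; rewrite E eqxx in di *; rewrite eq_sym -di.
have di2 : c (- d) != i by rewrite -di.
have [||E0 E1 E2] := type_add rD dD rdD mixr dmix; rewrite ?cr //.
split; rewrite ?E1 ?E2 //.
case: gen => [gr|[r0 [g [gr0 gD cg [cng gj] rE]]]].
  have [_ _ cnrj _] := gr; right; exists r, d; split=> //; first by rewrite E0.
  by split=> //; rewrite -cnrj -E0 eq_sym.
have [r0D cr0 cnr0 _] := gr0.
have := @root_triple _ _ _ _ _ rs r0 g d r0D gD dD; rewrite -rE => /(_ rD rdD)[[]|[]].
- move/eqP; rewrite addrC addr_eq0 => /eqP dE.
  by move: di2; rewrite dE opprK cr0 eqxx.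
- move=> r0dD; have [] := type_add r0D dD r0dD _ dmix; rewrite ?cr0 ?cnr0 //.
  by rewrite E0 -cng => E; rewrite E eqxx in gj.
- move/eqP; rewrite addrC addr_eq0 => /eqP dE.
  by left; rewrite rE dE addrK.
move=> gdD; have mixg : c g != c (- g) by rewrite cg eq_sym.
(* If -d has a color other than j, g + d is again of some type (j, l) with l different from j. If -d
   has color j, the degrees show that g + d has equal colors at both ends, and adding it to r0
   preserves congruence. *)
have [ndj|ndj] := eqVneq (c (- d)) j; last first.
  have [||F0 F1 F2] := type_add gD dD gdD mixg dmix.
  - by rewrite E0 -cng cg.
  - by rewrite cg.
  by right; exists r0, (g + d); rewrite F1 F2 addrA -rE; split.
left; rewrite rE -addrA; apply: congruent_add => //; last by rewrite addrA -rE.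
apply/eqP; rewrite eq_sym; apply/negPn/negP => mixgd.
have := (degree_eq1 (c (- (g + d))) (g + d)).2; rewrite eq_sym => /(_ (conj mixgd erefl)).
rewrite degreeD // /degree cg ndj E0 -cng.
by case: eqVneq => _; case: eqVneq.
Qed.

(** If a were not congruent to a0, the roots of degree -1 at i not generated from a0, together with
    their opposites, would form an absorbing set containing a, so some b in it would interact with
    a0. If b has degree -1, the sum would have degree -2. If b has degree 1, then a0 = -b + (a0 +
    b), and a0 + b, being 0 or of degree 0, makes -b generated. *)
Lemma congruent_type a : a \in D -> c a = i -> c (- a) = j -> congruent a.
Proof.
move=> aD ca cna; apply: NNPP => ncong.
pose K0 r := [/\ r \in D, c r = i, c (- r) != i & ~ row_generated r].
pose K r := K0 r \/ K0 (- r).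
have Ka : K a.
  left; split=> //; first by rewrite cna eq_sym.
  case=> _ _ _ [//|[r0 [g [_ _ _ [cng gj] _]]]].
  by rewrite cng cna eqxx in gj.
have KN b : K b -> K (- b) by rewrite /K opprK => -[]; [right | left].
have gen0 : row_generated a0.
  by split; rewrite ?cna0 // 1?eq_sym //; left; split=> //; apply: addvSl.
have genN b d : row_generated (b + d) -> b \in D -> d \in D -> degree i d = 0 -> row_generated b.
  move=> gbd bD dD d0; rewrite -[b](addrK d); apply: row_generated_add => //.
  - exact: rN.
  - by rewrite degreeN d0 oppr0.
  - by rewrite addrK.
have K0_add b d : b \in D -> ~ K b -> K0 d -> b + d \in D -> K (b + d).
  move=> bD nKb [dD cd cnd ngd] bdD.
  have dd : degree i d = -1 by apply/degree_eqN1.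
  have deg := degreeD i bD dD bdD; rewrite dd in deg.
  case: (degree_bound i b) => db; rewrite db in deg.
  - left; have [E1 E2] := (degree_eqN1 i (b + d)).1 deg; split=> //.
    by move=> g; apply: ngd; apply: (genN d b) => //; rewrite addrC.
  - have [E1 E2] := (degree_eq1 i b).1 db.
    have gnb : row_generated (- b).
      apply: NNPP => ng; apply: nKb; right; split=> //; first exact: rN.
      by rewrite opprK.
    case: ngd; rewrite -[d](addKr b); apply: row_generated_add => //.
    by rewrite addKr.
  - by have := degree_bound i (b + d); rewrite deg => -[].
have [|b [bD Kb ab]] := absorbing_interacts simL rs (K := K) aD Ka KN _ a0D.
  move=> b d bD dD nKb [Kd|Kd] bdD; first exact: K0_add.
  rewrite -[b + d]opprK; apply: (KN); rewrite opprD; apply: K0_add => //.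
  - exact: rN.
  - by move/KN; rewrite opprK.
  - by rewrite -opprD rN.
have d0 : degree i a0 = -1 by apply/degree_eqN1; rewrite cna0 eq_sym.
case: Kb => -[kD ck cnk ngk].
  have db : degree i b = -1 by apply/degree_eqN1.
  case: ab => [/color_opp|abD].
    by rewrite ck cna0 => E; move: ij; rewrite E eqxx.
  by have := degree_bound i (a0 + b); rewrite degreeD // d0 db => -[].
have db : degree i (- b) = -1 by apply/degree_eqN1.
case: ab => [/eqP|abD].
  by rewrite addr_eq0 => /eqP E; apply: ngk; rewrite -E.
apply: ngk; apply: (genN (- b) (a0 + b)) => //; first by rewrite addrCA addNr addr0.
by rewrite degreeD // d0 -[b]opprK degreeN db.
Qed.

End SameType.

(** * The Cartan parts and the directness of their sum *)

Lemma diag_space_ind (P : L -> Prop) i : P 0 ->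
  (forall (k : F) u v, P u -> P v -> P (k *: u + v)) ->
  (forall a, a \in D -> c a = i -> c (- a) = i ->
     P (lie (root_vector a) (root_vector (- a)))) ->
  forall t, t \in A i -> P t.
Proof.
move=> P0 PZD PT t tA; have [U UP] := pred_vspace P0 PZD.
apply/UP; apply: subvP tA; apply: sumv_seq_subP => a aD /andP[/eqP ca /eqP cna].
by rewrite -memvE; apply/UP/PT.
Qed.

Lemma diag_space_h i : (A i <= h)%VS.
Proof. by apply: sumv_seq_subP => a _ _; apply: (coroot_space_h rs). Qed.

(** For a of type (i, i), colors prevent b + a and b - a from being roots or 0. So the root vectors
    of a and -a commute with that of b, and so does their bracket. *)
Lemma diag_commute i j b t : b \in D -> c b = j -> c (- b) = j -> i != j ->
  t \in A i -> ev b t = 0.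
Proof.
move=> bD cb cnb ij; apply: (diag_space_ind (P := fun t => ev b t = 0)).
- by rewrite ev0r.
- by move=> k u v u0 v0; rewrite evP u0 v0 mulr0 addr0.
move=> a aD ca cna.
have comm d : d \in D -> c d = i -> c (- d) = i -> lie (root_vector d) (root_vector b) = 0.
  move=> dD cd cnd; apply/eqP/negPn/negP => db0.
  have [/color_opp|dbD] := lie_root_or0 rs (root_vectorP d) (root_vectorP b) db0.
    by rewrite cb cnd => E; rewrite E eqxx in ij.
  have bdD : b + d \in D by rewrite addrC.
  have := color_sub dD bD dbD; have := color_sub bD dD bdD.
  rewrite [b + d]addrC cd cb cnb cnd.
  case=> [E|E]; last by rewrite E eqxx in ij.
  by rewrite -E => -[] E'; rewrite E' eqxx in ij.
have th : lie (root_vector a) (root_vector (- a)) \in h.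
  by have := coroot_space_h rs a; rewrite -memvE.
have := lie_root th (root_vectorP b).
rewrite lie_jacobiE2 !comm ?opprK ?rN // !lie0r subrr => /esym/eqP.
by rewrite scaler_eq0 (negPf (root_vector_neq0 rs bD)) orbF => /eqP.
Qed.

Definition color_char i a : F := (degree i a)%:~R.

Lemma color_charN i a : color_char i (- a) = - color_char i a.
Proof. by rewrite /color_char degreeN intrN. Qed.

Lemma color_char0 i : color_char i 0 = 0.
Proof. by rewrite /color_char /degree oppr0 subrr. Qed.

Lemma color_charD i a b : a \in D -> b \in D -> a + b \in D ->
  color_char i (a + b) = color_char i a + color_char i b.
Proof. by move=> aD bD abD; rewrite /color_char degreeD // intrD. Qed.

Local Notation form i := (grading_form D (color_char i)).

Lemma form_coroot0 i a t : a \in D -> degree i a = 0 -> t \in T a -> form i t = 0.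
Proof.
move=> aD a0; apply: (grading_form0 rs) => //.
- exact: color_char0.
- by move=> *; apply: color_charN.
- by move=> *; apply: color_charD.
- by rewrite /color_char a0.
Qed.

Lemma form_diag0 i j t : t \in A j -> form i t = 0.
Proof.
apply: (diag_space_ind (P := fun t => form i t = 0)).
- by rewrite /grading_form big1 // => b _; rewrite ev0r mulr0.
- by move=> k u v u0 v0; rewrite grading_formP u0 v0 mulr0 addr0.
move=> a aD ca cna; apply: (form_coroot0 aD); last exact: memv_line.
by apply/degree_eq0; rewrite ca cna.
Qed.

Lemma form_inj i a t : a \in D -> degree i a != 0 -> t \in T a -> form i t = 0 -> t = 0.
Proof.
move=> aD ia tT; apply: (grading_form_inj rs) tT => //.
- exact: color_char0.
- by move=> *; apply: color_charN.
- by move=> *; apply: color_charD.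
rewrite /color_char; case: (degree_bound i a) ia => -> //= _; first exact: oner_neq0.
by rewrite oppr_eq0 oner_neq0.
Qed.

(** The form attached to the coordinate c(a) vanishes on every diagonal space but not on T_a. This
    is what tells two completions apart. *)
Lemma coroot_not_diag i a : a \in D -> c a != c (- a) -> ~~ (T a <= A i)%VS.
Proof.
move=> aD mixa; apply/negP; rewrite -memvE => tA.
have d0 : degree (c a) a != 0.
  by rewrite (degree_eqN1 _ _).2 // eq_sym.
have t0 := form_inj aD d0 (memv_line _) (form_diag0 (c a) tA).
have := grading_form_coroot rs (color_char0 (c a)) (fun b _ => color_charN (c a) b)
  (@color_charD (c a)) aD.
case=> k k0; rewrite t0 /grading_form big1 => [/esym/eqP|b _]; last by rewrite ev0r mulr0.
rewrite mulf_eq0 (negPf k0) orbF /color_char (degree_eqN1 _ _).2; last by rewrite eq_sym.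
by rewrite intrN oppr_eq0 oner_eq0.
Qed.

Section Frame.
Variables (k : 'I_m) (e : 'I_m -> dual_space h).
Hypotheses (ek : e k = 0) (frame : forall i j, i != j ->
  [/\ e i - e j \in D, c (e i - e j) = i & c (- (e i - e j)) = j]).

Lemma frame_root i : i != k -> [/\ e i \in D, c (e i) = i & c (- e i) = k].
Proof. by move=> /frame; rewrite ek subr0. Qed.

Definition cartan_part i : {vspace L} := (A i + (if i == k then 0 else T (e i)))%VS.

Lemma cartan_part_h i : (cartan_part i <= h)%VS.
Proof.
rewrite subv_add diag_space_h; case: eqP => _; first exact: sub0v.
exact: (coroot_space_h rs).
Qed.

Lemma frame_coroot i j : i != j -> (T (e i - e j) <= cartan_part i + cartan_part j)%VS.
Proof.
move=> ij; have part l : l != k -> (T (e l) <= cartan_part l)%VS.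
  by move=> lk; rewrite /cartan_part (negPf lk) addvSr.
have [sD _ _] := frame ij.
have [jk|jk] := eqVneq j k.
  rewrite jk ek subr0; apply: subv_trans (addvSl _ _); apply: part; by rewrite -jk.
have [ejD _ _] := frame_root jk.
have [ik|ik] := eqVneq i k.
  rewrite ik ek sub0r coroot_spaceN; apply: subv_trans (addvSr _ _); exact: part.
have [eiD _ _] := frame_root ik.
apply: subv_trans (coroot_spaceD rs eiD (rN ejD) sD) _.
by rewrite coroot_spaceN addvS ?part.
Qed.

Lemma coroot_cartan_part a : a \in D -> (T a <= cartan_part (c a) + cartan_part (c (- a)))%VS.
Proof.
move=> aD; have [same|mix] := eqVneq (c a) (c (- a)).
  apply: subv_trans (addvSl _ _); apply: subv_trans (addvSl _ _).
  exact: coroot_diag.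
have [sD cs cns] := frame mix.
have [_ _ _ Ta] := congruent_type sD cs cns mix aD erefl erefl.
apply: subv_trans Ta _; rewrite subv_add frame_coroot //=.
by rewrite addvS ?addvSl.
Qed.

Lemma cartan_part_full : (h <= \sum_i cartan_part i)%VS.
Proof.
apply/subvP => x /(h_coroots simL rs); apply: subvP; apply: sumv_seq_subP => a aD _.
apply: subv_trans (coroot_cartan_part aD) _.
by rewrite subv_add (sumv_sup (c a)) // (sumv_sup (c (- a))).
Qed.

Lemma cartan_part_independent (t : 'I_m -> L) :
  (forall i, t i \in cartan_part i) -> \sum_i t i = 0 -> forall i, t i = 0.
Proof.
move=> tP sum0.
have ex i : exists u, exists w, [/\ u \in A i,
    w \in (if i == k then 0 else T (e i))%VS & t i = u + w].
  by have /memv_addP[u uA [w wT ->]] := tP i; exists u, w.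
pose u i := sval (constructive_indefinite_description _ (ex i)).
have uA i : u i \in A i /\ exists2 w, w \in (if i == k then 0 else T (e i))%VS & t i = u i + w.
  by rewrite /u; case: constructive_indefinite_description => v [w []]; split=> //; exists w.
have form_sum j (f : 'I_m -> L) : form j (\sum_i f i) = \sum_i form j (f i).
  apply: (big_morph (grading_form D (color_char j))) => [x y|].
    by rewrite -[x]scale1r grading_formP mul1r scale1r.
  by rewrite /grading_form big1 // => b _; rewrite ev0r mulr0.
have tu i : t i = u i.
  have [ui [w wT tE]] := uA i; suff w0 : w = 0 by rewrite tE w0 addr0.
  have [ik|ik] := eqVneq i k; first by move: wT; rewrite ik eqxx memv0 => /eqP.
  rewrite (negPf ik) in wT; have [eD ce cne] := frame_root ik.
  apply: (form_inj eD _ wT).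
    by rewrite (degree_eqN1 _ _).2 // ce cne eq_sym.
  (* Only the T_(e_i) component survives in this form: e_j has degree 0 at i when j is neither i nor
     k, and the index k carries no line. *)
  have : form i (\sum_j t j) = 0.
    by rewrite sum0 /grading_form big1 // => b _; rewrite ev0r mulr0.
  rewrite form_sum (bigD1 i) //= big1 ?addr0 => [|j ji].
    by rewrite tE -[u i]scale1r grading_formP (form_diag0 _ ui) mulr0 add0r.
  have [uj [w' wT' ->]] := uA j.
  rewrite -[u j]scale1r grading_formP (form_diag0 _ uj) mulr0 add0r.
  have [jk|jk] := eqVneq j k.
    move: wT'; rewrite jk eqxx memv0 => /eqP ->.
    by rewrite /grading_form big1 // => b _; rewrite ev0r mulr0.
  rewrite (negPf jk) in wT'; have [ejD cej cnej] := frame_root jk.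
  apply: (form_coroot0 ejD _ wT').
  by apply/degree_eq0; rewrite cej cnej (negPf ji) eq_sym (negPf ik).
move=> i; rewrite tu; have [ui _] := uA i.
apply: (coroot_center0 charF0 rs ui) => b bD /andP[/eqP cb /eqP cnb].
(* The root b of type (i, i) vanishes on every other u_j, so the relation leaves b(u_i) = 0. *)
have : ev b (\sum_j u j) = 0 by rewrite -(eq_bigr _ (fun j _ => tu j)) sum0 ev0r.
have ev_sum (f : 'I_m -> L) : ev b (\sum_i f i) = \sum_i ev b (f i).
  by apply: (big_morph (ev b)) => [x y|]; rewrite ?ev_addr ?ev0r.
rewrite ev_sum (bigD1 i) //= big1 ?addr0 // => j ji.
by have [uj _] := uA j; apply: diag_commute bD cb cnb ji uj.
Qed.

End Frame.
End Coloring.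

(** * Completions and decompositions *)

Section Forms.
Variables (F : closedFieldType) (charF0 : [pchar F] =i pred0).
Variables (L : lieAlgType F) (h : {vspace L}) (simL : lie_simple L).
Variables (D : seq (dual_space h)) (Q : dual_space h -> 'End(L)).
Hypothesis rs : root_structure D Q.
Implicit Types (a b : dual_space h) (s : {vspace L}) (A B : {fset dual_space h}).

Notation R := root_space.
Notation T := coroot_space.

Definition form_space s A : {vspace L} := (s + \sum_(a <- A) R a)%VS.

Lemma root_sub_sum A a : a \in A -> (R a <= \sum_(b <- A) R b)%VS.
Proof. by move=> aA; rewrite (perm_big _ (perm_to_rem aA)) big_cons addvSl. Qed.

Lemma proj_sum0 (r : seq (dual_space h)) a v : a \notin r ->
  v \in (\sum_(b <- r) R b)%VS -> Q a v = 0.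
Proof.
move=> ar vr; apply/eqP; rewrite -memv_ker; apply: subvP vr.
apply: sumv_seq_subP => b br _; apply/subvP => u uR; rewrite memv_ker.
by rewrite (rs_proj0 rs _ uR) //; apply: contraNneq ar => ->.
Qed.

Lemma proj_h0 a x : a \in D -> x \in h -> Q a x = 0.
Proof.
by move=> aD; rewrite (mem_h rs) => xR; rewrite (rs_proj0 rs _ xR) // (root_neq0 rs).
Qed.

Lemma mem_form s A v : (s <= h)%VS -> {subset A <= D} ->
  v \in form_space s A <-> Q 0 v \in s /\ (forall a, a \in D -> a \notin A -> Q a v = 0).
Proof.
move=> sh AD; split=> [/memv_addP[t ts [u uA ->]]|[Q0v Qv]].
  have th := subvP sh t ts; split=> [|a aD aA].
    rewrite linearD /= (QRid rs) -?(mem_h rs) // (proj_sum0 _ uA) ?addr0 //.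
    by apply: contra (root_zero rs) => /AD.
  by rewrite linearD /= proj_h0 // (proj_sum0 aA uA) addr0.
rewrite [v](rs_sum rs); apply: memv_add => //; rewrite big_seq rpred_sum // => a aD.
have [aA|aA] := boolP (a \in A); last by rewrite Qv // mem0v.
by apply: (subvP (root_sub_sum aA)); apply: (QR rs).
Qed.

Lemma form_root_mem s A a v : (s <= h)%VS -> {subset A <= D} -> a \in D -> v \in R a ->
  v != 0 -> v \in form_space s A -> a \in A.
Proof.
move=> sh AD aD vR v0 /(mem_form _ sh AD)[_ Qv]; apply: contraR v0 => aA.
by rewrite -(QRid rs vR) Qv.
Qed.

Lemma root_sub_form s A a : a \in A -> (R a <= form_space s A)%VS.
Proof. by move=> aA; apply: subv_trans (addvSr _ _); apply: root_sub_sum. Qed.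

Lemma form_add s s' A B : (form_space s A + form_space s' B)%VS =
  form_space (s + s')%VS (A `|` B)%fset.
Proof.
rewrite /form_space -!addvA; congr (_ + _)%VS.
rewrite addvA [(_ + s')%VS]addvC -addvA; congr (_ + _)%VS; apply/eqP.
rewrite eqEsubv subv_add !sumv_seq_subP //= => a aAB _.
- by move: aAB; rewrite in_fsetU => /orP[] /root_sub_sum sub; apply: subv_trans sub _;
    rewrite ?addvSl ?addvSr.
- by apply: root_sub_sum; rewrite in_fsetU aAB orbT.
- by apply: root_sub_sum; rewrite in_fsetU aAB.
Qed.

Lemma dim_root_sum (r : seq (dual_space h)) : uniq r ->
  \dim (\sum_(a <- r) R a) = (\sum_(a <- r) \dim (R a))%N.
Proof.
elim: r => [|a r IHr] /=; first by rewrite !big_nil dimv0.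
case/andP=> ar ur; rewrite !big_cons -IHr // dimv_disjoint_sum //.
apply/eqP; rewrite -subv0; apply/subvP => v; rewrite memv_cap => /andP[vR vr].
by rewrite memv0 -(QRid rs vR) (proj_sum0 ar vr).
Qed.

Lemma directv_form s A : (s <= h)%VS -> {subset A <= D} ->
  directv (s + \sum_(a <- A) R a).
Proof.
move=> sh AD; rewrite directv_addE /= directv_trivial directvE /=.
rewrite dim_root_sum ?fset_uniq // eqxx /= -subv0; apply/subvP => v; rewrite memv_cap => /andP[vs vA].
rewrite memv0 -(QRid rs (a := 0) (v := v)) -?(mem_h rs); last exact: (subvP sh).
by rewrite (proj_sum0 _ vA) //; apply: contra (root_zero rs) => /AD.
Qed.

Lemma regular_formE s A : (s <= h)%VS -> {subset A <= D} ->
  regular_form (form_space s A) s A.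
Proof.
by move=> sh AD; split=> //; [move=> a /AD; rewrite (rs_mem rs) | exact: directv_form].
Qed.

Lemma form_subalgebra s A : (s <= h)%VS -> {subset A <= D} ->
  closed_subset (root_system h) A -> (forall a, a \in A -> - a \in A -> (T a <= s)%VS) ->
  lie_subalgebra (form_space s A).
Proof.
move=> sh AD clA TA x y.
move=> /(mem_form _ sh AD)[Q0x Qx] /(mem_form _ sh AD)[Q0y Qy].
have Q0xh := Q0_h rs x; have Q0yh := Q0_h rs y.
have inA a z : a \in D -> (a \notin A -> z = 0) -> z \in R a -> z \in form_space s A.
  move=> aD z0 zR; have [aA|aA] := boolP (a \in A); last by rewrite z0 // mem0v.
  exact: (subvP (root_sub_form s aA)).
rewrite [x](rs_sum rs) [y](rs_sum rs) lieDl !lieDr.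
apply: rpredD; apply: rpredD.
- by rewrite (h_abelian rs) ?mem0v.
- rewrite lie_sumr big_seq rpred_sum // => a aD.
  rewrite (lie_root Q0xh (QR rs a y)) rpredZ //.
  by apply: (inA a) => //; [apply: Qy | apply: (QR rs)].
- rewrite lie_suml big_seq rpred_sum // => a aD.
  rewrite lieC rpredN (lie_root Q0yh (QR rs a x)) rpredZ //.
  by apply: (inA a) => //; [apply: Qx | apply: (QR rs)].
rewrite lie_suml big_seq rpred_sum // => a aD.
rewrite lie_sumr big_seq rpred_sum // => b bD.
have [aA|aA] := boolP (a \in A); last by rewrite Qx // lie0l mem0v.
have [bA|bA] := boolP (b \in A); last by rewrite Qy // lie0r mem0v.
have [->|xy0] := eqVneq (lie (Q a x) (Q b y)) 0; first exact: mem0v.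
have [ab0|abD] := lie_root_or0 rs (QR rs a x) (QR rs b y) xy0.
  have bE : b = - a by apply/eqP; rewrite -addr_eq0 addrC ab0.
  apply: (subvP (addvSl _ _)); apply: (subvP (TA a aA _)); first by rewrite -bE.
  by rewrite bE (lie_coroot rs) ?(QR rs).
apply: (subvP (root_sub_form s (clA a b aA bA _))); first by rewrite -(rs_mem rs).
by rewrite root_lie ?(QR rs).
Qed.

(** * From a partition to a decomposition *)

Section Completion.
Variables (m : nat) (S : 'I_m -> {fset dual_space h}) (c : dual_space h -> 'I_m).
Hypotheses (partS : regular_partition (root_system h) S)
  (Sc : forall a i, a \in D -> (a \in S i) = (c a == i)).

Local Lemma S_sub i : {subset S i <= D}.
Proof.
by move=> a aS; case: partS => _ [cover _] _ _ _; rewrite (rs_mem rs) cover; apply/existsP; exists i.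
Qed.

(** Closedness of the parts and of their unions controls all brackets of root vectors except those
    of opposite roots; the last two conditions place the latter in the Cartan parts. *)
Lemma cartan_completion_of (s : 'I_m -> {vspace L}) :
  (forall i, s i <= h)%VS -> (h <= \sum_i s i)%VS ->
  (forall t : 'I_m -> L, (forall i, t i \in s i) -> \sum_i t i = 0 -> forall i, t i = 0) ->
  (forall a, a \in D -> c a = c (- a) -> (T a <= s (c a))%VS) ->
  (forall a, a \in D -> (T a <= s (c a) + s (c (- a)))%VS) ->
  cartan_completion S s.
Proof.
case: partS => m2 [cover _] Sn0 cl1 cl2 sh full indep T1 T2.
exists (fun i => form_space (s i) (S i)); last first.
  by move=> i; apply: regular_formE => //; apply: S_sub.
split=> //.
- split.
    apply/eqP; rewrite eqEsubv subvf /=; apply/subvP => v _.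
    rewrite [v](rs_sum rs) rpredD //.
      apply: (subvP (subv_trans full _) _ (Q0_h rs v)).
      apply/subv_sumP => i _; apply: (sumv_sup i) => //; exact: addvSl.
    rewrite big_seq rpred_sum // => a aD.
    apply: (subvP (sumv_sup (c a) _ (root_sub_form _ _)) _ (QR rs a v)) => //.
    by rewrite Sc.
  apply/directv_sum_independent => t tP sum0 i _.
  have {}tP j : t j \in form_space (s j) (S j) by apply: tP.
  have tQ j := (mem_form (t j) (sh j) (@S_sub j)).1 (tP j).
  have Qsum a : \sum_j Q a (t j) = 0 by rewrite -linear_sum sum0 linear0.
  have Q0t := indep (fun j => Q 0 (t j)) (fun j => (tQ j).1) (Qsum 0).
  rewrite [t i](rs_sum rs) Q0t add0r big_seq big1 // => a aD.
  have [ai|ai] := eqVneq (c a) i; last by apply: (tQ i).2; rewrite ?Sc.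
  have := Qsum a; rewrite (bigD1 i) //= big1 ?addr0 // => j ji.
  by apply: (tQ j).2; rewrite ?Sc // ai eq_sym.
- move=> i; have /fset0Pn[a aS] := Sn0 i; have aD := S_sub aS.
  apply/negP => /eqP g0; have /negP[] := root_vector_neq0 rs aD.
  by rewrite -memv0 -g0 (subvP (root_sub_form _ aS)) // root_vectorP.
- split=> [i|i j ij].
    apply: form_subalgebra => //; first exact: S_sub.
    move=> a aS naS; have aD := S_sub aS; have naD := S_sub naS.
    move: aS naS; rewrite !Sc // => /eqP ca /eqP cna.
    by rewrite -ca; apply: T1; rewrite // ca cna.
  rewrite form_add; apply: form_subalgebra.
  + by rewrite subv_add !sh.
  + by move=> a; rewrite in_fsetU => /orP[]; apply: S_sub.
  + exact: cl2.
  have sub l : (l == i) || (l == j) -> (s l <= s i + s j)%VS.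
    by case/orP=> /eqP ->; rewrite ?addvSl ?addvSr.
  move=> a aS naS; have aD : a \in D by move: aS; rewrite in_fsetU => /orP[]; apply: S_sub.
  move: aS naS; rewrite !in_fsetU !Sc ?(root_opp rs) // => ca cna.
  apply: subv_trans (T2 a aD) _.
  by rewrite subv_add !sub.
- by move=> i; exists (s i), (S i); apply: regular_formE => //; apply: S_sub.
Qed.

Lemma partition_color_add a b : a \in D -> b \in D -> a + b \in D ->
  c (a + b) = c a \/ c (a + b) = c b.
Proof.
case: partS => _ _ _ cl1 cl2 aD bD abD.
have abR : a + b \in root_system h by rewrite -(rs_mem rs).
have aS : a \in S (c a) by rewrite Sc.
have bS : b \in S (c b) by rewrite Sc.
have [ab|ab] := eqVneq (c a) (c b).
  by left; have := cl1 (c a) a b aS; rewrite {1}ab bS => /(_ isT abR); rewrite Sc // => /eqP.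
have := cl2 _ _ ab a b; rewrite !in_fsetU aS bS orbT => /(_ isT isT abR).
by rewrite !Sc // => /orP[]/eqP ->; [left | right].
Qed.

Lemma partition_color_surj i : exists2 a, a \in D & c a = i.
Proof.
case: partS => _ _ Sn0 _ _; have /fset0Pn[a aS] := Sn0 i.
by exists a; [exact: S_sub aS | apply/eqP; rewrite -Sc // (S_sub aS)].
Qed.

Lemma two_completions : (3 <= m)%N -> exists s s' : 'I_m -> {vspace L},
  [/\ cartan_completion S s, cartan_completion S s' & exists i, s i <> s' i].
Proof.
move=> m3; have cD := partition_color_add; have cs := partition_color_surj.
have [a aD mixa] := mixed_root simL rs cD cs m3.
have comp a' : a' \in D -> c a' != c (- a') -> exists e : 'I_m -> dual_space h,
    e (c a') = a' /\ cartan_completion S (cartan_part D c (c (- a')) e).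
  move=> a'D mix; have [e [ek ei fr]] := frame_exists simL rs cD cs a'D mix.
  exists e; split=> //; apply: cartan_completion_of.
  - exact: (cartan_part_h rs).
  - exact: (cartan_part_full simL rs cD cs m3 ek fr).
  - exact: (cartan_part_independent charF0 simL rs cD cs m3 ek fr).
  - move=> b bD cb; apply: subv_trans (addvSl _ _).
    by apply: coroot_diag; rewrite -?cb.
  - by move=> b bD; apply: (coroot_cartan_part simL rs cD cs m3 ek fr).
have [e [_ compe]] := comp a aD mixa.
have naD := root_opp rs aD.
have [|e' [e'a compe']] := comp (- a) naD; first by rewrite opprK eq_sym.
exists (cartan_part D c (c (- a)) e), (cartan_part D c (c (- - a)) e'); split=> //.
(* At this index the first completion has only the diagonal space, the second contains T_(-a) = T_a
   as well. *)
exists (c (- a)); rewrite /cartan_part eqxx addv0 opprK eq_sym (negPf mixa) e'a coroot_spaceN => E.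
have /negP := coroot_not_diag simL rs cD cs m3 (c (- a)) aD mixa; apply.
by rewrite E addvSr.
Qed.

End Completion.

Lemma partition_color m (S : 'I_m -> {fset dual_space h}) :
  regular_partition (root_system h) S ->
  exists c : dual_space h -> 'I_m, forall a i, a \in D -> (a \in S i) = (c a == i).
Proof.
case=> m2 [cover disj] _ _ _; pose i0 : 'I_m := Ordinal (leq_trans (isT : 0 < 2)%N m2).
(* The default [i0] is taken only off the root system. *)
exists (fun a => odflt i0 [pick i | a \in S i]) => a i; rewrite (rs_mem rs) cover.
case: pickP => [l aSl _ /=|none /existsP[l]]; last by move: (none l) => /= ->.
apply/idP/eqP => [aSi|<- //]; apply/eqP/negPn/negP => li.
by have /fdisjointP/(_ a aSl) := disj _ _ li; rewrite aSi.
Qed.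

Lemma decomposition_partition m (g s : 'I_m -> {vspace L}) (S : 'I_m -> {fset dual_space h}) :
  regular_decomposition h g -> (forall i, regular_form (g i) (s i) (S i)) ->
  regular_partition (root_system h) S.
Proof.
move=> [m2 [gfull gdir] gn0 [sub1 sub2] _] forms.
have sh i : (s i <= h)%VS by case: (forms i).
have SD i : {subset S i <= D} by move=> a aS; rewrite (rs_mem rs); case: (forms i) => _ sub _ _; apply: sub.
have gE i : g i = form_space (s i) (S i) by case: (forms i).
have ind := directv_sum_independent gdir.
have disj i j v : i != j -> v \in g i -> v \in g j -> v = 0.
  move=> ij vi vj.
  have := ind (fun l => if l == i then v else if l == j then - v else 0).
  move=> /(_ _ _ i isT); rewrite eqxx; apply=> [l _|].
    by case: eqP => [->//|_]; case: eqP => [->|_]; rewrite ?rpredN ?mem0v.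
  have ji : (j == i) = false by rewrite eq_sym (negPf ij).
  rewrite (bigD1 i) //= eqxx (bigD1 j) ?ji //= eqxx addrA subrr add0r.
  by rewrite big1 // => l /andP[/negPf -> /negPf ->].
have g_add i j : (g i + g j)%VS = form_space (s i + s j)%VS (S i `|` S j)%fset.
  by rewrite !gE form_add.
have sh2 i j : (s i + s j <= h)%VS by rewrite subv_add !sh.
have SD2 i j : {subset (S i `|` S j)%fset <= D}.
  by move=> a; rewrite in_fsetU => /orP[]; apply: SD.
have closed s' A : (s' <= h)%VS -> {subset A <= D} -> lie_subalgebra (form_space s' A) ->
    closed_subset (root_system h) A.
  move=> s'h AD subA a b aA bA; rewrite -(rs_mem rs) => abD.
  have [aD bD] := (AD a aA, AD b bA).
  apply: (form_root_mem s'h AD abD) (root_lie_neq0 rs aD bD abD) _.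
    by rewrite root_lie ?root_vectorP.
  by apply: subA; [apply: (subvP (root_sub_form _ aA)) | apply: (subvP (root_sub_form _ bA))];
    apply: root_vectorP.
have cover a : a \in D -> exists i, a \in S i.
  move=> aD; apply: NNPP => none; have /negP[] := root_vector_neq0 rs aD.
  have : root_vector a \in (\sum_i g i)%VS by rewrite gfull memvf.
  move=> vg; rewrite -(QRid rs (root_vectorP a)) -memv_ker; apply: subvP vg; apply/subv_sumP => i _.
  apply/subvP => v; rewrite gE memv_ker => /(mem_form _ (sh i) (SD i))[_ Qv].
  by rewrite Qv //; apply/negP => aS; apply: none; exists i.
split=> //.
- split=> [a|i j ij].
    rewrite -(rs_mem rs); apply/idP/existsP => [/cover //|[i /SD //]].
  apply/fdisjointP => a ai; apply/negP => aj; have aD := SD i a ai.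
  have /negP[] := root_vector_neq0 rs aD; apply/eqP/(disj i j) => //; rewrite gE.
    exact: (subvP (root_sub_form _ ai)) (root_vectorP _).
  exact: (subvP (root_sub_form _ aj)) (root_vectorP _).
- move=> i; apply/negP => /eqP Si0; have /negP[] := gn0 i.
  (* With S_i empty, g_i lies in h. But h is the sum of the T_a, and each T_a lies in the subalgebra
     spanned by the summands whose parts contain a and -a, both different from g_i; this contradicts
     directness. *)
  have hs : (h <= \sum_(j | j != i) g j)%VS.
    apply/subvP => x /(h_coroots simL rs); apply: subvP; apply: sumv_seq_subP => a aD _.
    have [j aj] := cover a aD; have [l al] := cover _ (root_opp rs aD).
    have ji : j != i by apply: contraTneq aj => ->; rewrite Si0 in_fset0.
    have li : l != i by apply: contraTneq al => ->; rewrite Si0 in_fset0.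
    apply: (@subv_trans _ _ (g j + g l)%VS); last first.
      by rewrite subv_add (sumv_sup j) // (sumv_sup l).
    have [jl|jl] := eqVneq j l.
      rewrite -memvE -jl addvv; apply: sub1; rewrite gE.
        exact: (subvP (root_sub_form _ aj)) (root_vectorP _).
      by rewrite -jl in al; apply: (subvP (root_sub_form _ al)) (root_vectorP _).
    rewrite -memvE; apply: sub2 => //; [apply: (subvP (addvSl _ _)) | apply: (subvP (addvSr _ _))]; rewrite gE.
      exact: (subvP (root_sub_form _ aj)) (root_vectorP _).
    exact: (subvP (root_sub_form _ al)) (root_vectorP _).
  have gi : (g i <= h)%VS by rewrite gE /form_space Si0 big_seq_fset0 addv0.
  have /directv_sumP/(_ i isT) := gdir; rewrite -subv0 => <-.
  by rewrite subv_cap subvv (subv_trans gi hs).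
- by move=> i; apply: (closed (s i)) => //; rewrite -gE.
- by move=> i j ij; apply: (closed (s i + s j)%VS) => //; rewrite -g_add; apply: sub2.
Qed.

End Forms.

(** * A regular partition for sl_3 *)

Section TracelessMatrices.
Variable F : fieldType.

Definition mxtr_lfun : 'Hom('M[F]_3, F^o) := linfun (fun A : 'M[F]_3 => \tr A : F^o).

Definition sl3 := subvs_of (lker mxtr_lfun).
HB.instance Definition _ := Vector.on sl3.

Definition sl3_mx (x : sl3) : 'M[F]_3 := vsval x.
Lemma sl3_mx_linear : linear sl3_mx.
Proof. by move=> k x y; apply: linearP. Qed.
HB.instance Definition _ := GRing.isLinear.Build F sl3 'M[F]_3 *:%R sl3_mx sl3_mx_linear.
Definition sl3_of_mx (A : 'M[F]_3) : sl3 := vsproj (lker mxtr_lfun) A.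

Lemma mem_traceless A : (A \in lker mxtr_lfun) = (\tr A == 0).
Proof. by rewrite memv_ker lfunE. Qed.

Lemma sl3_of_mxK A : \tr A = 0 -> sl3_mx (sl3_of_mx A) = A.
Proof. by move=> A0; rewrite /sl3_mx vsprojK // mem_traceless A0. Qed.

Lemma sl3_tr x : \tr (sl3_mx x) = 0.
Proof. by apply/eqP; rewrite -mem_traceless subvsP. Qed.

Lemma sl3_inj : injective sl3_mx.
Proof. exact: val_inj. Qed.

Definition sl3_lie (x y : sl3) : sl3 :=
  sl3_of_mx (sl3_mx x *m sl3_mx y - sl3_mx y *m sl3_mx x).

Lemma sl3_lie_mx x y : sl3_mx (sl3_lie x y) = sl3_mx x *m sl3_mx y - sl3_mx y *m sl3_mx x.
Proof. by rewrite sl3_of_mxK // raddfB /= mxtrace_mulC subrr. Qed.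

Lemma sl3_lie_linearl y : linear (sl3_lie^~ y).
Proof.
move=> k u v; apply: sl3_inj; rewrite sl3_mx_linear !sl3_lie_mx sl3_mx_linear.
by rewrite mulmxDl mulmxDr -scalemxAl -scalemxAr scalerBr opprD addrACA.
Qed.

Lemma sl3_lie_linearr x : linear (sl3_lie x).
Proof.
move=> k u v; apply: sl3_inj; rewrite sl3_mx_linear !sl3_lie_mx sl3_mx_linear.
by rewrite mulmxDl mulmxDr -scalemxAl -scalemxAr scalerBr opprD addrACA.
Qed.

Lemma sl3_liexx x : sl3_lie x x = 0.
Proof. by apply: sl3_inj; rewrite sl3_lie_mx subrr linear0. Qed.

Lemma sl3_jacobi x y z :
  sl3_lie x (sl3_lie y z) + sl3_lie y (sl3_lie z x) + sl3_lie z (sl3_lie x y) = 0.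
Proof.
apply: sl3_inj; rewrite !linearD linear0 /= !sl3_lie_mx.
move: (sl3_mx x) (sl3_mx y) (sl3_mx z) => A B C.
rewrite !mulmxBl !mulmxBr !mulmxA.
move: (A *m B *m C) (A *m C *m B) (B *m C *m A) (B *m A *m C) (C *m A *m B) (C *m B *m A).
by move=> p1 p2 p3 p4 p5 p6; apply/matrixP => i j; rewrite !mxE; ring.
Qed.

HB.instance Definition _ := Vector_isLieAlgebra.Build F sl3
  sl3_lie_linearl sl3_lie_linearr sl3_liexx sl3_jacobi.

Hypothesis charF0 : [pchar F] =i pred0.
Implicit Types (x y z : sl3) (i j k l p q : 'I_3).

Lemma lie_sl3 x y : sl3_mx (lie x y) = sl3_mx x *m sl3_mx y - sl3_mx y *m sl3_mx x.
Proof. exact: sl3_lie_mx. Qed.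

Definition elem i j : sl3 := sl3_of_mx (delta_mx i j).

Lemma elem_mx i j : i != j -> sl3_mx (elem i j) = delta_mx i j.
Proof.
move=> ij; rewrite sl3_of_mxK // /mxtrace big1 // => k _; rewrite mxE.
by case: eqVneq => // ->; rewrite (negPf ij).
Qed.

Lemma delta_mulE (A : 'M[F]_3) i j p q : (delta_mx i j *m A) p q = (p == i)%:R * A j q.
Proof.
rewrite mxE (bigD1 j) //= mxE eqxx andbT big1 ?addr0 // => k kj.
by rewrite mxE (negPf kj) andbF mul0r.
Qed.

Lemma mul_deltaE (A : 'M[F]_3) i j p q : (A *m delta_mx i j) p q = A p i * (q == j)%:R.
Proof.
rewrite mxE (bigD1 i) //= mxE eqxx /= big1 ?addr0 // => k ki.
by rewrite mxE (negPf ki) mulr0.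
Qed.

Lemma delta_mul_delta (A : 'M[F]_3) i j k l :
  delta_mx i j *m A *m delta_mx k l = A j k *: delta_mx i l.
Proof.
apply/matrixP => p q; rewrite mul_deltaE delta_mulE !mxE.
by case: (p == i); case: (q == l); rewrite ?mul1r ?mulr1 ?mul0r ?mulr0.
Qed.

Lemma lie_elem i j k : i != j -> j != k -> i != k -> lie (elem i j) (elem j k) = elem i k.
Proof.
move=> ij jk ik; apply: sl3_inj; rewrite lie_sl3 !elem_mx // mul_delta_mx mul_delta_mx_0 1?eq_sym //.
exact: subr0.
Qed.

Lemma diag_lieE x (d : 'rV[F]_3) y p q : sl3_mx x = diag_mx d ->
  sl3_mx (lie x y) p q = (d 0 p - d 0 q) * sl3_mx y p q.
Proof. by move=> xd; rewrite lie_sl3 xd mul_diag_mx mul_mx_diag !mxE; ring. Qed.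

Lemma sl3_of_diagK (d : 'rV[F]_3) : \sum_i d 0 i = 0 ->
  sl3_mx (sl3_of_mx (diag_mx d)) = diag_mx d.
Proof. by move=> d0; rewrite sl3_of_mxK // mxtrace_diag. Qed.

Lemma sl3_ideal_full (U : {vspace sl3}) : lie_ideal U -> U != 0%VS -> U = fullv.
Proof.
move=> idU Un0.
have idU' x y : x \in U -> lie x y \in U by move=> xU; rewrite lieC rpredN idU.
have two0 : (2 : F) != 0 by rewrite (natf0 charF0).
have three0 : (3 : F) != 0 by rewrite (natf0 charF0).
have [x xU x0] : exists2 x, x \in U & x != 0.
  by exists (vpick U); [exact: memv_pick | rewrite vpick0].
have scale i j (k : F) y : i != j -> k != 0 -> y \in U -> sl3_mx y = k *: delta_mx i j ->
    elem i j \in U.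
  move=> ij k0 yU yE; suff -> : elem i j = k^-1 *: y by rewrite rpredZ.
  by apply: sl3_inj; rewrite linearZ /= yE scalerA mulVf // scale1r elem_mx.
have [i [j [ij eU]]] : exists i j, i != j /\ elem i j \in U.
  have [/existsP[i /existsP[j /andP[ij xji]]]|off] :=
      boolP [exists i, exists j, (i != j) && (sl3_mx x j i != 0)].
    exists i, j; split=> //.
    (* The double bracket [E_ij, [E_ij, x]] equals -2 x_ji E_ij. *)
    apply: (scale i j (- 2 * sl3_mx x j i) (lie (elem i j) (lie (elem i j) x))) => //.
    - by rewrite mulf_neq0 // oppr_eq0.
    - by rewrite idU // idU.
    rewrite !lie_sl3 elem_mx // mulmxBl mulmxBr !mulmxA mul_delta_mx_0 1?eq_sym // mul0mx.
    rewrite -[X in _ - (_ - X)]mulmxA mul_delta_mx_0 1?eq_sym // mulmx0 !delta_mul_delta.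
    by rewrite subr0 sub0r -opprD -scalerDl -scaleNr; congr (_ *: _); ring.
  have xd i j : i != j -> sl3_mx x i j = 0.
    move=> ij; apply/eqP/negPn/negP => xij; move/negP: off; apply.
    by apply/existsP; exists j; apply/existsP; exists i; rewrite eq_sym ij.
  have [/existsP[i /existsP[j /andP[ij xij]]]|ndiff] :=
      boolP [exists i, exists j, (i != j) && (sl3_mx x i i != sl3_mx x j j)].
    exists i, j; split=> //.
    apply: (scale i j (sl3_mx x i i - sl3_mx x j j) (lie x (elem i j))) => //.
    - by rewrite subr_eq0.
    - exact: idU'.
    apply/matrixP => p q; rewrite (diag_lieE (d := \row_l sl3_mx x l l)); last first.
      by apply/matrixP => r t; rewrite !mxE; case: eqVneq => [->|rt]; rewrite ?mulr1n // mulr0n xd.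
    by rewrite !mxE elem_mx // mxE; case: eqVneq => [->|]; case: eqVneq => [->|]; rewrite ?mulr0.
  have same i j : sl3_mx x i i = sl3_mx x j j.
    have [-> //|ij] := eqVneq i j; apply/eqP/negPn/negP => xij; move/negP: ndiff; apply.
    by apply/existsP; exists i; apply/existsP; exists j; rewrite ij.
  (* What remains is a scalar matrix of trace 0, which vanishes because 3 is invertible. *)
  case/eqP: x0; apply: sl3_inj; rewrite linear0; apply/matrixP => i j; rewrite [RHS]mxE.
  have [->|/xd //] := eqVneq i j; have := sl3_tr x.
  rewrite /mxtrace (eq_bigr (fun=> sl3_mx x j j)) => [|l _]; last exact: same.
  rewrite sumr_const card_ord -mulr_natr => /eqP.
  by rewrite mulf_eq0 (negPf three0) orbF => /eqP.
have row i' j' k : i' != j' -> k != i' -> elem i' j' \in U -> elem i' k \in U.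
  move=> ij' ki eU'; have [-> //|kj] := eqVneq k j'.
  have [jk ik] : j' != k /\ i' != k by rewrite ![_ == k]eq_sym.
  by rewrite -(lie_elem ij' jk ik) idU'.
have col i' j' k : i' != j' -> k != j' -> elem i' j' \in U -> elem k j' \in U.
  move=> ij' kj eU'; have [-> //|ki] := eqVneq k i'.
  by rewrite -(lie_elem ki ij' kj) idU.
have allE p q : p != q -> elem p q \in U.
  (* Row and column indices are changed one at a time; the case p = j makes a detour through the
     third index r. *)
  move=> pq; have [pj|pj] := eqVneq p j; last first.
    by apply: (row p j q) => //; [rewrite eq_sym | apply: (col i j p)].
  have [r [ri rj]] : exists r, r != i /\ r != j.
    suff /set0Pn[r] : ~: [set i; j] != set0 by rewrite !inE negb_or => /andP[]; exists r.
    by rewrite -card_gt0 cardsCs setCK card_ord subn_gt0 cards2; case: (i != j).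
  apply: (row p r q); [by rewrite pj eq_sym | by rewrite eq_sym |].
  apply: (col i r p); [by rewrite eq_sym | by rewrite pj eq_sym |].
  by apply: (row i j r).
apply/eqP; rewrite eqEsubv subvf; apply/subvP => y _.
pose i0 : 'I_3 := @Ordinal 3 0 isT; pose i1 : 'I_3 := @Ordinal 3 1 isT.
pose i2 : 'I_3 := @Ordinal 3 2 isT.
(* The diagonal is written in E_00 - E_11 and E_11 - E_22; the coefficient of E_11 comes out right
   because the trace is 0. *)
have -> : y = sl3_mx y i0 i0 *: lie (elem i0 i1) (elem i1 i0)
    + (- sl3_mx y i2 i2) *: lie (elem i1 i2) (elem i2 i1)
    + (sl3_mx y i0 i1 *: elem i0 i1 + sl3_mx y i1 i0 *: elem i1 i0)
    + (sl3_mx y i0 i2 *: elem i0 i2 + sl3_mx y i2 i0 *: elem i2 i0)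
    + (sl3_mx y i1 i2 *: elem i1 i2 + sl3_mx y i2 i1 *: elem i2 i1).
  apply: sl3_inj.
  have ZE (k : F) v : sl3_mx (k *: v) = k *: sl3_mx v by exact: linearZ.
  have DE u v : sl3_mx (u + v) = sl3_mx u + sl3_mx v by exact: linearD.
  rewrite !(DE, ZE) !lie_sl3 !elem_mx // !mul_delta_mx.
  have : sl3_mx y i1 i1 = - sl3_mx y i0 i0 - sl3_mx y i2 i2.
    have := sl3_tr y; rewrite /mxtrace !big_ord_recr big_ord0 /= add0r => /eqP.
    rewrite (_ : widen_ord _ _ = i0); last exact: val_inj.
    rewrite (_ : widen_ord _ _ = i1); last exact: val_inj.
    rewrite (_ : ord_max = i2); last exact: val_inj.
    by move=> yt; apply/eqP; rewrite -subr_eq0 -(eqP yt); apply/eqP; ring.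
  move: (sl3_mx y) => A A11; apply/matrixP => p q; rewrite !mxE.
  have cases (r : 'I_3) : [\/ r = i0, r = i1 | r = i2].
    by case: r => [[|[|[|//]]] lr]; [constructor 1 | constructor 2 | constructor 3]; apply: val_inj.
  by case: (cases p) => ->; case: (cases q) => ->; rewrite ?A11 /=; ring.
by rewrite !rpredD ?rpredZ ?idU ?allE.
Qed.

Lemma sl3_simple : lie_simple sl3.
Proof.
split; last first.
  by move=> U idU; have [->|/(sl3_ideal_full idU)] := eqVneq U 0%VS; [left | right].
pose i0 : 'I_3 := @Ordinal 3 0 isT; pose i1 : 'I_3 := @Ordinal 3 1 isT.
exists (elem i0 i1), (elem i1 i0); apply/negP => /eqP/(congr1 sl3_mx)/matrixP/(_ i0 i0).
rewrite linear0 lie_sl3 !elem_mx // !mul_delta_mx !mxE /= => /eqP.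
by rewrite subr0 oner_eq0.
Qed.

(** This keeps the entries off the diagonal, so that its kernel consists of the diagonal
    matrices. *)
Definition diag_part (x : sl3) : 'M[F]_3 := \matrix_(i, j) (sl3_mx x i j *+ (i != j)).

Lemma diag_part_linear : linear diag_part.
Proof.
by move=> k x y; apply/matrixP => i j; rewrite mxE sl3_mx_linear !mxE mulrnDl mulrnAr.
Qed.
HB.instance Definition _ := GRing.isLinear.Build F sl3 'M[F]_3 *:%R diag_part diag_part_linear.

Definition sl3_diag : {vspace sl3} := lker (linfun diag_part).

Lemma mem_sl3_diag x : reflect (exists d, sl3_mx x = diag_mx d) (x \in sl3_diag).
Proof.
rewrite memv_ker lfunE /=; apply: (iffP eqP) => [x0|[d xd]]; last first.
  by apply/matrixP => i j; rewrite !mxE xd mxE; case: eqVneq => [|_]; rewrite ?mulr0n ?mul0rn.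
exists (\row_i sl3_mx x i i); apply/matrixP => i j; rewrite !mxE.
have [->|ij] := eqVneq i j; first by rewrite mulr1n.
by move/matrixP/(_ i j): x0; rewrite !mxE ij mulr1n mulr0n.
Qed.

Lemma sl3_diagE x i j : x \in sl3_diag -> i != j -> sl3_mx x i j = 0.
Proof. by move=> /mem_sl3_diag[d ->] ij; rewrite mxE (negPf ij). Qed.

Lemma sl3_diag_lieE x y i j : x \in sl3_diag ->
  sl3_mx (lie x y) i j = (sl3_mx x i i - sl3_mx x j j) * sl3_mx y i j.
Proof.
by move=> /mem_sl3_diag[d xd]; rewrite (diag_lieE _ _ _ xd) xd !mxE !eqxx !mulr1n.
Qed.

Lemma sl3_diag_abelian x y : x \in sl3_diag -> y \in sl3_diag -> lie x y = 0.
Proof.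
move=> xh yh; apply: sl3_inj; rewrite linear0; apply/matrixP => i j.
rewrite sl3_diag_lieE // mxE; have [->|ij] := eqVneq i j; first by rewrite subrr mul0r.
by rewrite (sl3_diagE yh) // mulr0.
Qed.

(* 3 E_qq - 1 reads off the coefficient of a weight at e_q. *)
Definition diag_test q : sl3 := sl3_of_mx (diag_mx (\row_i (3 *+ (i == q) - 1))).

Lemma diag_test_mx q : sl3_mx (diag_test q) = diag_mx (\row_i (3 *+ (i == q) - 1)).
Proof.
rewrite sl3_of_diagK // (eq_bigr (fun i => 3 *+ (i == q) - 1)) => [|i _]; last by rewrite mxE.
rewrite sumrB (bigD1 q) //= eqxx mulr1n big1 => [|i /negPf -> //].
by rewrite addr0 sumr_const card_ord subrr.
Qed.

Lemma diag_testP q : diag_test q \in sl3_diag.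
Proof. by apply/mem_sl3_diag; eexists; apply: diag_test_mx. Qed.

Lemma sl3_cartan : cartan_subalgebra sl3_diag.
Proof.
split.
- by move=> x y xh yh; rewrite sl3_diag_abelian // mem0v.
- exists 1; apply/eqP; rewrite -subv0; apply/lie_prodvP => x y xh yh.
  by rewrite sl3_diag_abelian // mem0v.
move=> x norm; apply/mem_sl3_diag; exists (\row_i sl3_mx x i i).
apply/matrixP => i j; rewrite !mxE; have [->|ij] := eqVneq i j; first by rewrite mulr1n.
(* The (i, j) entry of the bracket of [diag_test i] with x is 3 x_ij. *)
have := norm _ (diag_testP i); rewrite lieC rpredN => /sl3_diagE/(_ ij)/eqP.
rewrite sl3_diag_lieE ?diag_testP // diag_test_mx !mxE !eqxx !mulr1n [j == i]eq_sym (negPf ij) mulr0n.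
have -> : 3 - 1 - (0 - 1) = 3 :> F by ring.
by rewrite mulf_eq0 (natf0 charF0) mulr0n => /eqP.
Qed.

(** * The roots of sl_3 and their partition *)

Definition sl3_root_fun i j (y : subvs_of sl3_diag) : F^o :=
  sl3_mx (vsval y) i i - sl3_mx (vsval y) j j.

Lemma sl3_root_linear i j : linear (sl3_root_fun i j).
Proof.
move=> k u v; rewrite /sl3_root_fun (vsval_is_linear k u v) sl3_mx_linear !mxE.
by rewrite opprD addrACA scalerBr.
Qed.
HB.instance Definition _ i j :=
  GRing.isLinear.Build F (subvs_of sl3_diag) F^o *:%R (sl3_root_fun i j) (sl3_root_linear i j).

Definition sl3_root i j : dual_space sl3_diag := linfun (sl3_root_fun i j).

Lemma sl3_rootE i j y : y \in sl3_diag ->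
  sl3_root i j (vsproj sl3_diag y) = sl3_mx y i i - sl3_mx y j j.
Proof. by move=> yh; rewrite lfunE /= /sl3_root_fun vsprojK. Qed.

Lemma sl3_root_test i j q :
  sl3_root i j (vsproj sl3_diag (diag_test q)) = (i == q)%:R * 3 - (j == q)%:R * 3 :> F.
Proof.
rewrite sl3_rootE ?diag_testP // diag_test_mx !mxE !eqxx !mulr1n.
by case: (i == q); case: (j == q); rewrite ?mulr1n ?mulr0n; ring.
Qed.

(** A nonzero (p, q) entry of an eigenvector forces its weight to be e_p - e_q; if all nonzero
    entries are diagonal, the weight is 0. *)
Lemma sl3_rootP a : reflect (exists i j, i != j /\ a = sl3_root i j)
  (a \in root_system sl3_diag).
Proof.
have three0 : (3 : F) != 0 by rewrite (natf0 charF0).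
apply: (iffP andP) => [[a0 Ra0]|[i [j [ij ->]]]]; last first.
  split.
    apply/negP => /eqP/(congr1 (fun b : dual_space sl3_diag => b (vsproj sl3_diag (diag_test i)))).
    rewrite sl3_root_test zero_lfunE eqxx [j == i]eq_sym (negPf ij) mul0r subr0 mul1r => /eqP.
    by rewrite (negPf three0).
  apply/negP => /eqP R0; have : elem i j \in root_space (sl3_root i j).
    apply/root_spaceP => y yh; rewrite sl3_rootE //; apply: sl3_inj; apply/matrixP => p q.
    rewrite sl3_diag_lieE // linearZ /= [RHS]mxE elem_mx // mxE.
    by case: eqVneq => [->|]; case: eqVneq => [->|]; rewrite ?mulr0.
  rewrite R0 memv0 => /eqP/(congr1 sl3_mx)/matrixP/(_ i j).
  by rewrite elem_mx // linear0 !mxE !eqxx => /eqP; rewrite oner_eq0.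
set v := vpick (root_space a).
have /root_spaceP vR : v \in root_space a by exact: memv_pick.
have v0 : v != 0 by rewrite vpick0.
have entry y p q : y \in sl3_diag -> sl3_mx v p q != 0 ->
    a (vsproj sl3_diag y) = sl3_mx y p p - sl3_mx y q q.
  move=> yh vpq; apply: (mulIf vpq); rewrite -sl3_diag_lieE // vR //.
  by rewrite linearZ /= mxE.
have [/existsP[p /existsP[q /andP[pq vpq]]]|off] :=
    boolP [exists p, exists q, (p != q) && (sl3_mx v p q != 0)].
  exists p, q; split=> //; apply/lfunP => y; rewrite -[y]vsvalK sl3_rootE ?subvsP //.
  by rewrite (entry _ p q) ?subvsP.
have [p [q vpq]] : exists p q, sl3_mx v p q != 0.
  apply: NNPP => none; case/eqP: v0; apply: sl3_inj; rewrite linear0; apply/matrixP => p q.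
  by rewrite [RHS]mxE; apply/eqP/negPn/negP => vpq; apply: none; exists p, q.
have pq : p = q.
  apply/eqP/negPn/negP => pq; case/negP: off.
  by apply/existsP; exists p; apply/existsP; exists q; rewrite pq.
case/eqP: a0; apply/lfunP => y; rewrite zero_lfunE -[y]vsvalK.
by rewrite (entry _ p q) ?subvsP // pq subrr.
Qed.

(** The coefficient of e_q is -1 on the right, while on the left it would be nonnegative if q were
    neither i nor k; [diag_test q] reads it off up to the factor 3. *)
Lemma sl3_root_color i j k l p q : p != q ->
  sl3_root j i + sl3_root l k = sl3_root p q -> q = i \/ q = k.
Proof.
move=> pq E; have [|qi] := eqVneq q i; first by left.
have [|qk] := eqVneq q k; first by right.
have := congr1 (fun b : dual_space sl3_diag => b (vsproj sl3_diag (diag_test q))) E.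
rewrite add_lfunE !sl3_root_test (negPf pq) eqxx ![_ == q]eq_sym (negPf qi) (negPf qk) => /eqP.
rewrite -subr_eq0 => T; have : ((q == j) + (q == l)).+1%:R * 3 == 0 :> F.
  apply: etrans T; congr (_ == 0); rewrite -natr1 natrD /=; ring.
by rewrite mulf_eq0 !(natf0 charF0).
Qed.

Lemma sl3_root_inj_color i j k l : j != i -> sl3_root j i = sl3_root l k -> i = k.
Proof.
move=> ji E; apply/eqP/negPn/negP => ik.
have := congr1 (fun b : dual_space sl3_diag => b (vsproj sl3_diag (diag_test i))) E.
rewrite !sl3_root_test (negPf ji) eqxx [k == i]eq_sym (negPf ik) => /eqP.
rewrite eq_sym -subr_eq0 => T; have : (l == i).+1%:R * 3 == 0 :> F.
  apply: etrans T; congr (_ == 0); rewrite -natr1 /=; ring.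
by rewrite mulf_eq0 !(natf0 charF0).
Qed.

Definition sl3_part i : {fset dual_space sl3_diag} :=
  seq_fset tt [seq sl3_root j i | j <- [seq j <- enum 'I_3 | j != i]].

Lemma sl3_partP a i : reflect (exists2 j, j != i & a = sl3_root j i) (a \in sl3_part i).
Proof.
rewrite seq_fsetE; apply: (iffP mapP) => [[j jin ->]|[j ji ->]]; exists j => //.
  by move: jin; rewrite mem_filter => /andP[].
by rewrite mem_filter ji mem_enum.
Qed.

Lemma sl3_partition : regular_partition (root_system sl3_diag) sl3_part.
Proof.
(* Any union of parts is closed, because the negative index of a sum is one of those of its terms.
   Here I selects the parts, one or two of them below. *)
have closed (A : {fset dual_space sl3_diag}) (I : pred 'I_3) :
    (forall a, reflect (exists j i, [/\ I i, j != i & a = sl3_root j i]) (a \in A)) ->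
    closed_subset (root_system sl3_diag) A.
  move=> AP a b /AP[j [i [Ii ji ->]]] /AP[l [k [Ik lk ->]]] /sl3_rootP[p [q [pq E]]].
  apply/AP; exists p, q; split=> //.
  by have [->|->] := sl3_root_color pq E.
split=> //.
- split=> [a|i k ik].
    apply/sl3_rootP/existsP => [[j [i [ji ->]]]|[i /sl3_partP[j ji ->]]].
      by exists i; apply/sl3_partP; exists j.
    by exists j, i.
  apply/fdisjointP => a /sl3_partP[j ji ->]; apply/negP => /sl3_partP[l lk].
  by move/(sl3_root_inj_color ji) => E; rewrite E eqxx in ik.
- move=> i; apply/fset0Pn.
  suff /set0Pn[j] : ~: [set i] != set0.
    by rewrite !inE => ji; exists (sl3_root j i); apply/sl3_partP; exists j.
  by rewrite -card_gt0 cardsCs setCK card_ord subn_gt0 cards1.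
- move=> i; apply: (closed _ (pred1 i)) => a; apply: (iffP (sl3_partP a i)).
    by case=> j ji ->; exists j, i; split=> //=.
  by case=> j [i' [/eqP -> ji ->]]; exists j.
move=> i k ik; apply: (closed _ (pred2 i k)) => a; rewrite in_fsetU.
apply: (iffP orP) => [[]/sl3_partP[j ji ->]|[j [l [/= /orP[]/eqP -> ji ->]]]].
- by exists j, i; rewrite /= eqxx.
- by exists j, k; rewrite /= eqxx orbT.
- by left; apply/sl3_partP; exists j.
- by right; apply/sl3_partP; exists j.
Qed.

End TracelessMatrices.

(** * The theorem *)

Theorem proposition4p1 (F : closedFieldType) (charF0 : [pchar F] =i pred0) :
  [/\ (* every m-regular partition, m >= 3, is completed by Cartan parts *)
      forall (L : lieAlgType F) (h : {vspace L}),
        lie_simple L -> cartan_subalgebra h ->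
        forall (m : nat) (S : 'I_m -> {fset dual_space h}),
          (3 <= m)%N -> regular_partition (root_system h) S ->
          exists s : 'I_m -> {vspace L}, cartan_completion S s,
      (* the Cartan parts are not unique in general *)
      exists (L : lieAlgType F) (h : {vspace L}) (m : nat)
             (S : 'I_m -> {fset dual_space h}) (s s' : 'I_m -> {vspace L}),
        [/\ lie_simple L /\ cartan_subalgebra h,
            (3 <= m)%N /\ regular_partition (root_system h) S,
            cartan_completion S s,
            cartan_completion S s'
          & exists i, s i <> s' i]
    & (* forgetting the Cartan parts of a decomposition yields a partition *)
      forall (L : lieAlgType F) (h : {vspace L}),
        lie_simple L -> cartan_subalgebra h ->
        forall (m : nat) (g s : 'I_m -> {vspace L}) (S : 'I_m -> {fset dual_space h}),
          regular_decomposition h g ->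
          (forall i, regular_form (g i) (s i) (S i)) ->
          regular_partition (root_system h) S].
Proof.
(* Two different completions exist for every regular partition with m >= 3, so existence and the
   example of non-uniqueness come from one statement. *)
have two (L : lieAlgType F) (h : {vspace L}) m (S : 'I_m -> {fset dual_space h}) :
    lie_simple L -> cartan_subalgebra h -> (3 <= m)%N ->
    regular_partition (root_system h) S -> exists s s' : 'I_m -> {vspace L},
    [/\ cartan_completion S s, cartan_completion S s' & exists i, s i <> s' i].
  move=> simL carth m3 partS.
  have [D [Q rs]] := root_structure_exists charF0 simL carth.
  have [c Sc] := partition_color rs partS.
  exact: (two_completions charF0 simL rs partS Sc m3).
split.
- move=> L h simL carth m S m3 partS.
  by have [s [_ [compS _ _]]] := two L h m S simL carth m3 partS; exists s.
- exists (sl3 F), (sl3_diag F), 3, (@sl3_part F).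
  have simL := sl3_simple charF0; have carth := sl3_cartan charF0.
  have partS := sl3_partition charF0.
  have [s [s' [compS compS' ne]]] := two _ _ _ _ simL carth (leqnn 3) partS.
  by exists s, s'.
move=> L h simL carth m g s S decg forms.
have [D [Q rs]] := root_structure_exists charF0 simL carth.
exact: (decomposition_partition simL rs decg forms).
Qed.
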